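(* Let $D\subseteq\mathbb R^n$, $f_i\in C^3(D;\mathbb R^n)$ for $i=1,\dots,m$, and $g:\mathbb R\times D\to\mathbb R^n$, and consider the control system $$\dot x=g(t,x)+\sum_{i=1}^m f_i(x)u_i,\qquad x\in D\subseteq\mathbb R^n,\ u=(u_1,\dots,u_m)^\top\in\mathbb R^m. \qquad (\ast)$$ Let $S_1\subseteq\{1,\dots,m\}$, $S_2\subseteq\{1,\dots,m\}^2$, $S_3\subseteq\{1,\dots,m\}^3$ be sets of indices such that $|S_1|+|S_2|+|S_3|=n$ and, for each $x\in D$, $$\mathrm{span}\big\{f_i(x),\,[f_{j_1},f_{j_2}](x),\,[[f_{\ell_1},f_{\ell_2}],f_{\ell_3}](x)\ \big|\ i\in S_1,\ (j_1,j_2)\in S_2,\ (\ell_1,\ell_2,\ell_3)\in S_3\big\}=\mathbb R^n .$$ Suppose that there exists an $\alpha>0$ such that $\|\mathcal F^{-1}(x)\|\le\alpha$ for all $x\in D$, where $\mathcal F(x)$ is the $n\times n$ matrix $$\mathcal F(x)=\Big(\big(f_i(x)\big)_{i\in S_1}\ \big([f_{j_1},f_{j_2}](x)\big)_{(j_1,j_2)\in S_2}\ \big([[f_{\ell_1},f_{\ell_2}],f_{\ell_3}](x)\big)_{(\ell_1,\ell_2,\ell_3)\in S_3}\Big).$$ Assume also that there are $\mathcal M_g,\mathcal L_g\ge 0$ and $\delta_0>0$ such that $$\|g(t,x)\|\le\mathcal M_g\|x\|^3,\qquad \|g(t,x)-g(t,y)\|\le\mathcal L_g\|x-y\|\qquad\text{for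 all } t\ge 0,\ x,y\in B_{\delta_0}(0).$$ Let the controls be $u_k=h_k^\varepsilon(t,x)$, $k=1,\dots,m$, with $h_k^\varepsilon$ the control functions (depending on $\varepsilon>0$ and on the gain $\gamma>0$) defined in the context, with integer parameters $\kappa$ satisfying the absence-of-resonances assumption stated in the context. Then for any $\delta>0$ there exist $\gamma,\bar\varepsilon>0$ such that, for any $\varepsilon\in(0,\bar\varepsilon]$, the $\pi_\varepsilon$-solution $x(t)$ of system $(\ast)$ corresponding to the feedback $u=h^\varepsilon(t,x)$ with the initial data $x(0)=x^0\in B_\delta(0)$ is well-defined on $t\in[0,+\infty)$ and $$\|x(t)\|=O(e^{-\lambda t})\ \text{ as } t\to\infty,\ \text{ with some }\lambda>0.$$
   Context: **Notation.** $\|a\|$ is the Euclidean norm of a vector $a\in\mathbb R^n$; for an $n\times n$ matrix, $\|\mathcal F\|=\sup_{\|y\|=1}\|\mathcal F y\|$. $B_r(0)$ is the ball of radius $r$ centred at the origin of $\mathbb R^n$. $L_gf(x)=\lim_{s\to0}\frac{f(x+sg(x))-f(x)}{s}$ is the directional derivative, and $[f,g](x)=L_fg(x)-L_gf(x)$ is the Lie bracket. $\delta_{ki}$ is the Kronecker delta; $\sqrt[3]{\cdot}$ is the real cube root. **$\pi_\varepsilon$-solution.** For $\varepsilon>0$ put $t_j=\varepsilon j$, $j=0,1,2,\dots$. Given a feedback $u=h(t,x)$, $h:[0,+\infty)\times D\to\mathbb R^m$, and $x^0\in D$, a $\pi_\varepsilon$-solution of $\dot x=g(t,x)+\sum_{i=1}^m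 f_i(x)u_i$ corresponding to $x^0$ and $h$ is an absolutely continuous function $x(t)\in D$, defined for $t\in[0,+\infty)$, such that $x(0)=x^0$ and, for each $j=0,1,2,\dots$, $\dot x(t)=g(t,x(t))+\sum_{i=1}^m f_i(x(t))\,h_i(t,x(t_j))$ for $t\in[t_j,t_{j+1})$. **Control functions.** Given $\varepsilon,\gamma>0$, for $k=1,\dots,m$, $$h_k^\varepsilon(t,x)=\sum_{i_1\in S_1}a_{i_1}(x)\phi^{(k,\varepsilon)}_{i_1}(t)+\varepsilon^{-1/2}\sum_{(j_1,j_2)\in S_2}\sqrt{|a_{j_1j_2}(x)|}\,\phi^{(k,\varepsilon)}_{j_1j_2}(t,x)+\varepsilon^{-2/3}\sum_{(\ell_1,\ell_2,\ell_3)\in S_3}\sqrt[3]{a_{\ell_1\ell_2\ell_3}(x)}\,\phi^{(k,\varepsilon)}_{\ell_1\ell_2\ell_3}(t),$$ where the vector function $a(x)=\big(a_{i_1}(x)|_{i_1\in S_1},\,a_{j_1j_2}(x)|_{(j_1,j_2)\in S_2},\,a_{\ell_1\ell_2\ell_3}(x)|_{(\ell_1,\ell_2,\ell_3)\in S_3}\big)^\top\in\mathbb R^n$ (ordered as the columns of $\mathcal F$) is $$a(x)=-\gamma\,\mathcal F^{-1}(x)\,x,$$ and $\phi^{(k,\varepsilon)}_{i_1}(t)=\delta_{ki_1}$, $$\phi^{(k,\varepsilon)}_{j_1j_2}(t,x)=2\sqrt{\pi\kappa_{j_1j_2}}\Big(\delta_{kj_1}\,\mathrm{sign}(a_{j_1j_2}(x))\cos\tfrac{2\pi\kappa_{j_1j_2}t}{\varepsilon}+\delta_{kj_2}\sin\tfrac{2\pi\kappa_{j_1j_2}t}{\varepsilon}\Big),$$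 $$\phi^{(k,\varepsilon)}_{\ell_1\ell_2\ell_3}(t)=2\sqrt[3]{2\pi^2\kappa_{3\ell_1\ell_2\ell_3}\kappa_{4\ell_1\ell_2\ell_3}}\Big(\delta_{k\ell_1}\cos\tfrac{2\pi\kappa_{1\ell_1\ell_2\ell_3}t}{\varepsilon}+\delta_{k\ell_2}\sin\tfrac{2\pi\kappa_{2\ell_1\ell_2\ell_3}t}{\varepsilon}+\delta_{k\ell_3}\cos\tfrac{2\pi\kappa_{1\ell_1\ell_2\ell_3}t}{\varepsilon}\sin\tfrac{2\pi\kappa_{2\ell_1\ell_2\ell_3}t}{\varepsilon}\Big).$$ **Resonance.** There is a resonance of order $N\in\mathbb N$ between pairwise distinct numbers $k_1,\dots,k_p$ if there exist relatively prime integers $c_1,\dots,c_p$ with $|c_1|+\dots+|c_p|=N$ and $c_1k_1+\dots+c_pk_p=0$. **Absence-of-resonances assumption.** The positive integers $\kappa_{j_1j_2}$ ($(j_1,j_2)\in S_2$), $\kappa_{1\ell_1\ell_2\ell_3}$, $\kappa_{2\ell_1\ell_2\ell_3}$, $\kappa_{3\ell_1\ell_2\ell_3}=\kappa_{1\ell_1\ell_2\ell_3}+\kappa_{2\ell_1\ell_2\ell_3}$ and $\kappa_{4\ell_1\ell_2\ell_3}=\kappa_{2\ell_1\ell_2\ell_3}-\kappa_{1\ell_1\ell_2\ell_3}$ ($(\ell_1,\ell_2,\ell_3)\in S_3$) are pairwise distinct, and there are no third-order resonances between the numbers $\kappa_{s\ell_1\ell_2\ell_3}$ ($s=1,\dots,4$),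 except those imposed by the definition of $\kappa_{3\ell_1\ell_2\ell_3}$ and $\kappa_{4\ell_1\ell_2\ell_3}$.
   Formalization: D is taken open and the closed ball B_δ(0) is assumed to lie in D; g is also assumed measurable in t and locally Lipschitz in x on D, uniformly on bounded time intervals, since otherwise solutions need not exist (e.g. g=1/t² away from the origin). *)

(* Defs.v *)
From HB Require Import structures.
From mathcomp Require Import all_boot all_order all_algebra.
From mathcomp Require Import all_classical all_reals all_analysis.

Set Implicit Arguments.
Unset Strict Implicit.
Unset Printing Implicit Defensive.

Import Order.TTheory GRing.Theory Num.Theory.
Import numFieldNormedType.Exports.

Local Open Scope classical_set_scope.
Local Open Scope ring_scope.

(* Lets the library's Landau notations be used at +oo. *)
Canonical pinfty_filter_on (R : numFieldType) : filter_on R :=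
  FilterType (pinfty_nbhs R) proper_pinfty_nbhs.

Section Euclidean.
Context {R : realType} {n : nat}.
Implicit Types (D : set 'cV[R]_n) (f g : 'cV[R]_n -> 'cV[R]_n).

(* The library norm `|v| on 'cV[R]_n is the sup norm; the two induce the same
   topology, but all quantitative estimates below use this one. *)
Definition enorm (v : 'cV[R]_n) : R := Num.sqrt (\sum_i v i 0 ^+ 2).

Definition opnorm (A : 'M[R]_n) : R :=
  sup [set enorm (A *m y) | y in [set y | enorm y = 1]].

Definition eball (r : R) : set 'cV[R]_n := [set y | enorm y <= r].

(* Meant for open D: the values of the total function f outside D are then
   irrelevant, both here and for the derivatives below. *)
Fixpoint Ck (k : nat) D f : Prop :=
  (forall x, D x -> {for x, continuous f}) /\
  (if k is k'.+1 then
     forall i : 'I_n,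
       (forall x, D x -> derivable f x (delta_mx i 0)) /\
       Ck k' D ('D_(delta_mx i 0) f)
   else True).

(* [f, g] = L_f g - L_g f, where L_f g (x) is the derivative of g at x in the
   direction f x. *)
Definition lie f g : 'cV[R]_n -> 'cV[R]_n :=
  fun x => 'D_(f x) g x - 'D_(g x) f x.

Definition abs_continuous (x : R -> 'cV[R]_n) (T : R) : Prop :=
  forall e : R, 0 < e -> exists2 d : R, 0 < d &
    forall (N : nat) (a b : 'I_N -> R),
      (forall i, 0 <= a i /\ a i <= b i /\ b i <= T) ->
      trivIset setT (fun i => [set` `]a i, b i[]) ->
      \sum_i (b i - a i) < d ->
      \sum_i enorm (x (b i) - x (a i)) < e.

(* The usual regularity of the drift that makes the initial value problems
   well-posed: (Borel) measurability in time and a local Lipschitz condition in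
   space, uniform on bounded time intervals. *)
Definition caratheodory_lipschitz D (g : R -> 'cV[R]_n -> 'cV[R]_n) : Prop :=
  (forall x i, D x -> measurable_fun (`[0, +oo[ : set R) (fun t : R => g t x i 0)) /\
  (forall x (T : R), D x -> exists r L : R, 0 < r /\
     forall (t : R) y z, 0 <= t <= T -> D y -> D z ->
       enorm (y - x) < r -> enorm (z - x) < r ->
       enorm (g t y - g t z) <= L * enorm (y - z)).

End Euclidean.

Section PiSolution.
Context {R : realType} {m n : nat}.

(* The differential equation is required for almost every t, as is usual for
   absolutely continuous solutions. A solution is a total function of which
   only the restriction to [0, +oo) matters. *)
Definition pi_solution (D : set 'cV[R]_n) (g : R -> 'cV[R]_n -> 'cV[R]_n)
    (f : 'I_m -> 'cV[R]_n -> 'cV[R]_n) (h : 'I_m -> R -> 'cV[R]_n -> R)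
    (eps : R) (x0 : 'cV[R]_n) (x : R -> 'cV[R]_n) : Prop :=
  [/\ forall t : R, 0 <= t -> D (x t),
      forall T, abs_continuous x T,
      x 0 = x0 &
      forall j : nat, {ae @lebesgue_measure R, forall t,
        eps * j%:R <= t < eps * j.+1%:R ->
        is_derive t (1 : R) x
          (g t (x t) + \sum_i h i t (x (eps * j%:R)) *: f i (x t))}].

End PiSolution.

Section Controls.
Context {R : realType} {m n : nat}.
Variables (f : 'I_m -> 'cV[R]_n -> 'cV[R]_n).
Variables (S1 : {set 'I_m}) (S2 : {set 'I_m * 'I_m})
  (S3 : {set 'I_m * 'I_m * 'I_m}).
Hypothesis hn : (#|S1| + #|S2| + #|S3|)%N = n.
Implicit Types (x : 'cV[R]_n) (j : 'I_m * 'I_m) (l : 'I_m * 'I_m * 'I_m).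

Definition field2 j := lie (f j.1) (f j.2).
Definition field3 l := lie (lie (f l.1.1) (f l.1.2)) (f l.2).

Definition fields_at x : seq 'cV[R]_n :=
  [seq f i x | i <- enum S1] ++ [seq field2 j x | j <- enum S2] ++
  [seq field3 l x | l <- enum S3].

Definition Fmx x : 'M[R]_n :=
  castmx (erefl n, hn)
    (row_mx (row_mx (\matrix_(r < n, c < #|S1|) f (enum_val c) x r 0)
                    (\matrix_(r < n, c < #|S2|) field2 (enum_val c) x r 0))
            (\matrix_(r < n, c < #|S3|) field3 (enum_val c) x r 0)).

Definition avec (gamma : R) x : 'cV[R]_n := - (gamma *: (invmx (Fmx x) *m x)).

(* The entries of avec, split along the three column blocks of Fmx. *)
Definition avec_split gamma x : 'cV[R]_(#|S1| + #|S2| + #|S3|) :=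
  castmx (esym hn, erefl 1%N) (avec gamma x).
Definition a1 gamma x (c : 'I_#|S1|) : R :=
  usubmx (usubmx (avec_split gamma x)) c 0.
Definition a2 gamma x (c : 'I_#|S2|) : R :=
  dsubmx (usubmx (avec_split gamma x)) c 0.
Definition a3 gamma x (c : 'I_#|S3|) : R :=
  dsubmx (avec_split gamma x) c 0.

(* kap is the frequency attached to a pair, kap1 and kap2 the first two
   frequencies attached to a triple. *)
Variables (kap : 'I_m * 'I_m -> nat) (kap1 kap2 : 'I_m * 'I_m * 'I_m -> nat).

(* The subtraction in kap4 is truncated; nonresonant requires kap4 > 0 on S3,
   so that there it is the true difference. *)
Definition kap3 l : nat := (kap1 l + kap2 l)%N.
Definition kap4 l : nat := (kap2 l - kap1 l)%N.

Definition kaps (s : 'I_4) l : nat :=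
  nth 0%N [:: kap1 l; kap2 l; kap3 l; kap4 l] s.

Definition frequencies : seq nat :=
  [seq kap j | j <- enum S2] ++
  [seq kaps s l | s <- enum 'I_4, l <- enum S3].

(* The integers c witness a resonance of order N between the numbers k;
   "relatively prime" is joint, and zero coefficients are allowed. *)
Definition resonance (I : finType) (N : nat) (k : I -> nat) (c : I -> int) :
    Prop :=
  [/\ injective k, \big[gcdn/0%N]_i `|c i|%N = 1%N,
      (\sum_i `|c i|)%N = N & \sum_i c i * (k i)%:Z = 0].

(* The relations kap1 + kap2 - kap3 = 0 and kap1 - kap2 + kap4 = 0 of a single
   triple, up to a global sign. *)
Definition imposed (c : 'I_4 * 'I_#|S3| -> int) : Prop :=
  exists (l0 : 'I_#|S3|) (sg : bool) (rel3 : bool), forall s (i : 'I_#|S3|),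
    c (s, i) = (-1) ^+ sg * (i == l0)%:Z *
      nth 0 (if rel3 then [:: 1; 1; -1; 0] else [:: 1; -1; 0; 1]) s.

Definition nonresonant : Prop :=
  [/\ all (fun k => 0 < k)%N frequencies, uniq frequencies &
      forall c : 'I_4 * 'I_#|S3| -> int,
        resonance 3 (fun p => kaps p.1 (enum_val p.2)) c -> imposed c].

Definition cbrt (y : R) : R := Num.sg y * `|y| `^ (1 / 3).

Definition phi1 (k i : 'I_m) : R := (k == i)%:R.

Definition phi2 (k : 'I_m) j (eps av t : R) : R :=
  let w := 2 * pi * (kap j)%:R / eps in
  2 * Num.sqrt (pi * (kap j)%:R) *
    ((k == j.1)%:R * Num.sg av * cos (w * t) + (k == j.2)%:R * sin (w * t)).

Definition phi3 (k : 'I_m) l (eps t : R) : R :=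
  let w1 := 2 * pi * (kap1 l)%:R / eps in
  let w2 := 2 * pi * (kap2 l)%:R / eps in
  2 * cbrt (2 * pi ^+ 2 * (kap3 l)%:R * (kap4 l)%:R) *
    ((k == l.1.1)%:R * cos (w1 * t) + (k == l.1.2)%:R * sin (w2 * t) +
     (k == l.2)%:R * (cos (w1 * t) * sin (w2 * t))).

Definition control (gamma eps : R) (k : 'I_m) (t : R) x : R :=
  \sum_(c < #|S1|) a1 gamma x c * phi1 k (enum_val c) +
  eps `^ (- (1 / 2)) *
    \sum_(c < #|S2|) Num.sqrt `|a2 gamma x c| *
                     phi2 k (enum_val c) eps (a2 gamma x c) t +
  eps `^ (- (2 / 3)) *
    \sum_(c < #|S3|) cbrt (a3 gamma x c) * phi3 k (enum_val c) eps t.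

End Controls.

(* Main.v *)
Require Import Defs.
From HB Require Import structures.
From mathcomp Require Import all_boot all_order all_algebra.
From mathcomp Require Import all_classical all_reals all_analysis measurable_realfun.
From mathcomp Require Import ring lra zify.
Import Order.TTheory GRing.Theory Num.Theory.
Import numFieldNormedType.Exports.
Local Open Scope classical_set_scope.
Local Open Scope ring_scope.

Set Implicit Arguments.
Unset Strict Implicit.
Unset Printing Implicit Defensive.

(** Over one period of length eps the control is frozen at the sampled state p, so
    it is a constant part plus finitely many pure waves. Expanding the solution to
    third order along these waves, the iterated integrals of the waves over a period
    are explicit: distinctness of the frequencies leaves only the brackets of the
    pairs in S2, and the absence of third-order resonances leaves only the double
    brackets of the triples in S3. The amplitudes are tuned so that the surviving terms
    sum to eps F(p) a(p) = - eps gamma p. With s = (eps |p|)^(1/6), waves of pairs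
    have amplitude O(s^3) and waves of triples O(s^2), so the trajectory stays within
    O(s^2) of p, the remainder is o(s^6) = o(eps |p|), and the cubic bound makes the
    drift O(eps |p|^3) up to smaller terms. Hence
    |x(t_(j+1))| <= (1 - eps lam) |x(t_j)| for gamma large and eps small. *)

(** * Almost-everywhere differentiable functions *)

(** For fixed eps and p near the origin, [s^2 = (eps |p|)^(1/3)] is much larger than [|p|]: within a
    period the state may move farther than its own norm, and smallness is recovered only at the
    sampling times. The drift must therefore be bounded at distance [s^2] from p, and this is
    affordable because the cube of [s^2] is again [eps |p|]. For the same reason the decay between
    sampling times is slower than the decay along them, by a factor three in the rate. The main term
    has order [s^6], which dictates what must vanish exactly and what may be estimated. Products of
    two waves of triples have order [s^4] and mixed products of two have order [s^5], so their
    averages have to be zero. Products of three waves that include a wave of a pair have order at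
    most [s^7] and are bounded crudely; hence third-order resonances matter only among the
    frequencies of triples. The part of the rate lost to the drift does not depend on gamma, so
    gamma is fixed first and eps afterwards, although all other constants grow with gamma. *)

(* Cousin's lemma, as an induction principle on intervals. *)
Lemma additive_interval (R : realType) (P : R -> R -> Prop) (a b : R) : a <= b ->
  (forall s t u, a <= s <= t -> t <= u <= b -> P s t -> P t u -> P s u) ->
  (forall z, a <= z <= b -> exists2 d, 0 < d & forall s t, a <= s <= z ->
     z <= t <= b -> z - d < s -> t < z + d -> P s t) ->
  P a b.
Proof.
move=> ab Padd Ploc.
have Paa : P a a.
  have [d d0] := Ploc a ltac:(lra); apply; lra.
pose S := [set t | a <= t <= b /\ P a t].
have Sa : S a by split => //; lra.
have hS : has_sup S by split; [exists a | exists b => t [/andP[]]].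
set c := sup S.
have ac : a <= c by apply: sup_upper_bound.
have cb : c <= b by apply: ge_sup => [|t [/andP[]]//]; exists a.
have [d d0 Pd] := Ploc c ltac:(lra).
have Pac : P a c.
  have [t [/andP[at_ tb] Pt] ct] := sup_adherent d0 hS.
  have tc : t <= c by apply: sup_upper_bound => //; split => //; lra.
  apply: (Padd a t c) => //; [lra|lra|].
  by apply: Pd => //; lra.
have [->//|cltb] := eqVneq b c.
have {cltb} cltb : c < b by rewrite lt_neqAle eq_sym cltb.
pose t := Num.min b (c + d / 2).
have tc : c < t by rewrite lt_min cltb /=; lra.
have tb : t <= b by rewrite ge_min lexx.
have td : t <= c + d / 2 by rewrite ge_min lexx orbT.
suff : t <= c by lra.
apply: sup_upper_bound => //; split; first lra.
apply: (Padd a c t) => //; [lra|lra|apply: Pd; lra].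
Qed.

Section ac.
Context {R : realType} {V : normedModType R}.

Definition ac_on (F : R -> V) (a b : R) : Prop :=
  forall e : R, 0 < e -> exists2 d : R, 0 < d &
    forall (N : nat) (s t : 'I_N -> R),
      (forall i, a <= s i /\ s i <= t i /\ t i <= b) ->
      trivIset setT (fun i => [set` `]s i, t i[]) ->
      \sum_i (t i - s i) < d -> \sum_i `|F (t i) - F (s i)| < e.

Definition lip_on (F : R -> V) (a b : R) : Prop :=
  exists K : R, forall s t, a <= s <= b -> a <= t <= b ->
    `|F t - F s| <= K * `|t - s|.

Lemma lip_ac F a b : lip_on F a b -> ac_on F a b.
Proof.
move=> [K hK] e e0; pose K' := `|K| + 1.
have K0 : 0 < K' by rewrite /K' ltr_wpDl.
exists (e / K'); first exact: divr_gt0.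
move=> N s t h _ hs; rewrite ltr_pdivlMr // in hs.
apply: le_lt_trans hs; rewrite mulr_suml; apply: ler_sum => i _.
have [h1 [h2 h3]] := h i.
apply: (le_trans (hK (s i) (t i) _ _)); [lra|lra|].
rewrite ger0_norm ?subr_ge0 // mulrC; apply: ler_wpM2l; first by rewrite subr_ge0.
by rewrite /K' (le_trans (ler_norm K)) // lerDl.
Qed.

(** The quotient is cleared, so the estimate also holds at [s = t]; this is the form in which the
    inductions on intervals consume a derivative at a point. *)
Lemma is_deriveP (F : R -> V) (t : R) v : is_derive t (1:R) F v <->
  forall e : R, 0 < e -> exists2 d, 0 < d & forall s, `|s - t| < d ->
    `|F s - F t - (s - t) *: v| <= e * `|s - t|.
Proof.
split.
  move=> [dF <-] e e0.
  have /eqaddoP /(_ e e0) := derivable_nbhs dF.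
  move/nbhs_ballP => -[d /= d0 hd]; exists d => // s sd.
  have -> : F s - F t - (s - t) *: 'D_1 F t =
      F ((s - t) *: 1 + t) - (F t + (s - t) *: 'D_1 F t).
    by rewrite opprD addrA scaler1 subrK.
  by apply: (hd (s - t)); rewrite -ball_normE /= sub0r normrN.
move=> h.
suff H : (fun h : R => h^-1 *: ((F \o shift t) (h *: 1) - F t)) @ 0^' --> v.
  split; first by apply/cvg_ex; exists v.
  exact: cvg_lim.
apply/cvgrPdist_le => e e0; have [d d0 hd] := h e e0.
rewrite near_withinE; near=> u => u0 /=.
have -> : v - u^-1 *: (F (u *: 1 + t) - F t) =
    - (u^-1 *: (F (u + t) - F t - u *: v)).
  by rewrite scaler1 [in RHS]scalerBr scalerA mulVf // scale1r opprB.
rewrite normrN normrZ normfV ler_pdivrMl ?normr_gt0 // mulrC.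
have := hd (u + t); rewrite addrK; apply.
near: u; apply/nbhs_ballP; exists d => //= u; by rewrite -ball_normE /= sub0r normrN.
Unshelve. all: by end_near. Qed.

(* The exceptional null set is covered by an open set on which absolute continuity
   makes the total increment small; elsewhere the derivative bounds the increment. *)
Lemma ae_mvi (F : R -> V) (a b B : R) : a <= b -> 0 <= B -> ac_on F a b ->
  {ae @lebesgue_measure R, forall t, a <= t <= b ->
     exists2 v, is_derive t (1:R) F v & `|v| <= B} ->
  `|F b - F a| <= B * (b - a).
Proof.
move=> ab Bge0 acF [A [mA A0 hA]].
have B0 : 0 <= b - a by lra.
apply/ler_addgt0Pr => e e0.
pose e1 := e / 2 / (b - a + 1).
have e10 : 0 < e1 by rewrite /e1 !divr_gt0 //; lra.
have [d d0 hd] := acF (e / 2) (divr_gt0 e0 (ltr0n _ 2)).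
have [|U [oU AU Ud]] := @lebesgue_regularity_outer R A d mA _ d0.
  by rewrite [X in (X < _)%E]A0.
have mU : measurable U by exact: open_measurable.
have {}Ud : (lebesgue_measure U < d%:E)%E.
  have -> : U = (U `\` A) `|` A by rewrite setUC setDUK.
  rewrite measureU //; last 2 first.
  - exact: measurableD.
  - by rewrite setDKI.
  by rewrite [X in (_ + X)%E]A0 adde0.
(* This invariant is additive, since two families can be concatenated. Absolute continuity is
   invoked once, for the final family, whose total length is at most the measure of [U], hence below
   [d]. *)
pose P s t := exists N (l r : 'I_N -> R),
  [/\ forall i, s <= l i /\ l i <= r i /\ r i <= t,
      forall i, [set` `]l i, r i[] `<=` U,
      trivIset setT (fun i => [set` `]l i, r i[]) &
      `|F t - F s| <= \sum_i `|F (r i) - F (l i)| + (B + e1) * (t - s)].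
suff [N [l [r [h1 h2 h3 h4]]]] : P a b.
  apply: (le_trans h4).
  have : \sum_i `|F (r i) - F (l i)| < e / 2.
    apply: hd => //.
    rewrite -lte_fin; apply: le_lt_trans Ud.
    rewrite -sumEFin.
    apply: (@le_trans _ _ (\sum_i lebesgue_measure [set` `]l i, r i[])%E).
      apply: lee_sum => i _; rewrite lebesgue_measure_itv /= lte_fin.
      have [_ [+ _]] := h1 i; rewrite le_eqVlt => /orP[/eqP->|->] //.
      by rewrite ltxx subrr.
    rewrite -(@measure_bigsetU_ord _ _ _ (@lebesgue_measure R) N xpredT
      (fun i => [set` `]l i, r i[])) //.
    apply: le_measure; rewrite ?inE //.
      exact: bigsetU_measurable.
    by rewrite -bigcup_seq => x [i _]; exact: h2.
  have : e1 * (b - a) <= e / 2.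
    by rewrite /e1 mulrAC ler_pdivrMr ?ler_wpM2l //; lra.
  lra.
apply: additive_interval => //.
  move=> s t u h1 h2 [N [l [r [h3 h4 h5 h6]]]] [N' [l' [r' [k3 k4 k5 k6]]]].
  exists (N + N')%N, (fun i => match fintype.split i with inl j => l j | inr j => l' j end),
   (fun i => match fintype.split i with inl j => r j | inr j => r' j end).
  split.
  - move=> i; case: (fintype.split i) => j; [have := h3 j|have := k3 j]; lra.
  - by move=> i; case: (fintype.split i).
  - apply/trivIsetP => i j _ _ ij.
    have : fintype.split i <> fintype.split j.
      by move=> /(congr1 (@unsplit _ _)); rewrite !splitK; exact/eqP.
    case: (fintype.split i) => i'; case: (fintype.split j) => j' ij'.
    + by move/trivIsetP: h5 => h5; apply: h5 => //; apply/eqP; congruence.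
    + rewrite -subset0 => x [] /=; rewrite !in_itv /=.
      have := h3 i'; have := k3 j'; lra.
    + rewrite -subset0 => x [] /=; rewrite !in_itv /=.
      have := h3 j'; have := k3 i'; lra.
    + by move/trivIsetP: k5 => k5; apply: k5 => //; apply/eqP; congruence.
  - rewrite big_split_ord /=.
    under eq_bigr do rewrite (unsplitK (inl _)).
    under [X in _ + X + _]eq_bigr do rewrite (unsplitK (inr _)).
    have := ler_distD (F t) (F u) (F s); lra.
move=> z zab.
(* Around a point of [U] the whole interval forms the family; elsewhere the derivative exists with
   norm at most [B] and the family is empty. *)
have [Uz|Uz] := pselect (U z).
  have /nbhs_ballP[d' /= d'0 hd'] := open_nbhs_nbhs (conj oU Uz).
  exists d' => // s t h1 h2 h3 h4.
  exists 1%N, (fun _ => s), (fun _ => t); split.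
  - move=> _; lra.
  - move=> _ x /=; rewrite in_itv /= => xst; apply: hd'.
    rewrite -ball_normE /= ltr_norml; lra.
  - by move=> i j _ _ _; rewrite !ord1.
  - rewrite big_ord1 lerDl mulr_ge0 //; last lra.
    lra.
have /contrapT [v dv vB] : ~ ~ exists2 v, is_derive z (1:R) F v & `|v| <= B.
  move=> hn; apply: Uz; apply: AU; by apply: hA => /= /(_ zab).
have [d' d'0 hd'] := (is_deriveP F z v).1 dv e1 e10.
exists d' => // s t h1 h2 h3 h4.
exists 0%N, (fun _ => 0), (fun _ => 0); split.
- by case.
- by case.
- by move=> [].
rewrite big_ord0 add0r.
have H u : `|u - z| < d' -> `|F u - F z| <= (B + e1) * `|u - z|.
  move=> /hd' hu; rewrite -(subrK ((u - z) *: v) (F u - F z)).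
  apply: (le_trans (ler_normD _ _)); rewrite mulrDl addrC lerD //.
  by rewrite normrZ mulrC ler_wpM2r.
have := H t; have := H s.
rewrite (ger0_norm (_ : 0 <= t - z)); last lra.
rewrite (ler0_norm (_ : s - z <= 0)); last lra.
move=> /(_ ltac:(lra)) + /(_ ltac:(lra)).
have := ler_distD (F z) (F t) (F s); rewrite (distrC (F z)); lra.
Qed.

End ac.

Section mvi.
Context {R : realType} {V : normedModType R}.

(** Vector values have no mean value point. The bound with slope [B + e1] is local and additive by
    the triangle inequality, so Cousin's lemma propagates it, and [e1] is arbitrarily small. *)
Lemma mvi (F : R -> V) (a b B : R) : a <= b ->
  (forall t, a <= t <= b -> exists2 v, is_derive t (1:R) F v & `|v| <= B) ->
  `|F b - F a| <= B * (b - a).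
Proof.
move=> ab dF; apply/ler_addgt0Pr => e e0.
pose e1 := e / (b - a + 1).
have e10 : 0 < e1 by rewrite /e1 !divr_gt0 //; lra.
suff : `|F b - F a| <= (B + e1) * (b - a).
  have : e1 * (b - a) <= e.
    by rewrite /e1 mulrAC ler_pdivrMr ?ler_wpM2l //; lra.
  lra.
apply: (@additive_interval R (fun s t => `|F t - F s| <= (B + e1) * (t - s))) => //.
  by move=> s t u _ _ h1 h2; have := ler_distD (F t) (F u) (F s); lra.
move=> z zab; have [v dv vB] := dF z zab.
have [d' d'0 hd'] := (is_deriveP F z v).1 dv e1 e10.
exists d' => // s t h1 h2 h3 h4.
have H u : `|u - z| < d' -> `|F u - F z| <= (B + e1) * `|u - z|.
  move=> /hd' hu; rewrite -(subrK ((u - z) *: v) (F u - F z)).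
  apply: (le_trans (ler_normD _ _)); rewrite mulrDl addrC lerD //.
  by rewrite normrZ mulrC ler_wpM2r.
have := H t; have := H s.
rewrite (ger0_norm (_ : 0 <= t - z)); last lra.
rewrite (ler0_norm (_ : s - z <= 0)); last lra.
move=> /(_ ltac:(lra)) + /(_ ltac:(lra)).
have := ler_distD (F z) (F t) (F s); rewrite (distrC (F z)); lra.
Qed.

Lemma is_derive_add (F G : R -> V) (t : R) (dF dG : V) :
  is_derive t (1:R) F dF -> is_derive t (1:R) G dG ->
  is_derive t (1:R) (fun s => F s + G s) (dF + dG).
Proof. exact: is_deriveD. Qed.

Lemma is_derive_sub (F G : R -> V) (t : R) (dF dG : V) :
  is_derive t (1:R) F dF -> is_derive t (1:R) G dG ->
  is_derive t (1:R) (fun s => F s - G s) (dF - dG).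
Proof. exact: is_deriveB. Qed.

Lemma is_derive_bigsum (I : finType) (F : I -> R -> V) (t : R) (dF : I -> V) :
  (forall i, is_derive t (1:R) (F i) (dF i)) ->
  is_derive t (1:R) (fun s => \sum_i F i s) (\sum_i dF i).
Proof.
move=> h; elim: (index_enum I) => [|i r IH].
  rewrite big_nil; have -> : (fun s => \sum_(i <- [::]) F i s) = cst 0.
    by apply/funext => s; rewrite big_nil.
  exact: is_derive_cst.
rewrite big_cons; have -> : (fun s => \sum_(j <- i :: r) F j s) =
    F i + fun s => \sum_(j <- r) F j s.
  by apply/funext => s; rewrite big_cons.
exact: is_deriveD.
Qed.

Lemma is_derive_scale (k : R -> R) (F : R -> V) (t dk : R) (dF : V) :
  is_derive t (1:R) k dk -> is_derive t (1:R) F dF ->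
  is_derive t (1:R) (fun s => k s *: F s) (dk *: F t + k t *: dF).
Proof.
move=> hk hF.
have ck : {for t, continuous k}.
  by apply/differentiable_continuous/derivable1_diffP.
suff H : (fun h : R => h^-1 *: (((fun s => k s *: F s) \o shift t) (h *: 1) - k t *: F t)) @ 0^'
     --> dk *: F t + k t *: dF.
  split; first by apply/cvg_ex; eexists; exact: H.
  exact: cvg_lim.
have -> : (fun h : R => h^-1 *: (((fun s => k s *: F s) \o shift t) (h *: 1) - k t *: F t)) =
  (fun h : R => (h^-1 *: ((k \o shift t) (h *: 1) - k t)) *: F t +
     k (h + t) *: (h^-1 *: ((F \o shift t) (h *: 1) - F t))).
  apply/funext => h /=; rewrite scaler1.
  rewrite [in RHS]scalerA [k _ * _]mulrC -[in RHS]scalerA -[in RHS](scalerA h^-1).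
  rewrite -scalerDr; congr (_ *: _).
  by rewrite scalerBl scalerBr [RHS]addrC addrA subrK.
apply: cvgD.
  apply: cvgZr_tmp; have [] := hk => /[swap] <-; exact.
apply: cvgZ; last by have [] := hF => /[swap] <-; exact.
have : k (h + t) @[h --> 0] --> k t.
  apply/cvgrPdist_lt => e e0.
  move/cvgrPdist_lt: ck => /(_ e e0) /nbhs_ballP[d /= d0 hd].
  apply/nbhs_ballP; exists d => //= h hh; apply: hd; move: hh.
  by rewrite -!ball_normE /= opprD addrCA subrr addr0 sub0r.
exact: cvg_within_filter.
Qed.

Lemma is_derive_comp_diff (W : normedModType R) (X : V -> W) (x : R -> V) (t : R) w :
  differentiable X (x t) -> is_derive t (1:R) x w ->
  is_derive t (1:R) (fun s => X (x s)) ('d X (x t) w).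
Proof.
move=> dX [dx xw].
have dfx : differentiable x t by apply/derivable1_diffP.
have dXx : differentiable (X \o x) t by exact: differentiable_comp.
split; first by apply/derivable1_diffP.
by rewrite deriveE // diff_comp //= -[in RHS]xw [in RHS]deriveE.
Qed.

(** This calculus of Lipschitz curves serves to check the absolute continuity that [ae_mvi] requires
    of the corrected trajectory in the expansion. *)
Lemma lip_onD (F G : R -> V) a b : lip_on F a b -> lip_on G a b ->
  lip_on (fun t => F t + G t) a b.
Proof.
move=> [K hK] [L hL]; exists (K + L) => s t hs ht.
rewrite opprD addrACA mulrDl (le_trans (ler_normD _ _)) // lerD //; [exact: hK|exact: hL].
Qed.

Lemma lip_onN (F : R -> V) a b : lip_on F a b -> lip_on (fun t => - F t) a b.
Proof.
by move=> [K hK]; exists K => s t hs ht; rewrite -opprD normrN; exact: hK.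
Qed.

Lemma lip_on_cst (c : V) a b : lip_on (fun _ => c) a b.
Proof. by exists 0 => s t _ _; rewrite subrr normr0 mul0r. Qed.

Lemma lip_on_sum (I : finType) (F : I -> R -> V) a b :
  (forall i, lip_on (F i) a b) -> lip_on (fun t => \sum_i F i t) a b.
Proof.
move=> h; elim: (index_enum I) => [|i r IH].
  have -> : (fun s => \sum_(i <- [::]) F i s) = fun _ => 0.
    by apply/funext => s; rewrite big_nil.
  exact: lip_on_cst.
have -> : (fun s => \sum_(j <- i :: r) F j s) = fun s => F i s + \sum_(j <- r) F j s.
  by apply/funext => s; rewrite big_cons.
exact: lip_onD.
Qed.

Lemma lip_on_bounded (F : R -> V) a b : lip_on F a b ->
  exists2 B, 0 <= B & forall t, a <= t <= b -> `|F t| <= B.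
Proof.
move=> [K hK]; exists (`|F a| + `|K| * `|b - a|).
  by rewrite addr_ge0 // mulr_ge0.
move=> t ht; rewrite -(subrK (F a) (F t)) addrC (le_trans (ler_normD _ _)) // lerD2l.
rewrite (le_trans (hK a t _ _)) //; first lra.
rewrite (le_trans (_ : _ <= `|K| * `|t - a|)) //.
  by rewrite ler_wpM2r // ler_norm.
by rewrite ler_wpM2l // !ger0_norm ?subr_ge0; lra.
Qed.

Lemma lip_on_le (F : R -> V) a b : lip_on F a b -> exists2 K : R, 0 <= K &
  forall s t, a <= s <= b -> a <= t <= b -> `|F t - F s| <= K * `|t - s|.
Proof.
move=> [{}K hK]; exists `|K| => // s t hs ht.
by rewrite (le_trans (hK s t hs ht)) // ler_wpM2r // ler_norm.
Qed.

Lemma lip_on_deriv (F : R -> V) (a b : R) (dF : R -> V) (B : R) :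
  (forall t, a <= t <= b -> is_derive t (1:R) F (dF t) /\ `|dF t| <= B) ->
  lip_on F a b.
Proof.
move=> h; exists B.
suff H s t : a <= s <= b -> a <= t <= b -> s <= t -> `|F t - F s| <= B * `|t - s|.
  move=> s t hs ht; have [|/ltW] := leP s t; first exact: H.
  rewrite distrC (distrC t); exact: H.
move=> hs ht st; rewrite ger0_norm ?subr_ge0 //; apply: mvi => // u hu.
by have [? ?] := h u ltac:(lra); exists (dF u).
Qed.

Lemma lip_on_scale (k : R -> R) (F : R -> V) (a b : R) :
  @lip_on R R^o k a b -> lip_on F a b -> lip_on (fun t => k t *: F t) a b.
Proof.
move=> hk hF.
have [Bk Bk0 hBk] : exists2 B, 0 <= B & forall t, a <= t <= b -> `|k t| <= B.
  case: hk => K hK; exists (`|k a| + `|K| * `|b - a|).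
    by rewrite addr_ge0 // mulr_ge0.
  move=> t ht; rewrite -(subrK (k a) (k t)) addrC (le_trans (ler_normD _ _)) // lerD2l.
  rewrite (le_trans (hK a t _ _)) //; first lra.
  rewrite (le_trans (_ : _ <= `|K| * `|t - a|)) //.
    by rewrite ler_wpM2r // ler_norm.
  by rewrite ler_wpM2l // !ger0_norm ?subr_ge0; lra.
have [B B0 hB] := lip_on_bounded hF.
case: hk => K hK; case: hF => L hL.
exists (Bk * `|L| + `|K| * B) => s t hs ht.
have -> : k t *: F t - k s *: F s = k t *: (F t - F s) + (k t - k s) *: F s.
  by rewrite scalerBr scalerBl addrA subrK.
rewrite (le_trans (ler_normD _ _)) // mulrDl !normrZ lerD //.
  rewrite -mulrA ler_pM // ?hBk // (le_trans (hL s t hs ht)) //.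
  by rewrite ler_wpM2r // ler_norm.
rewrite mulrAC ler_pM // ?hB // (le_trans (hK s t hs ht)) //.
by rewrite ler_wpM2r // ler_norm.
Qed.

(** On column vectors this is a ball for the sup norm, whereas [eball] is Euclidean; the analysis of
    one period takes place in [cball]. *)
Definition cball (p : V) (r : R) : set V := [set y | `|y - p| <= r].

Lemma cball_segment (p : V) (r : R) y z (t : R) : cball p r y -> cball p r z ->
  0 <= t <= 1 -> cball p r (y + t *: (z - y)).
Proof.
rewrite /cball /= => hy hz ht.
have -> : y + t *: (z - y) - p = (1 - t) *: (y - p) + t *: (z - p).
  rewrite scalerBl scale1r -[RHS]addrA [- _ + _]addrC -scalerBr.
  by rewrite (opprB y p) addrA subrK addrAC.
rewrite (le_trans (ler_normD _ _)) // !normrZ !ger0_norm; try lra.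
have h1 : (1 - t) * `|y - p| <= (1 - t) * r by apply: ler_wpM2l; lra.
have h2 : t * `|z - p| <= t * r by apply: ler_wpM2l; lra.
lra.
Qed.

End mvi.

Section mvi_diff.
Context {R : realType} {V W : normedModType R}.

Lemma mvi_diff (X : V -> W) (p : V) (r M : R) y z :
  (forall y, cball p r y -> differentiable X y /\ forall h, `|'d X y h| <= M * `|h|) ->
  cball p r y -> cball p r z -> `|X z - X y| <= M * `|z - y|.
Proof.
move=> h hy hz.
have := @mvi R W (fun t => X (y + t *: (z - y))) 0 1 (M * `|z - y|) ler01.
rewrite scale0r addr0 scale1r (addrC y) subrK subr0 mulr1; apply=> t ht.
have [dX bX] := h _ (cball_segment hy hz ht).
exists ('d X (y + t *: (z - y)) (z - y)); last exact: bX.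
apply: (@is_derive_comp_diff _ _ _ _ (fun t => y + t *: (z - y))) => //.
have H : is_derive t (1:R) (fun t : R => y + t *: (z - y)) (0 + (1 *: (z - y) + t *: 0)).
  apply: (@is_deriveD _ _ _ (cst y) (fun t : R => t *: (z - y))).
  by apply: (@is_derive_scale _ _ id (cst (z - y))).
by move: H; rewrite add0r scaler0 addr0 scale1r.
Qed.

Lemma lip_on_comp (X : V -> W) (x : R -> V) (p : V) (r M a b : R) :
  (forall y, cball p r y -> differentiable X y /\ forall h, `|'d X y h| <= M * `|h|) ->
  (forall t, a <= t <= b -> cball p r (x t)) ->
  lip_on x a b -> lip_on (fun t => X (x t)) a b.
Proof.
move=> h hx hl; have [K K0 hK] := lip_on_le hl.
exists (`|M| * K) => s t hs ht.
rewrite (le_trans (mvi_diff h (hx s hs) (hx t ht))) //.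
rewrite (le_trans (_ : _ <= `|M| * `|x t - x s|)) //; first by rewrite ler_wpM2r // ler_norm.
by rewrite -mulrA ler_wpM2l // hK.
Qed.

End mvi_diff.

(** * Third-order expansion along oscillating inputs *)

Section expansion.
Context {R : realType} {V : normedModType R} {C : finType}.
Variables (X : C -> V -> V).

(* Iterated derivatives of the state along the fields: L2 c d = (D X_c) X_d and
   L3 c d e = (D (L2 c d)) X_e. *)
Definition L2 c d (y : V) : V := 'd (X c) y (X d y).
Definition L3 c d e (y : V) : V := 'd (L2 c d) y (X e y).

(** [L3] contains second derivatives of the fields and is controlled through its continuity: a small
    oscillation around [p]. The third-order remainder is therefore small through [eta], not through
    a further power of the amplitude. *)
Definition smooth_on (p : V) (r M eta : R) : Prop :=
  forall y, cball p r y ->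
  [/\ forall c, differentiable (X c) y /\ forall h, `|'d (X c) y h| <= M * `|h|,
      forall c d, differentiable (L2 c d) y /\ forall h, `|'d (L2 c d) y h| <= M * `|h| &
      forall c d e, `|L3 c d e y - L3 c d e p| <= eta].

Lemma ler_sum_const (I : finType) (F : I -> V) (B : R) :
  (forall i, `|F i| <= B) -> `|\sum_i F i| <= #|I|%:R * B.
Proof.
move=> h; rewrite (le_trans (ler_norm_sum _ _ _)) //.
rewrite (le_trans (ler_sum _ (fun i _ => h i))) //.
by rewrite sumr_const mulr_natl.
Qed.

(** Bookkeeping for the derivative of the corrected trajectory: [S], [Q] and [U0] are the
    oscillating terms of orders one, two and three. Each correction cancels one order and creates
    the next; the last one, [U1], is frozen at [p] and leaves the difference [U0 - U1]. *)
Lemma expansion_cancel (G A S P Q T U0 U1 : V) :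
  G + A + S - (S + (P + Q)) + (Q + (T + U0)) - U1 - A = G - P + T + (U0 - U1).
Proof.
rewrite !opprD.
rewrite [LHS](AC (((3*(1*2))*(1*2))*1*1) ((1*5*8*(9*10))*((2*11)*(3*4)*(7*6)))) /=.
by rewrite !subrr !addr0.
Qed.

(* Vv, W and U are the iterated integrals of the inputs v; Vv vanishes at both ends
   of the period, so there is no first-order term. *)
Lemma expansion (p A0 : V) (r M eta q B0 mm t0 t1 : R)
  (v Vv : C -> R -> R) (W : C -> C -> R -> R) (U : C -> C -> C -> R -> R) (x : R -> V) :
  smooth_on p r M eta -> t0 < t1 -> 0 <= M -> 0 <= q -> 0 <= B0 -> 0 <= eta ->
  (forall c t, is_derive t (1:R) (Vv c) (v c t)) ->
  (forall c, Vv c t0 = 0 /\ Vv c t1 = 0) ->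
  (forall c t, t0 <= t <= t1 -> `|v c t| * (t1 - t0) <= q /\ `|Vv c t| <= q) ->
  (forall c d t, is_derive t (1:R) (W c d) (Vv c t * v d t)) ->
  (forall c d, W c d t0 = 0 /\ `|W c d t1| <= mm) ->
  (forall c d e t, is_derive t (1:R) (U c d e) (Vv c t * v d t * Vv e t)) ->
  (forall c d e, U c d e t0 = 0) ->
  lip_on x t0 t1 -> x t0 = p -> (forall t, t0 <= t <= t1 -> cball p r (x t)) ->
  {ae @lebesgue_measure R, forall t, t0 <= t <= t1 ->
     exists2 G0, `|G0| <= B0 & is_derive t (1:R) x (G0 + A0 + \sum_c v c t *: X c (x t))} ->
  `| x t1 - p - (t1 - t0) *: A0 + \sum_c \sum_d W c d t1 *: L2 c d p
     + \sum_c \sum_d \sum_e U c d e t1 *: L3 c d e p | <=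
  (t1 - t0) * B0 + (t1 - t0) * (#|C|%:R * M * q + #|C|%:R ^+ 2 * M * q ^+ 2) * (B0 + `|A0|)
  + #|C|%:R ^+ 3 * q ^+ 3 * eta + #|C|%:R ^+ 2 * mm * M * r.
Proof.
move=> hX t01 M0 q0 B00 eta0 dV V0 bV dW W0 dU U0 lx x0 xK dx.
have tau0 : 0 < t1 - t0 by lra.
set tau := t1 - t0.
set N := #|C|%:R.
have N0 : 0 <= N by rewrite /N.
have bv c t : t0 <= t <= t1 -> `|v c t| <= q / tau.
  by move=> ht; rewrite ler_pdivlMr //; have [] := bV c t ht.
have bVv c t : t0 <= t <= t1 -> `|Vv c t| <= q by move=> /(bV c) [].
have qt0 : 0 <= q / tau by rewrite divr_ge0 // ltW.
have bWd c d t : t0 <= t <= t1 -> `|Vv c t * v d t| <= q * (q / tau).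
  by move=> ht; rewrite normrM ler_pM // ?bv // bVv.
have bW c d t : t0 <= t <= t1 -> `|W c d t| <= q ^+ 2.
  move=> ht; have := @mvi R R^o (W c d) t0 t (q * (q / tau)).
  rewrite (W0 c d).1 subr0 => /(_ _ _) /le_trans; apply; first lra.
    move=> s hs; exists (Vv c s * v d s); [exact: dW|apply: bWd; lra].
  rewrite (le_trans (_ : _ <= q * (q / tau) * tau)) //.
    by apply: ler_wpM2l; [exact: mulr_ge0|rewrite /tau; lra].
  by rewrite -mulrA divfK ?gt_eqF // expr2.
(* Integration by parts: the derivative of [Y c d e] is [W c d * v e], and its value at [t1] is
   [- U c d e t1] because [Vv e] vanishes there. Products of two primitives [Vv] are easier to
   average than nested integrals. *)
pose Y c d e t := W c d t * Vv e t - U c d e t.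
(* A change of variables close to the identity, which removes the oscillating part
   of the equation up to third order. *)
pose Z t := x t - (\sum_c Vv c t *: X c (x t)) + (\sum_c \sum_d W c d t *: L2 c d (x t))
   - (\sum_c \sum_d \sum_e Y c d e t *: L3 c d e p) - (t - t0) *: A0.
have Zt0 : Z t0 = p.
  rewrite /Z subrr scale0r subr0 x0 !big1 ?subr0 ?addr0 // => c _.
  - by rewrite big1 // => d _; rewrite big1 // => e _; rewrite /Y (W0 c d).1 U0 mul0r subrr scale0r.
  - by rewrite big1 // => d _; rewrite (W0 c d).1 scale0r.
  - by rewrite (V0 c).1 scale0r.
have Zt1 : Z t1 = x t1 + (\sum_c \sum_d W c d t1 *: L2 c d (x t1))
   + (\sum_c \sum_d \sum_e U c d e t1 *: L3 c d e p) - tau *: A0.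
  rewrite /Z; congr (_ + _ + _ - _).
    by rewrite big1 ?subr0 // => c _; rewrite (V0 c).2 scale0r.
  rewrite -sumrN; apply: eq_bigr => c _; rewrite -sumrN; apply: eq_bigr => d _.
  rewrite -sumrN; apply: eq_bigr => e _.
  by rewrite /Y (V0 e).2 mulr0 sub0r scaleNr opprK.
have p_in : cball p r p by rewrite -{2}x0; apply: xK; lra.
have r0 : 0 <= r by move: p_in; rewrite /cball /= subrr normr0.
have main : `|Z t1 - Z t0| <= (B0 + (N * M * q + N ^+ 2 * M * q ^+ 2) * (B0 + `|A0|)
    + N ^+ 3 * (q ^+ 2 * (q / tau) * eta)) * tau.
  apply: ae_mvi; first lra.
  - have h1 : 0 <= N * M * q by rewrite !mulr_ge0.
    have h2 : 0 <= N ^+ 2 * M * q ^+ 2 by rewrite !mulr_ge0 // ?exprn_ge0.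
    have h3 : 0 <= N ^+ 3 * (q ^+ 2 * (q / tau) * eta).
      by rewrite mulr_ge0 ?exprn_ge0 // mulr_ge0 // mulr_ge0 // exprn_ge0.
    have h4 : 0 <= (N * M * q + N ^+ 2 * M * q ^+ 2) * (B0 + `|A0|).
      by rewrite mulr_ge0 // addr_ge0.
    lra.
  - apply: lip_ac.
    have lV c : @lip_on R R^o (Vv c) t0 t1.
      by apply: (@lip_on_deriv R R^o _ _ _ (v c) (q / tau)) => t ht; split; [exact: dV|exact: bv].
    have lW c d : @lip_on R R^o (W c d) t0 t1.
      by apply: (@lip_on_deriv R R^o _ _ _ _ (q * (q / tau))) => t ht; split; [exact: dW|exact: bWd].
    have lU c d e : @lip_on R R^o (U c d e) t0 t1.
      apply: (@lip_on_deriv R R^o _ _ _ _ (q * (q / tau) * q)) => t ht; split; first exact: dU.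
      by rewrite normrM ler_pM // ?bWd // bVv.
    have lY c d e : @lip_on R R^o (Y c d e) t0 t1.
      apply: (@lip_onD R R^o (fun t => W c d t * Vv e t)); last exact: (@lip_onN R R^o).
      exact: (@lip_on_scale R R^o).
    apply: lip_onD; [apply: lip_onD; [apply: lip_onD; [apply: lip_onD|]|]|].
    + exact: lx.
    + apply/lip_onN/lip_on_sum => c; apply: lip_on_scale => //.
      by apply: (@lip_on_comp _ _ _ (X c) x p r M) => // y /hX[].
    + apply/lip_on_sum => c; apply/lip_on_sum => d; apply: lip_on_scale => //.
      by apply: (@lip_on_comp _ _ _ (L2 c d) x p r M) => // y /hX[].
    + apply/lip_onN/lip_on_sum => c; apply/lip_on_sum => d; apply/lip_on_sum => e.
      by apply: lip_on_scale => //; exact: lip_on_cst.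
    + apply/lip_onN; apply: lip_on_scale; last exact: lip_on_cst.
      by exists 1 => s t _ _; rewrite mul1r opprB addrA subrK.
  - apply: filterS dx; first exact: (ae_filter_ringOfSetsType lebesgue_measure).
    move=> t /= + ht => /(_ ht) [G0 G0B dxt].
    have [hX1 hX2 hX3] := hX _ (xK t ht).
    set w := G0 + A0 + _ in dxt.
    pose P := \sum_c Vv c t *: 'd (X c) (x t) (G0 + A0).
    pose Q := \sum_c \sum_d (Vv c t * v d t) *: L2 c d (x t).
    pose T := \sum_c \sum_d W c d t *: 'd (L2 c d) (x t) (G0 + A0).
    pose U' y := \sum_c \sum_d \sum_e (W c d t * v e t) *: L3 c d e y.
    have dXw c : 'd (X c) (x t) w = 'd (X c) (x t) (G0 + A0) + \sum_d v d t *: L2 c d (x t).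
      by rewrite /w linearD linear_sum; congr (_ + _); apply: eq_bigr => d _; rewrite linearZ.
    have dL2w c d : 'd (L2 c d) (x t) w = 'd (L2 c d) (x t) (G0 + A0) + \sum_e v e t *: L3 c d e (x t).
      by rewrite /w linearD linear_sum; congr (_ + _); apply: eq_bigr => e _; rewrite linearZ.
    (* What survives of the derivative of [Z]: the slow remainder [G0], the two terms in which the
       slow velocity [G0 + A0] is multiplied by a small [Vv] or [W], and the third-order term at
       [x t] minus its value frozen at [p]. *)
    exists (G0 - P + T + (U' (x t) - U' p)).
      rewrite -(expansion_cancel G0 A0 (\sum_c v c t *: X c (x t)) P Q T).
      apply: is_derive_sub; [apply: is_derive_sub; [apply: is_derive_add; [apply: is_derive_sub|]|]|].
      + have -> : \sum_c v c t *: X c (x t) + (P + Q) =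
            \sum_c (v c t *: X c (x t) + Vv c t *: 'd (X c) (x t) w).
          rewrite big_split /=; congr (_ + _); rewrite -big_split /=; apply: eq_bigr => c _.
          rewrite dXw scalerDr; congr (_ + _); rewrite scaler_sumr; apply: eq_bigr => d _.
          by rewrite scalerA.
        apply: is_derive_bigsum => c; apply: is_derive_scale => //.
        by apply: is_derive_comp_diff => //; have [] := hX1 c.
      + have -> : Q + (T + U' (x t)) =
            \sum_c \sum_d ((Vv c t * v d t) *: L2 c d (x t) + W c d t *: 'd (L2 c d) (x t) w).
          rewrite -[T + _]big_split -big_split /=; apply: eq_bigr => c _.
          rewrite -!big_split /=; apply: eq_bigr => d _.
          rewrite dL2w scalerDr; congr (_ + (_ + _)); rewrite scaler_sumr; apply: eq_bigr => e _.
          by rewrite scalerA.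
        apply: is_derive_bigsum => c; apply: is_derive_bigsum => d; apply: is_derive_scale => //.
        by apply: is_derive_comp_diff => //; have [] := hX2 c d.
      + apply: is_derive_bigsum => c; apply: is_derive_bigsum => d; apply: is_derive_bigsum => e.
        have -> : (W c d t * v e t) *: L3 c d e p =
          ((Vv c t * v d t) * Vv e t + W c d t * v e t - Vv c t * v d t * Vv e t) *: L3 c d e p
            + Y c d e t *: 0.
          by rewrite scaler0 addr0 addrAC subrr add0r.
        apply: is_derive_scale.
        apply: (@is_derive_sub R R^o (fun t => W c d t * Vv e t) (U c d e)) => //.
        exact: (@is_derive_scale R R^o).
      + have E : A0 = (1 - 0) *: A0 + (t - t0) *: 0 by rewrite subr0 scale1r scaler0 addr0.
        rewrite [X in is_derive _ _ _ X]E.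
        apply: is_derive_scale.
    have wB : `|G0 + A0| <= B0 + `|A0| by rewrite (le_trans (ler_normD _ _)) // lerD2r.
    have hP : `|P| <= N * (q * (M * (B0 + `|A0|))).
      apply: ler_sum_const => c; rewrite normrZ ler_pM ?bVv //.
      by rewrite (le_trans ((hX1 c).2 _)) // ler_wpM2l.
    have hT : `|T| <= N * (N * (q ^+ 2 * (M * (B0 + `|A0|)))).
      apply: ler_sum_const => c; apply: ler_sum_const => d; rewrite normrZ ler_pM ?bW //.
      by rewrite (le_trans ((hX2 c d).2 _)) // ler_wpM2l.
    have hU : `|U' (x t) - U' p| <= N * (N * (N * (q ^+ 2 * (q / tau) * eta))).
      have -> : U' (x t) - U' p =
          \sum_c \sum_d \sum_e (W c d t * v e t) *: (L3 c d e (x t) - L3 c d e p).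
        rewrite -sumrB; apply: eq_bigr => c _; rewrite -sumrB; apply: eq_bigr => d _.
        by rewrite -sumrB; apply: eq_bigr => e _; rewrite scalerBr.
      apply: ler_sum_const => c; apply: ler_sum_const => d; apply: ler_sum_const => e.
      rewrite normrZ normrM; apply: ler_pM; [by rewrite mulr_ge0|by []| |exact: hX3].
      by rewrite ler_pM ?bW ?bv.
    have h1 := ler_normD (G0 - P + T) (U' (x t) - U' p).
    have h2 := ler_normD (G0 - P) T; have h3 := ler_normB G0 P.
    lra.
have -> : x t1 - p - tau *: A0 + (\sum_c \sum_d W c d t1 *: L2 c d p)
     + (\sum_c \sum_d \sum_e U c d e t1 *: L3 c d e p) =
   (Z t1 - Z t0) - \sum_c \sum_d W c d t1 *: (L2 c d (x t1) - L2 c d p).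
  rewrite Zt0 Zt1.
  have -> : \sum_c \sum_d W c d t1 *: (L2 c d (x t1) - L2 c d p) =
     \sum_c \sum_d W c d t1 *: L2 c d (x t1) - \sum_c \sum_d W c d t1 *: L2 c d p.
    rewrite -sumrB; apply: eq_bigr => c _; rewrite -sumrB; apply: eq_bigr => d _.
    by rewrite scalerBr.
  set a := \sum_c _; set b := \sum_c _; set e := \sum_c _.
  by rewrite opprB [RHS](AC (5*2) ((1*5*4*6*3)*(2*7))) /= subrr addr0.
rewrite (le_trans (ler_normB _ _)) //.
(* Moving [L2] from [x t1] back to [p] costs [M * r] per term. The separate bound [mm] on [W] at the
   end of the period matters here: it will have order six in the amplitude scale, whereas [q ^+ 2]
   has only order four. *)
have last : `|\sum_c \sum_d W c d t1 *: (L2 c d (x t1) - L2 c d p)| <= N ^+ 2 * mm * M * r.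
  have -> : N ^+ 2 * mm * M * r = N * (N * (mm * (M * r))) by ring.
  apply: ler_sum_const => c; apply: ler_sum_const => d.
  rewrite normrZ ler_pM ?normr_ge0 // ?(W0 c d).2 //.
  have xt1 : cball p r (x t1) by apply: xK; lra.
  rewrite (le_trans (@mvi_diff _ _ _ (L2 c d) p r M p (x t1) _ p_in xt1)) //.
    by move=> y /hX [_ + _]; exact.
  by rewrite ler_wpM2l.
have -> : N ^+ 3 * q ^+ 3 * eta = N ^+ 3 * (q ^+ 2 * (q / tau) * eta) * tau.
  by field; rewrite gt_eqF.
lra.
Qed.

End expansion.

(** * Caratheodory equations *)

Section antiderivative.
Context {R : realType}.
Notation mu := (@lebesgue_measure R).

Lemma antiderivative (phi : R -> R) (a b B : R) : a <= b ->
  measurable_fun (`[a, b] : set R) phi ->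
  (forall t, a <= t <= b -> `|phi t| <= B) ->
  exists F : R -> R, [/\ F a = 0,
    forall s t, `|F t - F s| <= B * `|t - s| &
    {ae mu, forall t, a <= t <= b -> is_derive t (1:R) F (phi t)}].
Proof.
move=> ab mphi bphi.
have B0 : 0 <= B by have := bphi a ltac:(lra); have := normr_ge0 (phi a); lra.
(* Extended by zero, [phi] is integrable on the whole line, so the differentiation theorem for
   integrals from minus infinity applies without boundary cases. *)
pose psi := phi \_ (`[a, b] : set R).
have psiE t : a <= t <= b -> psi t = phi t.
  by move=> ht; rewrite /psi patchT // inE /= in_itv.
have psiB t : `|psi t| <= B.
  have [ht|ht] := boolP (a <= t <= b); first by rewrite psiE // bphi.
  by rewrite /psi patchC ?normr0 // inE /= in_itv; apply/negP.
have ipsi : mu.-integrable setT (EFin \o psi).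
  have : mu.-integrable (`[a, b] : set R) (EFin \o phi).
    apply: measurable_bounded_integrable => //.
      rewrite /= lebesgue_measure_itv /=; case: ifP => // _; exact: ltry.
    exists B; split; first by rewrite num_real.
    move=> M BM t /=; rewrite in_itv /= => /bphi /le_trans; apply; exact: ltW.
  by rewrite integrable_mkcond //= (restrict_EFin phi).
have ipsiS (D : set R) : measurable D -> mu.-integrable D (EFin \o psi).
  by move=> mD; apply: integrableS ipsi.
pose F0 x := (\int[mu]_(t in `]-oo, x]) psi t)%R.
have F0B s t : s <= t -> `|F0 t - F0 s| <= B * (t - s).
  move=> st; rewrite /F0 Rintegral_itvB //; last exact: ipsiS.
  apply: (le_trans (le_normr_Rintegral _ _)) => //; first exact: ipsiS.
  rewrite (le_trans (@le_Rintegral _ _ _ mu _ _ (fun=> B) _ _ _ _)) //.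
  - by have := integrable_norm (ipsiS `]s, t]%classic (measurable_itv _)).
  - apply: measurable_bounded_integrable => //.
    + rewrite /= lebesgue_measure_itv /=; case: ifP => // _; exact: ltry.
    + exact: bounded_cst.
  - rewrite Rintegral_cst //= lebesgue_measure_itv /= lte_fin.
    by case: ltP => // ts /=; rewrite mulr0 mulr_ge0 // subr_ge0.
exists (fun x => F0 x - F0 a); split; first by rewrite subrr.
  move=> s t; rewrite opprB addrA subrK.
  have [st|/ltW st] := leP s t.
    by rewrite (ger0_norm (_ : 0 <= t - s)) ?F0B // subr_ge0.
  by rewrite distrC (ler0_norm (_ : t - s <= 0)) ?opprB ?F0B // subr_le0.
have := @FTC1Ny R psi (fun y => ipsiS _ (measurable_itv _)) (open_integrable_locally openT ipsi).
apply: filterS; first exact: (ae_filter_ringOfSetsType mu).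
move=> t /= [dF Ft] ht.
have dF0 : is_derive t (1:R) F0 (phi t).
  by split => //; rewrite -derive1E Ft psiE.
rewrite -[phi t]subr0.
exact: (@is_derive_sub R R^o F0 (cst (F0 a))).
Qed.

End antiderivative.

(** [G] is measurable in time for each fixed state, so the composite is reached as a pointwise
    limit: the curve is frozen at the left end of each cell of a grid, and the Lipschitz bounds in
    space and time control the error by the mesh. *)
Lemma carath_measurable (R : realType) (V : normedModType R) (G : R -> V -> R) (x : R -> V)
    (a b K L : R) (S : set V) : a < b ->
  (forall y, S y -> measurable_fun (`[a, b] : set R) (G ^~ y)) ->
  (forall t y z, a <= t <= b -> S y -> S z -> `|G t y - G t z| <= L * `|y - z|) ->
  (forall t, a <= t <= b -> S (x t)) ->
  (forall s t, a <= s <= b -> a <= t <= b -> `|x t - x s| <= K * `|t - s|) ->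
  measurable_fun (`[a, b] : set R) (fun t => G t (x t)).
Proof.
move=> ab mG lG Sx lx.
pose w m : R := (b - a) / m.+1%:R.
have w0 m : 0 < w m by rewrite divr_gt0 // subr_gt0.
pose c m k : R := a + k%:R * w m.
have cin m (k : 'I_m.+2) : a <= c m k <= b.
  have h1 : 0 <= (k%:R : R) * w m by rewrite mulr_ge0 // ltW.
  have h2 : (k%:R : R) * w m <= m.+1%:R * w m.
    by apply: ler_wpM2r; [exact: ltW|rewrite ler_nat -ltnS].
  have h3 : m.+1%:R * w m = b - a by rewrite /w mulrC divfK.
  rewrite /c; lra.
(* The last index [k = m.+1] gives the cell that starts at [b], so that [t = b] is covered as
   well. *)
pose h m t := \sum_(k < m.+2) (\1_(`[c m k, c m k.+1[ : set R) t * G t (x (c m k))).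
apply: (@measurable_fun_cvg _ _ _ _ h).
  move=> m; apply: measurable_sum => k; apply: measurable_funM.
    exact: measurable_indic.
  by apply: mG; apply: Sx; exact: cin.
move=> t /=; rewrite in_itv /= => tab.
have hE m : `|G t (x t) - h m t| <= `|L| * (`|K| * w m).
  pose k0 := Num.truncn ((t - a) / w m).
  have t0 : 0 <= (t - a) / w m by apply: divr_ge0; [lra|exact: ltW].
  have /andP[] := truncn_itv t0; rewrite -/k0 ler_pdivlMr // ltr_pdivrMr // => k1 k2.
  have k0m : (k0 < m.+2)%N.
    rewrite ltnS -(ler_nat R) -(ler_pM2r (w0 m)) (le_trans k1) //.
    by rewrite /w [leRHS]mulrC divfK //; lra.
  have -> : h m t = G t (x (c m k0)).
    rewrite /h (bigD1 (Ordinal k0m)) //= big1 ?addr0.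
      rewrite indicE mem_set ?mul1r //= in_itv /= /c; lra.
    move=> i ik; rewrite indicE memNset ?mul0r //= in_itv /= => /andP[h1 h2].
    move/eqP: ik; apply; apply/val_inj => /=; rewrite /k0; apply/esym/truncn_def.
    rewrite ler_pdivlMr // ltr_pdivrMr //; rewrite /c in h1 h2; lra.
  have ck : a <= c m k0 <= b by exact: (cin m (Ordinal k0m)).
  have hL := lG t (x t) (x (c m k0)) tab (Sx _ tab) (Sx _ ck).
  have hK := lx (c m k0) t ck tab.
  rewrite (le_trans hL) // (le_trans (_ : _ <= `|L| * `|x t - x (c m k0)|)) //.
    by rewrite ler_wpM2r // ler_norm.
  rewrite ler_wpM2l // (le_trans hK) // (le_trans (_ : _ <= `|K| * `|t - c m k0|)) //.
    by rewrite ler_wpM2r // ler_norm.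
  by rewrite ler_wpM2l // ger0_norm /c; lra.
apply/cvgrPdist_le => e e0.
pose A := `|L| * `|K| * (b - a).
have A0 : 0 <= A by rewrite !mulr_ge0 //; lra.
near=> m; apply: (le_trans (hE m)).
have -> : `|L| * (`|K| * w m) = A / m.+1%:R by rewrite /A /w !mulrA.
rewrite ler_pdivrMr // -ler_pdivrMl //.
have : (Num.truncn (e^-1 * A) < m.+1)%N.
  near: m; exists (Num.truncn (e^-1 * A)) => // k /=; by rewrite ltnS.
rewrite -(ler_nat R) => /(le_trans _); apply; apply/ltW.
have /andP[] := @truncn_itv R (e^-1 * A) ltac:(by rewrite mulr_ge0 // invr_ge0 ltW) => //.
Unshelve. all: by end_near. Qed.

Section vector_antiderivative.
Context {R : realType} {n : nat}.
Notation mu := (@lebesgue_measure R).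
Implicit Types v : 'cV[R]_n.

Lemma cVnorm_le v c : 0 <= c -> (forall i, `|v i 0| <= c) -> `|v| <= c.
Proof.
move=> c0 h; rewrite /Num.norm /= mx_normrE; apply/bigmax_leP; split => // -[i j] _ /=.
by rewrite ord1.
Qed.

Lemma cVnorm_ge v i : `|v i 0| <= `|v|.
Proof.
rewrite [leRHS]/Num.norm /= mx_normrE; exact: (le_bigmax _ (fun ij => `|v ij.1 ij.2|) (i, 0)).
Qed.

Lemma is_derive_cV (F : R -> 'cV[R]_n) (t : R) v :
  (forall i, is_derive t (1:R) (fun s => F s i 0) (v i 0)) -> is_derive t (1:R) F v.
Proof.
move=> h; apply/is_deriveP => e e0.
have /choice [d hd] : forall i, exists d, 0 < d /\ forall s, `|s - t| < d ->
    `|F s i 0 - F t i 0 - (s - t) * v i 0| <= e * `|s - t|.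
  by move=> i; have [d d0 hd] := (@is_deriveP R R^o _ _ _).1 (h i) e e0; exists d.
exists (\big[Num.min/1]_i d i).
  by apply/bigmin_gtP; split => // i _; have [] := hd i.
move=> s /bigmin_gtP[_ hs]; apply: cVnorm_le; first by rewrite mulr_ge0 // ltW.
by move=> i; rewrite !mxE; apply: (hd i).2; exact: hs.
Qed.

Lemma ae_forall_fin (I : finType) (P : I -> R -> Prop) :
  (forall i, {ae mu, forall t, P i t}) -> {ae mu, forall t, forall i, P i t}.
Proof.
move=> h.
have H : {ae mu, forall t, forall i, i \in enum I -> P i t}.
  elim: (enum I) => [|i s IH].
    by apply: aeW => t i; rewrite in_nil.
  apply: (@filterS2 _ _ (ae_filter_ringOfSetsType mu) _ _ _ _ IH (h i)).
  by move=> t h1 h2 j; rewrite inE => /orP[/eqP->//|]; exact: h1.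
apply: (@filterS _ _ (ae_filter_ringOfSetsType mu) _ _ _ H).
by move=> t ht i; apply: ht; rewrite mem_enum.
Qed.

Lemma vec_antiderivative (phi : R -> 'cV[R]_n) (a b B : R) : a <= b -> 0 <= B ->
  (forall i, measurable_fun (`[a, b] : set R) (fun t => phi t i 0)) ->
  (forall t, a <= t <= b -> `|phi t| <= B) ->
  exists F : R -> 'cV[R]_n, [/\ F a = 0,
    forall s t, `|F t - F s| <= B * `|t - s| &
    {ae mu, forall t, a <= t <= b -> is_derive t (1:R) F (phi t)}].
Proof.
move=> ab B0 mphi bphi.
have /choice [F hF] : forall i, exists F : R -> R, [/\ F a = 0,
    forall s t, `|F t - F s| <= B * `|t - s| &
    {ae mu, forall t, a <= t <= b -> is_derive t (1:R) F (phi t i 0)}].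
  move=> i; apply: antiderivative => // t /bphi; exact/le_trans/cVnorm_ge.
exists (fun t => \col_i F i t); split.
- by apply/colP => i; rewrite !mxE; have [] := hF i.
- move=> s t; apply: cVnorm_le; first by rewrite mulr_ge0.
  by move=> i; rewrite !mxE; have [_ +] := hF i.
have := ae_forall_fin (fun i => let: And3 _ _ h := hF i in h).
apply: filterS; first exact: (ae_filter_ringOfSetsType mu).
move=> t h tab; apply: is_derive_cV => i.
have -> : (fun s => (\col_i0 F i0 s) i 0) = F i by apply/funext => s; rewrite mxE.
exact: h.
Qed.

End vector_antiderivative.

Section picard.
Context {R : realType} {n : nat}.
Notation mu := (@lebesgue_measure R).
Notation V := 'cV[R]_n.

Lemma geometric_cvg (u : nat -> V) (r : R) : 0 <= r ->
  (forall k, `|u k.+1 - u k| <= r / 2 ^+ k) ->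
  exists l, forall k, `|u k - l| <= 2 * r / 2 ^+ k.
Proof.
move=> r0 hu.
have hm k m : `|u (k + m)%N - u k| <= 2 * r / 2 ^+ k.
  suff : `|u (k + m)%N - u k| <= 2 * r / 2 ^+ k - 2 * r / 2 ^+ (k + m).
    move=> /le_trans; apply; rewrite gerBl divr_ge0 // ?exprn_ge0 //; lra.
  elim: m => [|m IH]; first by rewrite addn0 !subrr normr0.
  rewrite addnS; have := ler_distD (u (k + m)%N) (u (k + m).+1) (u k).
  move=> /le_trans; apply.
  have := hu (k + m)%N.
  have -> : 2 * r / 2 ^+ (k + m).+1 = r / 2 ^+ (k + m).
    by rewrite exprS; field; rewrite expf_neq0.
  by move: IH; rewrite -[2 * r / 2 ^+ (k + m)]mulrA; lra.
have small e : 0 < e -> exists k, 2 * r / 2 ^+ k < e.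
  move=> e0; exists (Num.truncn (2 * r / e)).+1.
  rewrite ltr_pdivrMr ?exprn_gt0 // [ltRHS]mulrC -ltr_pdivrMr //.
  have /andP[_ h] := @truncn_itv R (2 * r / e) ltac:(by apply: divr_ge0; [lra|exact: ltW]).
  apply: (lt_trans h); rewrite -natrX ltr_nat; exact: ltn_expl.
have cu : cvgn u.
  apply/cauchy_cvgP/cauchy_exP => e e0.
  have [k hk] := small e e0.
  exists (u k); exists k => // m /= km; rewrite -ball_normE /= distrC -(subnKC km).
  exact: le_lt_trans (hm _ _) hk.
exists (limn u) => k; apply/ler_addgt0Pr => e e0.
have /cvgrPdist_le /(_ e e0) [N _ hN] := cu.
have h1 := hN (k + N)%N (leq_addl _ _); have h2 := hm k N.
have := ler_distD (u (k + N)%N) (u k) (limn u).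
by rewrite (distrC (u k) (u (k + N)%N)) (distrC (u (k + N)%N) (limn u)); lra.
Qed.

(** Picard iteration on curves that stay in the ball and are [B]-Lipschitz on [a, b]. The operator
    is chosen from [vec_antiderivative], and its contraction factor 1/2 comes from the
    almost-everywhere mean value inequality applied to the difference of two images, so no integral
    is estimated. *)
Lemma picard (G : R -> V -> V) (p : V) (a b B L r : R) :
  a < b -> 0 <= B -> 0 <= L -> 0 <= r ->
  (forall i y, cball p r y -> measurable_fun (`[a, b] : set R) (fun t => G t y i 0)) ->
  (forall t y, a <= t <= b -> cball p r y -> `|G t y| <= B) ->
  (forall t y z, a <= t <= b -> cball p r y -> cball p r z ->
     `|G t y - G t z| <= L * `|y - z|) ->
  B * (b - a) <= r -> L * (b - a) <= 2^-1 ->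
  exists x : R -> V, [/\ x a = p,
    forall s t, `|x t - x s| <= B * `|t - s|,
    forall t, a <= t <= b -> cball p r (x t) &
    {ae mu, forall t, a <= t <= b -> is_derive t (1:R) x (G t (x t))}].
Proof.
move=> ab B0 L0 r0 mG bG lG Br Lr.
pose adm (x : R -> V) := (forall s t, a <= s <= b -> a <= t <= b ->
    `|x t - x s| <= B * `|t - s|) /\ forall t, a <= t <= b -> cball p r (x t).
have /choice [T hT] : forall x, exists y, adm x ->
    [/\ adm y, y a = p, forall s t, `|y t - y s| <= B * `|t - s| &
     {ae mu, forall t, a <= t <= b -> is_derive t (1:R) y (G t (x t))}].
  move=> x; have [[lx bx]|nx] := pselect (adm x); last by exists x.
  have [F [Fa lF dF]] : exists F : R -> V, [/\ F a = 0,
      forall s t, `|F t - F s| <= B * `|t - s| &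
      {ae mu, forall t, a <= t <= b -> is_derive t (1:R) F (G t (x t))}].
    apply: vec_antiderivative => //; first exact: ltW.
      move=> i; apply: (@carath_measurable R V (fun t y => G t y i 0) x a b B L (cball p r)) => //.
        by move=> y hy; exact: mG.
      move=> t y z ht hy hz; apply: le_trans (lG t y z ht hy hz).
      by have := cVnorm_ge (G t y - G t z) i; rewrite !mxE.
    by move=> t ht; apply: bG => //; exact: bx.
  exists (fun t => p + F t) => _.
  have lF' s t : `|p + F t - (p + F s)| <= B * `|t - s|.
    by rewrite opprD addrACA subrr add0r.
  split => //; [split|by rewrite Fa addr0|] => //.
    move=> t ht; rewrite /cball /= addrAC subrr add0r.
    have := lF a t; rewrite Fa subr0 => /le_trans; apply.
    rewrite (le_trans _ Br) // ler_wpM2l // ger0_norm; lra.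
  apply: filterS dF; first exact: (ae_filter_ringOfSetsType mu).
  move=> t h ht; rewrite -[G t _]add0r.
  by apply: is_derive_add; exact: h.
pose x k := iter k T (cst p).
have adm0 : adm (cst p).
  split=> [s t _ _|t _]; first by rewrite subrr normr0 mulr_ge0.
  by rewrite /cball /= subrr normr0.
have admx k : adm (x k) by elim: k => //= k /hT [].
have contr y z D : adm y -> adm z -> 0 <= D ->
    (forall t, a <= t <= b -> `|y t - z t| <= D) ->
    forall t, a <= t <= b -> `|T y t - T z t| <= D / 2.
  move=> ay az D0 yz t ht.
  have [_ ya ly dy] := hT y ay; have [_ za lz dz] := hT z az.
  have H : `|(T y t - T z t) - (T y a - T z a)| <= (L * D) * (t - a).
    apply: (@ae_mvi R V (fun t => T y t - T z t)); first lra.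
    - exact: mulr_ge0.
    - apply: lip_ac; apply: lip_onD; last apply: lip_onN.
        by exists B => s s' _ _.
      by exists B => s s' _ _.
    - apply: (@filterS2 _ _ (ae_filter_ringOfSetsType mu) _ _ _ _ dy dz).
      move=> s hy hz hs; have hs' : a <= s <= b by lra.
      exists (G s (y s) - G s (z s)).
        by apply: is_derive_sub; [exact: hy|exact: hz].
      rewrite (le_trans (lG s _ _ hs' (ay.2 s hs') (az.2 s hs'))) //.
      by rewrite ler_wpM2l // yz.
  move: H; rewrite ya za subrr subr0 => /le_trans; apply.
  have : L * (t - a) <= 2^-1 by rewrite (le_trans _ Lr) // ler_wpM2l //; lra.
  move=> h; have := ler_wpM2r D0 h; lra.
have diffx k t : a <= t <= b -> `|x k.+1 t - x k t| <= r / 2 ^+ k.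
  elim: k t => [|k IH] t ht.
    by rewrite expr0 divr1; have [_ /(_ t ht)] := admx 1%N.
  have := contr _ _ _ (admx k.+1) (admx k) _ IH t ht.
  rewrite exprSr invfM mulrA; apply.
  by rewrite divr_ge0 // exprn_ge0.
have /choice [xl hxl] : forall t, exists l, a <= t <= b -> forall k, `|x k t - l| <= 2 * r / 2 ^+ k.
  move=> t; have [ht|nt] := pselect (a <= t <= b); last by exists 0.
  have [l hl] := geometric_cvg r0 (fun k => diffx k t ht).
  by exists l.
have small e : 0 < e -> exists k, 2 * r / 2 ^+ k < e.
  move=> e0; exists (Num.truncn (2 * r / e)).+1.
  rewrite ltr_pdivrMr ?exprn_gt0 // [ltRHS]mulrC -ltr_pdivrMr //.
  have /andP[_ h] := @truncn_itv R (2 * r / e) ltac:(by apply: divr_ge0; [lra|exact: ltW]).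
  apply: (lt_trans h); rewrite -natrX ltr_nat; exact: ltn_expl.
have axl : adm xl.
  split.
    move=> s t hs ht; apply/ler_addgt0Pr => e e0.
    have [k hk] := small (e / 2) ltac:(lra).
    have h1 := hxl s hs k; have h2 := hxl t ht k; have h3 := (admx k).1 s t hs ht.
    have := ler_distD (x k s) (xl t) (xl s); have := ler_distD (x k t) (xl t) (x k s).
    rewrite (distrC (xl t) (x k t)); lra.
  move=> t ht; apply/ler_addgt0Pr => e e0.
  have [k hk] := small e ltac:(lra).
  have h1 := hxl t ht k; have : `|x k t - p| <= r := (admx k).2 t ht.
  have := ler_distD (x k t) (xl t) p; rewrite (distrC (xl t) (x k t)); lra.
have [ay ya ly dy] := hT xl axl.
have yE t : a <= t <= b -> T xl t = xl t.
  move=> ht; apply/eqP; rewrite -subr_eq0 -normr_le0; apply/ler_addgt0Pr => e e0.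
  rewrite add0r; have [k hk] := small (e / 2) ltac:(lra).
  have r2 : 0 <= 2 * r / 2 ^+ k by apply: divr_ge0; [lra|exact: exprn_ge0].
  have h1 := contr xl (x k) (2 * r / 2 ^+ k) axl (admx k) r2
    (fun s hs => ltac:(rewrite distrC; exact: hxl)) t ht.
  have h2 := hxl t ht k.+1.
  have h3 : 2 * r / 2 ^+ k.+1 = 2 * r / 2 ^+ k / 2 by rewrite exprSr invfM mulrA.
  have := ler_distD (x k.+1 t) (T xl t) (xl t); rewrite -/(x k.+1) in h1; rewrite -h3 in h1.
  rewrite h3 in h1 h2; change (T (x k) t) with (x k.+1 t) in h1; lra.
(* The witness is [T xl] rather than [xl]: the two agree on [a, b] only, while the Lipschitz bound
   on the whole line and the two-sided derivatives belong to [T xl]. *)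
exists (T xl); split => //; first by move=> t ht; exact: ay.2.
apply: filterS dy; first exact: (ae_filter_ringOfSetsType mu).
by move=> t h ht; rewrite yE //; exact: h.
Qed.

End picard.

Section uniqueness.
Context {R : realType} {V : normedModType R}.
Notation mu := (@lebesgue_measure R).

Lemma ae_closed_itv (P : R -> Prop) (a b : R) :
  {ae mu, forall t, a <= t < b -> P t} -> {ae mu, forall t, a <= t <= b -> P t}.
Proof.
move=> h.
have hb : {ae mu, forall t, t <> b}.
  exists [set b]; split => //; first by rewrite lebesgue_measure_set1.
  by move=> t /= /contrapT ->.
apply: (@filterS2 _ _ (ae_filter_ringOfSetsType mu) _ _ _ _ h hb).
move=> t ht tb /andP[at_ tb']; apply: ht; rewrite at_ /= lt_neqAle tb' andbT; exact/eqP.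
Qed.

Lemma ac_onB (F G : R -> V) a b : ac_on F a b -> ac_on G a b ->
  ac_on (fun t => F t - G t) a b.
Proof.
move=> hF hG e e0.
have e2 : 0 < e / 2 by lra.
have [d d0 hd] := hF _ e2; have [d' d'0 hd'] := hG _ e2.
exists (Num.min d d'); first by rewrite lt_min d0.
move=> N s t h1 h2; rewrite lt_min => /andP[h3 h4].
have := hd N s t h1 h2 h3; have := hd' N s t h1 h2 h4.
have : \sum_i `|F (t i) - G (t i) - (F (s i) - G (s i))| <=
   \sum_i `|F (t i) - F (s i)| + \sum_i `|G (t i) - G (s i)|.
  rewrite -big_split /=; apply: ler_sum => i _.
  by rewrite opprD addrACA -opprD; exact: ler_normB.
lra.
Qed.

Lemma ac_on_sub (F : R -> V) (a b c d : R) : a <= c -> d <= b -> ac_on F a b -> ac_on F c d.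
Proof.
move=> ac db h e /h [de de0 hd]; exists de => // N s t h1; apply: hd => i.
have := h1 i; lra.
Qed.

Lemma ac_on_cont (F : R -> V) (a b : R) : ac_on F a b -> forall e, 0 < e ->
  exists2 d : R, 0 < d & forall s t, a <= s <= b -> a <= t <= b -> `|t - s| < d ->
    `|F t - F s| < e.
Proof.
move=> h e /h [d d0 hd]; exists d => //.
suff H s t : a <= s <= b -> a <= t <= b -> s <= t -> `|t - s| < d -> `|F t - F s| < e.
  move=> s t hs ht hst; have [|/ltW ts] := leP s t; first by move=> ?; exact: H.
  by rewrite distrC; apply: H => //; rewrite distrC.
move=> hs ht st; rewrite ger0_norm ?subr_ge0 // => td.
have := hd 1%N (fun=> s) (fun=> t); rewrite !big_ord1; apply => //.
  by move=> _; lra.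
by move=> i j _ _ _; rewrite !ord1.
Qed.

(** Induction on intervals for the implication that agreement at the left end gives agreement
    throughout. Around a point where the curves differ, they differ nearby and the premise fails.
    Around a point where they agree, a short interval makes each application of the mean value
    inequality halve the bound on the difference, which is therefore zero. *)
Lemma ode_unique (G : R -> V -> V) (D : set V) (y z : R -> V) (a b : R) : a <= b ->
  ac_on y a b -> ac_on z a b -> (forall t, a <= t <= b -> D (y t) /\ D (z t)) ->
  {ae mu, forall t, a <= t <= b -> is_derive t (1:R) y (G t (y t))} ->
  {ae mu, forall t, a <= t <= b -> is_derive t (1:R) z (G t (z t))} ->
  (forall s, a <= s <= b -> exists r L : R, 0 < r /\ forall t u w, a <= t <= b ->
     D u -> D w -> `|u - z s| < r -> `|w - z s| < r -> `|G t u - G t w| <= L * `|u - w|) ->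
  y a = z a -> forall t, a <= t <= b -> y t = z t.
Proof.
move=> ab acy acz Dyz dy dz lG yza.
suff H : forall u, a <= u <= b -> y u = z u by [].
move: yza; apply: (@additive_interval R
  (fun s t => y s = z s -> forall u, s <= u <= t -> y u = z u)) => //.
  move=> s t u hs ht P1 P2 ys w /andP[sw wu].
  have [wt|tw] := leP w t; first by apply: P1 => //; rewrite sw.
  by apply: P2; rewrite ?(ltW tw) //; apply: P1 => //; lra.
move=> c cab; have [yzc|yzc] := pselect (y c = z c); last first.
  have e0 : 0 < `|y c - z c| by rewrite normr_gt0 subr_eq0; exact/eqP.
  have [d d0 hd] := ac_on_cont (ac_onB acy acz) e0.
  exists d => // s t hs ht sd td ys u hu; exfalso.
  have := hd s c ltac:(lra) cab; rewrite ys subrr subr0 ltxx => h.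
  suff : false by []; apply: h; rewrite ger0_norm; lra.
have [r [L [r0 hL]]] := lG c cab.
have [d d0 hd] := ac_on_cont acy r0; have [d' d'0 hd'] := ac_on_cont acz r0.
pose K := `|L| + 1; have K0 : 0 < K by rewrite ltr_wpDl.
pose d1 := Num.min (Num.min d d') ((4 * K)^-1).
have d10 : 0 < d1 by rewrite !lt_min d0 d'0 invr_gt0; lra.
exists d1 => // s t hs ht sd td ys.
have d1d : d1 <= d by rewrite /d1 !ge_min lexx.
have d1d' : d1 <= d' by rewrite /d1 !ge_min lexx orbT.
have d1K : d1 <= (4 * K)^-1 by rewrite /d1 ge_min lexx orbT.
have st : s <= t by lra.
have Kst : K * (t - s) <= 2^-1.
  have -> : 2^-1 = K * (2 * (4 * K)^-1) by field; rewrite gt_eqF.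
  rewrite ler_pM2l //; lra.
have near u : s <= u <= t -> `|y u - z c| < r /\ `|z u - z c| < r.
  move=> hu; rewrite -{1}yzc; split; [apply: hd|apply: hd']; rewrite ?ltr_norml; lra.
have bnd k u : s <= u <= t -> `|y u - z u| <= 2 * r / 2 ^+ k.
  elim: k u => [|k IH] u hu.
    have [h1 h2] := near u hu; have := ler_distD (z c) (y u) (z u).
    rewrite (distrC (z c)) expr0; lra.
  have r2 : 0 <= 2 * r / 2 ^+ k by apply: divr_ge0; [lra|exact: exprn_ge0].
  have H : `|(y u - z u) - (y s - z s)| <= K * (2 * r / 2 ^+ k) * (u - s).
    apply: (@ae_mvi R V (fun t => y t - z t)); first lra.
    - by rewrite mulr_ge0 // ltW.
    - apply: ac_onB; [apply: ac_on_sub acy|apply: ac_on_sub acz]; lra.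
    - apply: (@filterS2 _ _ (ae_filter_ringOfSetsType mu) _ _ _ _ dy dz).
      move=> w hy hz hw; have hw' : a <= w <= b by lra.
      exists (G w (y w) - G w (z w)); first by apply: is_derive_sub; [exact: hy|exact: hz].
      have hw2 : s <= w <= t by lra.
      have [h1 h2] := near w hw2; have [D1 D2] := Dyz w hw'.
      rewrite (le_trans (hL w _ _ hw' D1 D2 h1 h2)) //.
      rewrite (le_trans (_ : _ <= K * `|y w - z w|)) //.
        by rewrite ler_wpM2r // (le_trans (ler_norm L)) // lerDl.
      by rewrite ler_pM2l // IH.
  move: H; rewrite ys subrr subr0 => /le_trans; apply.
  rewrite exprSr invfM mulrA.
  have : K * (u - s) <= 2^-1 by rewrite (le_trans _ Kst) // ler_pM2l //; lra.
  move=> h; have := ler_wpM2r r2 h; lra.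
move=> u hu; apply/eqP; rewrite -subr_eq0 -normr_le0; apply/ler_addgt0Pr => e e0.
rewrite add0r.
have [k hk] : exists k, 2 * r / 2 ^+ k < e.
  exists (Num.truncn (2 * r / e)).+1.
  rewrite ltr_pdivrMr ?exprn_gt0 // [ltRHS]mulrC -ltr_pdivrMr //.
  have /andP[_ h] := @truncn_itv R (2 * r / e) ltac:(by apply: divr_ge0; [lra|exact: ltW]).
  apply: (lt_trans h); rewrite -natrX ltr_nat; exact: ltn_expl.
exact: le_trans (bnd k u hu) (ltW hk).
Qed.

End uniqueness.

(** * Differentials, partial derivatives and the symmetry of second derivatives *)

Section diff_tools.
Context {R : realType} {V W : normedModType R}.

Lemma linear_bound_continuous (L : {linear V -> W}) (K : R) :
  (forall h, `|L h| <= K * `|h|) -> continuous L.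
Proof.
move=> LK y; apply/cvgrPdist_lt => e e0.
have K0 : 0 < `|K| + 1 by rewrite ltr_wpDl.
apply/nbhs_ballP; exists (e / (`|K| + 1)); first exact: divr_gt0.
move=> z; rewrite -ball_normE /= => yz; rewrite -linearB.
apply: (le_lt_trans (LK _)).
apply: (@le_lt_trans _ _ ((`|K| + 1) * `|y - z|)).
  by rewrite ler_wpM2r // (le_trans (ler_norm K)) // lerDl.
by rewrite mulrC -ltr_pdivlMr.
Qed.

Lemma diff_eps (f : V -> W) (x : V) (L : {linear V -> W}) : continuous L ->
  (forall e : R, 0 < e -> exists2 d, 0 < d & forall h, `|h| < d ->
     `|f (x + h) - f x - L h| <= e * `|h|) ->
  differentiable f x /\ forall h, 'd f x h = L h.
Proof.
move=> cL H.
have E : f \o shift x = cst (f x) + L +o_ 0 id.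
  apply/eqaddoP => e e0; have [d d0 hd] := H e e0.
  apply/nbhs_ballP; exists d => //= h; rewrite -ball_normE /= sub0r normrN => hh.
  rewrite -[X in `|X|]/(f (h + x) - (f x + L h)) opprD addrA (addrC h); exact: hd.
have D := diff_unique cL E.
split; last by move=> h; rewrite D.
by apply/diff_locallyP; rewrite D.
Qed.

Lemma diff_eps_conv (f : V -> W) (x : V) : differentiable f x ->
  forall e : R, 0 < e -> exists2 d, 0 < d & forall h, `|h| < d ->
     `|f (x + h) - f x - 'd f x h| <= e * `|h|.
Proof.
move=> /diff_locallyP [_ /eqaddoP H] e e0.
have /nbhs_ballP [d /= d0 hd] := H e e0.
exists d => // h hh; have := hd h; rewrite -ball_normE /= sub0r normrN => /(_ hh).
by rewrite -[X in `|X|]/(f (h + x) - (f x + 'd f x h)) opprD addrA (addrC h).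
Qed.

(** The expressions of [L2] and [lie] hold on [D] only; as [D] is open they hold near each of its
    points, which determines the differential. *)
Lemma diff_near (f g : V -> W) (x : V) : (\near x, f x = g x) -> differentiable f x ->
  differentiable g x /\ forall h, 'd g x h = 'd f x h.
Proof.
move=> fg df; apply: diff_eps => [|e e0]; first exact: diff_continuous.
have [d d0 hd] := diff_eps_conv df e0.
have /nbhs_ballP [d' /= d'0 hd'] := fg.
exists (Num.min d d'); first by rewrite lt_min d0.
move=> h; rewrite lt_min => /andP[h1 h2].
rewrite -(nbhs_singleton fg) -hd'; first exact: hd.
by rewrite -ball_normE /= opprD addrA subrr sub0r normrN.
Qed.

Lemma diff_scale (k : V -> R) (F : V -> W) (x : V) :
  differentiable (k : V -> R^o) x -> differentiable F x ->
  differentiable (fun y => k y *: F y) x /\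
  forall h, 'd (fun y => k y *: F y) x h = k x *: 'd F x h + 'd (k : V -> R^o) x h *: F x.
Proof.
move=> dk dF.
have scb : bilinear_for (GRing.Scale.Law.clone _ _ *:%R _) (GRing.Scale.Law.clone _ _ *:%R _)
  (fun (a : R^o) (w : W) => a *: w).
  split=> [u|u] a y z /=; first by rewrite scalerDl scalerA.
  by rewrite scalerDr !scalerA mulrC.
pose b : {bilinear R^o -> W -> W} := HB.pack (fun (a : R^o) (w : W) => a *: w)
  (bilinear_isBilinear.Build R R^o W W _ _ (fun (a : R^o) (w : W) => a *: w) scb).
have cb : continuous (fun p : R^o * W => b p.1 p.2) by exact: scale_continuous.
have dkF : differentiable (fun y => (k y : R^o, F y)) x by exact: differentiable_pair.
have db : differentiable (fun p : R^o * W => b p.1 p.2) (k x : R^o, F x).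
  exact: differentiable_bilin.
have -> : (fun y => k y *: F y) = (fun p : R^o * W => b p.1 p.2) \o (fun y => (k y : R^o, F y)) by [].
split; first exact: differentiable_comp.
move=> h.
have E := @diff_bilin _ _ _ _ b (k x : R^o, F x) cb.
have -> : 'd ((fun p : R^o * W => b p.1 p.2) \o (fun y => (k y : R^o, F y))) x h =
    'd (fun p : R^o * W => b p.1 p.2) (k x : R^o, F x) ('d (fun y => (k y : R^o, F y)) x h).
  by rewrite diff_comp.
by rewrite E diff_pair.
Qed.

Lemma diff_bigsum (I : finType) (F : I -> V -> W) (x : V) :
  (forall i, differentiable (F i) x) ->
  differentiable (fun y => \sum_i F i y) x /\
  forall h, 'd (fun y => \sum_i F i y) x h = \sum_i 'd (F i) x h.
Proof.
move=> dF; elim: (index_enum I) => [|i r [IH1 IH2]].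
  have -> : (fun y => \sum_(i <- [::]) F i y) = cst 0.
    by apply/funext => y; rewrite big_nil.
  by split=> [|h]; [exact: differentiable_cst|rewrite diff_cst big_nil].
have -> : (fun y => \sum_(j <- i :: r) F j y) = F i + fun y => \sum_(j <- r) F j y.
  by apply/funext => y; rewrite big_cons.
split=> [|h]; first exact: differentiableD.
by rewrite diffD //= big_cons /= -IH2.
Qed.

Lemma is_derive_dir (f : V -> W) (q v : V) (t : R) : derivable f (q + t *: v) v ->
  is_derive t (1:R) (fun s => f (q + s *: v)) ('D_v f (q + t *: v)).
Proof.
move=> df.
have E : (fun h : R => h^-1 *: (((fun s => f (q + s *: v)) \o shift t) (h *: 1) - f (q + t *: v))) =
   (fun h => h^-1 *: ((f \o shift (q + t *: v)) (h *: v) - f (q + t *: v))).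
  by apply/funext => h /=; rewrite scaler1 scalerDl addrCA.
split; first by rewrite /derivable E.
by rewrite /derive E.
Qed.

Lemma mvi_abs (F : R -> W) (c B : R) :
  (forall t, `|t| <= `|c| -> exists2 v, is_derive t (1:R) F v & `|v| <= B) ->
  `|F c - F 0| <= B * `|c|.
Proof.
move=> h; have [c0|/ltW c0] := leP 0 c.
  have := @mvi R W F 0 c B c0; rewrite subr0 (ger0_norm c0); apply=> t ht; apply: h.
  rewrite !ger0_norm //; lra.
have := @mvi R W F c 0 B c0; rewrite sub0r (ler0_norm c0) distrC; apply=> t ht; apply: h.
rewrite !ler0_norm //; lra.
Qed.

End diff_tools.

Section C1.
Context {R : realType} {n : nat}.
Notation V := 'cV[R]_n.
Notation e_ i := (delta_mx i 0 : V).
Implicit Types (D : set V) (f : V -> V).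

Lemma norm_delta (i : 'I_n) : `|e_ i| <= 1.
Proof. by apply: cVnorm_le => // j; rewrite mxE normr_nat; case: (_ && _). Qed.

Lemma open_cball D (x : V) : open D -> D x -> exists2 r : R, 0 < r & forall y, `|y - x| < r -> D y.
Proof.
move=> oD Dx; have /nbhs_ballP[r /= r0 hr] := open_nbhs_nbhs (conj oD Dx).
by exists r => // y yx; apply: hr; rewrite -ball_normE /= distrC.
Qed.

Lemma cont_eps (U W : normedModType R) (F : U -> W) (x : U) : {for x, continuous F} ->
  forall e : R, 0 < e -> exists2 d, 0 < d & forall y, `|y - x| < d -> `|F y - F x| < e.
Proof.
move=> /cvgrPdist_lt cF e /cF /nbhs_ballP[d /= d0 hd]; exists d => // y yx.
by rewrite distrC; apply: hd; rewrite -ball_normE /= distrC.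
Qed.

Lemma Ck_cont k D f x : Ck k D f -> D x -> {for x, continuous f}.
Proof. by case: k => [|k] [h _] /h. Qed.

Lemma Ck_derivable k D f x i : Ck k.+1 D f -> D x -> derivable f x (e_ i).
Proof. by move=> [_ /(_ i) [h _]] /h. Qed.

Lemma Ck_partial k D f i : Ck k.+1 D f -> Ck k D ('D_(e_ i) f).
Proof. by move=> [_ /(_ i) []]. Qed.

Lemma CkW k D f : Ck k.+1 D f -> Ck k D f.
Proof.
elim: k f => [|k IH] f [h1 h2]; first by split.
split=> // i; have [h3 h4] := h2 i; split=> //; exact: IH.
Qed.

Definition lin_of (c : 'I_n -> V) (h : V) : V := \sum_i h i 0 *: c i.

Lemma lin_of_linear c : linear (lin_of c).
Proof.
move=> a u v; rewrite /lin_of scaler_sumr -big_split /=; apply: eq_bigr => i _.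
by rewrite !mxE scalerDl scalerA.
Qed.

Lemma lin_of_bound c (B : R) : (forall i, `|c i| <= B) -> forall h, `|lin_of c h| <= n%:R * B * `|h|.
Proof.
move=> cB h; rewrite /lin_of (le_trans (ler_norm_sum _ _ _)) //.
have H (i : 'I_n) : true -> `|h i 0 *: c i| <= B * `|h|.
  by move=> _; rewrite normrZ mulrC ler_pM // cVnorm_ge.
have -> : n%:R * B * `|h| = \sum_(i < n) B * `|h|.
  by rewrite sumr_const card_ord -[RHS]mulr_natl mulrA.
exact: ler_sum.
Qed.

(** [Ck] speaks of coordinate directions, whereas the expansion differentiates along arbitrary
    fields; continuity of the partial derivatives bridges the two. *)
Lemma C1_diff D f x : open D -> Ck 1 D f -> D x ->
  differentiable f x /\ forall h, 'd f x h = \sum_i h i 0 *: 'D_(e_ i) f x.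
Proof.
move=> oD Cf Dx.
pose c i := 'D_(e_ i) f x.
pose L : {linear V -> V} := HB.pack (lin_of c) (GRing.isLinear.Build _ _ _ _ _ (lin_of_linear c)).
have := @diff_eps R V V f x L; apply.
  move=> y.
  have cB i : `|c i| <= \sum_i `|c i|.
    by rewrite (bigD1 i) //= lerDl sumr_ge0.
  exact: (linear_bound_continuous (L := L) (lin_of_bound cB)).
move=> e e0.
pose e1 := e / (n%:R + 1).
have e10 : 0 < e1 by rewrite divr_gt0 // ltr_wpDl.
have /choice [d hd] : forall i, exists d, 0 < d /\ forall y, `|y - x| < d ->
    `|'D_(e_ i) f y - 'D_(e_ i) f x| < e1.
  move=> i; have [d d0 hd] := cont_eps (Ck_cont (Ck_partial i Cf) Dx) e10.
  by exists d.
have [r r0 hr] := open_cball oD Dx.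
exists (Num.min r (\big[Num.min/1]_i d i)).
  by rewrite lt_min r0 /=; apply/bigmin_gtP; split => // i _; have [] := hd i.
move=> h; rewrite lt_min => /andP[hhr /bigmin_gtP [_ hhd]].
(* [hk k] keeps the first [k] coordinates of [h], so the path from [x] to [x + h] follows coordinate
   directions; in the sup norm it never gets farther from [x] than the norm of [h]. *)
pose hk k : V := \col_i (if (i < k)%N then h i 0 else 0).
have hk0 : hk 0 = 0 by apply/colP => i; rewrite !mxE.
have hkn : hk n = h by apply/colP => i; rewrite !mxE ltn_ord.
have -> : f (x + h) - f x - L h =
    \sum_(k < n) (f (x + hk k.+1) - f (x + hk k) - h k 0 *: c k).
  rewrite sumrB; congr (_ - _).
  rewrite -(big_mkord xpredT (fun k => f (x + hk k.+1) - f (x + hk k))).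
  by rewrite telescope_sumr // hkn hk0 addr0.
have key (k : 'I_n) : true -> `|f (x + hk k.+1) - f (x + hk k) - h k 0 *: c k| <= e1 * `|h|.
  move=> _.
  have hkS : hk k.+1 = hk k + h k 0 *: e_ k.
    apply/colP => i; rewrite !mxE eqxx andbT ltnS leq_eqVlt.
    rewrite val_eqE; have [->|ik] := eqVneq i k.
      by rewrite ltnn /= add0r mulr1.
    by rewrite /= mulr0 addr0.
  have hkle s : `|s| <= `|h k 0| -> `|x + hk k + s *: e_ k - x| <= `|h|.
    move=> hs; rewrite addrAC (addrAC x) subrr add0r.
    apply: cVnorm_le => // i; rewrite !mxE eqxx andbT.
    have [->|ik] := eqVneq i k.
      by rewrite ltnn mulr1 add0r; apply: (le_trans hs); exact: cVnorm_ge.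
    by rewrite mulr0 addr0; case: ifP => _; rewrite ?normr0 // cVnorm_ge.
  have M := @mvi_abs R V (fun s => f (x + hk k + s *: e_ k) - s *: c k) (h k 0) e1.
  have -> : f (x + hk k.+1) - f (x + hk k) - h k 0 *: c k =
    (f (x + hk k + h k 0 *: e_ k) - h k 0 *: c k) - (f (x + hk k + 0 *: e_ k) - 0 *: c k).
    rewrite !scale0r addr0 subr0 hkS addrA; exact: addrAC.
  apply: (@le_trans _ _ (e1 * `|h k 0|)); last by rewrite ler_pM2l // cVnorm_ge.
  apply: M => s hs.
  have hy := hkle s hs.
  exists ('D_(e_ k) f (x + hk k + s *: e_ k) - c k).
    apply: is_derive_sub.
      apply: is_derive_dir; apply: (@Ck_derivable 0 D f _ k Cf); apply: hr.
      exact: le_lt_trans hy _.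
    rewrite -[X in is_derive _ _ _ X]addr0 -[X in is_derive _ _ _ (X + _)]scale1r.
    rewrite -[X in is_derive _ _ _ (_ + X)](scaler0 _ s).
    exact: (@is_derive_scale _ _ id (cst (c k))).
  apply/ltW/(hd k).2; apply: le_lt_trans hy _; exact: hhd.
rewrite (le_trans (ler_norm_sum _ _ _)) // (le_trans (ler_sum _ key)) //.
rewrite sumr_const card_ord -[leLHS]mulr_natl mulrA ler_wpM2r //.
have h1 : e1 * (n%:R + 1) = e by rewrite divfK // gt_eqF // ltr_wpDl.
lra.
Qed.

End C1.

Section schwarz.
Context {R : realType} {n : nat}.
Notation V := 'cV[R]_n.
Notation e_ i := (delta_mx i 0 : V).
Implicit Types (D : set V) (f : V -> V).

Lemma is_derive_line (c : V) (s : R) : is_derive s (1:R) (fun s : R => s *: c) c.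
Proof.
rewrite -[X in is_derive _ _ _ X]addr0 -[X in is_derive _ _ _ (X + _)]scale1r.
rewrite -[X in is_derive _ _ _ (_ + X)](scaler0 _ s).
exact: (@is_derive_scale _ _ id (cst c)).
Qed.

(** Nested mean value inequalities: the outer one moves along [e_ i], and its derivative, a
    difference of ['D_(e_ i) f] across a step along [e_ j], is estimated by the inner one. *)
Lemma second_difference D f x i j : open D -> Ck 2 D f -> D x ->
  forall e : R, 0 < e -> exists2 d, 0 < d & forall s : R, 0 < s < d ->
  `|f (x + s *: e_ i + s *: e_ j) - f (x + s *: e_ i) - (f (x + s *: e_ j) - f x)
    - (s * s) *: 'D_(e_ j) ('D_(e_ i) f) x| <= e * (s * s).
Proof.
move=> oD Cf Dx e e0.
set A := 'D_(e_ j) ('D_(e_ i) f) x.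
have Ci := Ck_partial i Cf; have Cij := Ck_partial j Ci.
have [d d0 hd] := cont_eps (Ck_cont Cij Dx) e0.
have [r r0 hr] := open_cball oD Dx.
exists (Num.min r d / 2); first by rewrite divr_gt0 // lt_min r0.
move=> s /andP[s0 sd].
have near u v : `|u| <= s -> `|v| <= s -> `|x + u *: e_ i + v *: e_ j - x| < Num.min r d.
  move=> us vs; rewrite -(addrA x) addrAC subrr add0r (le_lt_trans (ler_normD _ _)) //.
  rewrite !normrZ.
  have h1 : `|u| * `|e_ i| <= s by rewrite -[s]mulr1 ler_pM // norm_delta.
  have h2 : `|v| * `|e_ j| <= s by rewrite -[s]mulr1 ler_pM // norm_delta.
  lra.
have nD u v : `|u| <= s -> `|v| <= s -> D (x + u *: e_ i + v *: e_ j).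
  by move=> us vs; apply: hr; apply: lt_le_trans (near u v us vs) _; rewrite ge_min lexx.
have ns : `|s| = s by rewrite ger0_norm // ltW.
have inner u : `|u| <= s -> `|('D_(e_ i) f (x + u *: e_ i + s *: e_ j) - s *: A) -
    ('D_(e_ i) f (x + u *: e_ i + 0 *: e_ j) - 0 *: A)| <= e * s.
  move=> us; rewrite -[X in _ * X]ns.
  apply: (@mvi_abs R V (fun v => 'D_(e_ i) f (x + u *: e_ i + v *: e_ j) - v *: A)) => v.
  rewrite ns => vs; exists ('D_(e_ j) ('D_(e_ i) f) (x + u *: e_ i + v *: e_ j) - A).
    apply: is_derive_sub; last exact: is_derive_line.
    by apply: is_derive_dir; apply: (@Ck_derivable _ _ 0 D _ _ j Ci); exact: nD.
  apply/ltW/hd; apply: lt_le_trans (near u v us vs) _; by rewrite ge_min lexx orbT.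
have := @mvi_abs R V (fun u => f (x + s *: e_ j + u *: e_ i) - f (x + u *: e_ i) - u *: (s *: A)) s (e * s).
rewrite ns !scale0r !addr0 subr0 scalerA mulrA.
rewrite (addrAC x (s *: e_ j)) [X in `|X|]addrAC; apply => u us.
exists ('D_(e_ i) f (x + s *: e_ j + u *: e_ i) - 'D_(e_ i) f (x + u *: e_ i) - s *: A).
  apply: is_derive_sub; last exact: is_derive_line.
  apply: is_derive_sub; apply: is_derive_dir; apply: (@Ck_derivable _ _ 1 D _ _ i Cf).
    by rewrite addrAC; apply: nD => //; rewrite ns.
  by rewrite -[x + _]addr0 -(scale0r (e_ j)); apply: nD => //; rewrite normr0 ltW.
have := inner u us; rewrite !scale0r addr0 subr0.
by rewrite (addrAC x (s *: e_ j)) [X in `|X| <= _]addrAC.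
Qed.

(** The second difference takes the same value for both orders of the directions, so both mixed
    derivatives times [s * s] lie within [e / 2 * (s * s)] of it. *)
Lemma schwarz D f x i j : open D -> Ck 2 D f -> D x ->
  'D_(e_ i) ('D_(e_ j) f) x = 'D_(e_ j) ('D_(e_ i) f) x.
Proof.
move=> oD Cf Dx; apply/eqP; rewrite -subr_eq0 -normr_le0; apply/ler_addgt0Pr => e e0.
rewrite add0r; have e2 : 0 < e / 2 by lra.
have [d d0 hd] := second_difference i j oD Cf Dx e2.
have [d' d'0 hd'] := second_difference j i oD Cf Dx e2.
pose s := Num.min d d' / 2.
have m0 : 0 < Num.min d d' by rewrite lt_min d0.
have s0 : 0 < s by rewrite /s; lra.
have m1 : Num.min d d' <= d by rewrite ge_min lexx.
have m2 : Num.min d d' <= d' by rewrite ge_min lexx orbT.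
have sd : s < d by rewrite /s; lra.
have sd' : s < d' by rewrite /s; lra.
have h := hd s ltac:(by rewrite s0); have h' := hd' s ltac:(by rewrite s0).
have ss : 0 < s * s by rewrite mulr_gt0.
rewrite -(ler_pM2l ss) -[X in X * `|_|](ger0_norm (ltW ss)) -normrZ scalerBr.
rewrite (addrAC x (s *: e_ j)) in h'.
set P := f (x + s *: e_ i + s *: e_ j) in h h'.
set Q := f (x + s *: e_ i) in h h'; set S := f (x + s *: e_ j) in h h'.
have E : P - S - (Q - f x) = P - Q - (S - f x).
  by rewrite !opprB (addrC (f x)) (addrC (f x)) !addrA (addrAC P).
rewrite E in h'.
have -> : s * s * e = e / 2 * (s * s) + e / 2 * (s * s) by field.
apply: le_trans (ler_distD (P - Q - (S - f x)) _ _) _.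
by apply: lerD; [rewrite distrC; exact: h'|exact: h].
Qed.

End schwarz.

(** * Lie brackets as combinations of iterated derivatives *)

Section brackets.
Context {R : realType} {n : nat} {C : finType}.
Notation V := 'cV[R]_n.
Notation e_ i := (delta_mx i 0 : V).
Variables (D : set V) (X : C -> V -> V).
Hypotheses (oD : open D) (CX : forall c, Ck 2 D (X c)).

Lemma near_open (P : V -> Prop) y : (forall y, D y -> P y) -> D y -> \near y, P y.
Proof.
move=> h Dy; have := open_nbhs_nbhs (conj oD Dy).
by rewrite -nbhs_nearE; apply: filterS => z /h.
Qed.

Lemma X_diff c y : D y ->
  differentiable (X c) y /\ forall h, 'd (X c) y h = \sum_p h p 0 *: 'D_(e_ p) (X c) y.
Proof. by move=> Dy; apply: (C1_diff oD (CkW (CX c)) Dy). Qed.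

Lemma dX_diff c p y : D y -> differentiable ('D_(e_ p) (X c)) y /\
  forall h, 'd ('D_(e_ p) (X c)) y h = \sum_q h q 0 *: 'D_(e_ q) ('D_(e_ p) (X c)) y.
Proof. by move=> Dy; apply: (C1_diff oD (Ck_partial p (CX c)) Dy). Qed.

Lemma diff_coord (f : V -> V) p y : differentiable f y ->
  differentiable (fun z => f z p 0 : R^o) y /\
  forall h, 'd (fun z => f z p 0 : R^o) y h = ('d f y h) p 0.
Proof.
move=> df.
have lin : linear (fun h => ('d f y h) p 0 : R^o).
  by move=> a u v; rewrite linearP !mxE.
pose L : {linear V -> R^o} := HB.pack (fun h => ('d f y h) p 0 : R^o)
  (GRing.isLinear.Build _ _ _ _ _ lin).
apply: (@diff_eps R V R^o _ y L).
  have cd : continuous ('d f y) by exact: diff_continuous.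
  move=> h; apply: (@continuous_comp _ _ _ ('d f y) (fun w : V => w p 0)); first exact: cd.
  exact: coord_continuous.
move=> e e0; have [d' d'0 hd'] := diff_eps_conv df e0; exists d' => // h /hd'.
apply: le_trans; have := cVnorm_ge (f (y + h) - f y - 'd f y h) p.
by rewrite !mxE.
Qed.

Lemma L2_near c d y : D y ->
  \near y, \sum_p (X d y) p 0 *: 'D_(e_ p) (X c) y = L2 X c d y.
Proof. by apply: near_open => z Dz; rewrite /L2 (X_diff c Dz).2. Qed.

Lemma L2_diff c d y : D y -> differentiable (L2 X c d) y /\
  forall h, 'd (L2 X c d) y h = 'd (X c) y ('d (X d) y h) +
    \sum_p (X d y) p 0 *: \sum_q h q 0 *: 'D_(e_ q) ('D_(e_ p) (X c)) y.
Proof.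
move=> Dy.
have Hp p : differentiable (fun y => (X d y) p 0 *: 'D_(e_ p) (X c) y) y /\
    forall h, 'd (fun y => (X d y) p 0 *: 'D_(e_ p) (X c) y) y h =
    (X d y) p 0 *: 'd ('D_(e_ p) (X c)) y h + ('d (X d) y h) p 0 *: 'D_(e_ p) (X c) y.
  have [h1 h2] := diff_coord p (X_diff d Dy).1.
  have [h3 h4] := diff_scale h1 (dX_diff c p Dy).1.
  split; first exact: h3.
  move=> h. apply: (etrans (h4 h)). congr (_ + _). congr (_ *: _). exact: h2.
have [S1 S2] := diff_bigsum (fun p => (Hp p).1).
have [h1 h2] := diff_near (L2_near c d Dy) S1.
split; first exact: h1.
move=> h; apply: (etrans (h2 h)); apply: (etrans (S2 h)).
apply: (etrans (eq_bigr _ (fun p _ => (Hp p).2 h))).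
rewrite big_split /= addrC; congr (_ + _); first exact/esym/(X_diff c Dy).2.
by apply: eq_bigr => p _; congr (_ *: _); exact: (dX_diff c p Dy).2.
Qed.

(** The terms with second derivatives of [X c] are symmetric in the two inner directions by Schwarz
    and cancel; only the differential of [X c] on the antisymmetrised inner term is left. *)
Lemma L3_sub c d e y : D y -> L3 X c d e y - L3 X c e d y = 'd (X c) y (L2 X d e y - L2 X e d y).
Proof.
move=> Dy; rewrite linearB /=.
apply: (etrans (congr2 (fun a b => a - b) ((L2_diff c d Dy).2 _) ((L2_diff c e Dy).2 _))).
suff -> : \sum_p (X d y) p 0 *: (\sum_q (X e y) q 0 *: 'D_(e_ q) ('D_(e_ p) (X c)) y) =
          \sum_p (X e y) p 0 *: (\sum_q (X d y) q 0 *: 'D_(e_ q) ('D_(e_ p) (X c)) y).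
  by rewrite opprD addrACA subrr addr0.
transitivity (\sum_p \sum_q (X d y p 0 * X e y q 0) *: 'D_(e_ q) ('D_(e_ p) (X c)) y).
  by apply: eq_bigr => p _; rewrite scaler_sumr; apply: eq_bigr => q _; rewrite scalerA.
rewrite exchange_big /=; apply: eq_bigr => q _; rewrite scaler_sumr.
by apply: eq_bigr => p _; rewrite scalerA mulrC (schwarz p q oD (CX c) Dy).
Qed.

Lemma lie_L2 c d y : D y -> lie (X c) (X d) y = L2 X d c y - L2 X c d y.
Proof.
by move=> Dy; rewrite /lie (deriveE _ (X_diff d Dy).1) (deriveE _ (X_diff c Dy).1).
Qed.

(** These four signed iterated derivatives are the target that the averages of the waves of a triple
    have to reproduce. *)
Lemma lie_L3 a b c y : D y -> lie (lie (X a) (X b)) (X c) y =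
  L3 X c b a y - L3 X c a b y - (L3 X b a c y - L3 X a b c y).
Proof.
move=> Dy; rewrite L3_sub // {1}/lie.
have [h1 h2] : differentiable (lie (X a) (X b)) y /\ forall h, 'd (lie (X a) (X b)) y h =
     'd (L2 X b a) y h - 'd (L2 X a b) y h.
  have dB : differentiable (L2 X b a - L2 X a b) y.
    by apply: differentiableB; [exact: (L2_diff b a Dy).1|exact: (L2_diff a b Dy).1].
  have nr : \near y, (L2 X b a - L2 X a b) y = lie (X a) (X b) y.
    by apply: near_open Dy => z Dz; rewrite lie_L2.
  have [k1 k2] := diff_near nr dB; split; first exact: k1.
  move=> h; apply: (etrans (k2 h)).
  have E := diffB (L2_diff b a Dy).1 (L2_diff a b Dy).1.
  exact: (congr1 (fun F : V -> V => F h) E).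
apply: (etrans (congr2 (fun a b => a - b) (deriveE _ (X_diff c Dy).1) (deriveE _ h1))).
exact: (congr2 (fun a b => a - b) (congr1 ('d (X c) y) (lie_L2 a b Dy)) (h2 _)).
Qed.

End brackets.

(** * The Euclidean norm *)

Section enorm_theory.
Context {R : realType} {n : nat}.
Implicit Types u v : 'cV[R]_n.

Lemma enorm_sq v : enorm v ^+ 2 = \sum_i v i 0 ^+ 2.
Proof. by rewrite sqr_sqrtr // sumr_ge0 // => i _; exact: sqr_ge0. Qed.

Lemma enorm_ge0 v : 0 <= enorm v. Proof. exact: sqrtr_ge0. Qed.

Lemma norm_le_enorm v : `|v| <= enorm v.
Proof.
apply: cVnorm_le => [|i]; first exact: enorm_ge0.
rewrite -sqrtr_sqr ler_sqrt ?sumr_ge0 // => [|j _]; last exact: sqr_ge0.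
by rewrite (bigD1 i) //= lerDl sumr_ge0 // => j _; exact: sqr_ge0.
Qed.

Lemma enorm_le_norm v : enorm v <= n%:R * `|v|.
Proof.
have -> : n%:R * `|v| = \sum_(i < n) `|v| by rewrite sumr_const card_ord -[RHS]mulr_natl.
have s0 : 0 <= \sum_(i < n) `|v i 0| by exact: sumr_ge0.
apply: (@le_trans _ _ (\sum_(i < n) `|v i 0|)); last by apply: ler_sum => i _; exact: cVnorm_ge.
rewrite -[leRHS]ger0_norm // -sqrtr_sqr ler_sqrt ?sqr_ge0 //.
rewrite expr2 mulr_suml; apply: ler_sum => i _; rewrite -normr_id -real_normK ?num_real //.
by rewrite expr2 normr_id ler_wpM2l // (bigD1 i) //= lerDl sumr_ge0.
Qed.

Lemma enorm_eq0 v : enorm v = 0 -> v = 0.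
Proof.
by move=> h; apply/eqP; rewrite -normr_eq0 eq_le normr_ge0 andbT -h norm_le_enorm.
Qed.

Lemma enorm0 : enorm (0 : 'cV[R]_n) = 0.
Proof. by apply/eqP; rewrite eq_le enorm_ge0 andbT (le_trans (enorm_le_norm _)) // normr0 mulr0. Qed.

Lemma enormZ (a : R) v : enorm (a *: v) = `|a| * enorm v.
Proof.
rewrite /enorm -sqrtr_sqr -sqrtrM ?sqr_ge0 //; congr Num.sqrt.
by rewrite mulr_sumr; apply: eq_bigr => i _; rewrite mxE exprMn.
Qed.

Lemma enormN v : enorm (- v) = enorm v.
Proof. by rewrite -scaleN1r enormZ normrN normr1 mul1r. Qed.

(** With [p] and [q] the two norms, each cross term [2 * u i 0 * v i 0] is at most
    [q / p * u i 0 ^+ 2 + p / q * v i 0 ^+ 2], and these bounds add up to exactly [2 * p * q]; this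
    replaces the Cauchy-Schwarz inequality. *)
Lemma enormD u v : enorm (u + v) <= enorm u + enorm v.
Proof.
have [u0|u0] := eqVneq (enorm u) 0; first by rewrite (enorm_eq0 u0) enorm0 !add0r.
have [v0|v0] := eqVneq (enorm v) 0; first by rewrite (enorm_eq0 v0) enorm0 !addr0.
have {}u0 : 0 < enorm u by rewrite lt_neqAle eq_sym u0 enorm_ge0.
have {}v0 : 0 < enorm v by rewrite lt_neqAle eq_sym v0 enorm_ge0.
rewrite -(@ler_pXn2r _ 2) // ?nnegrE ?addr_ge0 ?enorm_ge0 // enorm_sq.
set p := enorm u in u0 *; set q := enorm v in v0 *.
apply: (@le_trans _ _ (\sum_i (u i 0 ^+ 2 + v i 0 ^+ 2 + (q / p * u i 0 ^+ 2 + p / q * v i 0 ^+ 2)))).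
  apply: ler_sum => i _; rewrite mxE.
  have H : 0 <= (q * u i 0 - p * v i 0) ^+ 2 / (p * q).
    by rewrite divr_ge0 ?sqr_ge0 // mulr_ge0 // ltW.
  have E : (q * u i 0 - p * v i 0) ^+ 2 / (p * q) =
     q / p * u i 0 ^+ 2 + p / q * v i 0 ^+ 2 - 2 * u i 0 * v i 0.
    by field; rewrite !gt_eqF.
  rewrite E in H; lra.
rewrite !big_split /= -!mulr_sumr -!enorm_sq -/p -/q.
have -> : q / p * p ^+ 2 + p / q * q ^+ 2 = 2 * p * q by field; rewrite !gt_eqF.
lra.
Qed.

Lemma enormB u v : enorm (u - v) = enorm (v - u).
Proof. by rewrite -opprB enormN. Qed.

Lemma enorm_dist u v : `|enorm u - enorm v| <= enorm (u - v).
Proof.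
have h1 := enormD (u - v) v; have h2 := enormD (v - u) u.
rewrite subrK in h1; rewrite subrK enormB in h2.
rewrite ler_norml; lra.
Qed.

End enorm_theory.

(** * Compactness and uniform bounds *)

Section compactness.
Context {R : realType}.

(** One covering argument serves all the uniformity statements below. Balls of half the radius form
    the cover, so that a point near [y] still lies in the full ball around the same centre;
    monotonicity in [L] merges the finitely many local constants. *)
Lemma compact_uniform (V : normedModType R) (K : set V) (P : R -> V -> V -> Prop) :
  compact K -> (forall L L' y z, L <= L' -> P L y z -> P L' y z) ->
  (forall x, K x -> exists r L : R, 0 < r /\
     forall y z, `|y - x| < r -> `|z - x| < r -> P L y z) ->
  exists d L : R, 0 < d /\ forall y z, K y -> `|z - y| < d -> P L y z.
Proof.
move=> cK mono loc.
have /choice [rL hrL] : forall x, exists rL : R * R, K x -> 0 < rL.1 /\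
     forall y z, `|y - x| < rL.1 -> `|z - x| < rL.1 -> P rL.2 y z.
  move=> x; have [Kx|nK] := pselect (K x); last by exists (0, 0).
  by have [r [L h]] := loc x Kx; exists (r, L).
move: cK; rewrite compact_cover => /(_ V K (fun x => ball x ((rL x).1 / 2))).
case.
- move=> x Kx; exact: ball_open.
- move=> x Kx; exists x => //; apply: ballxx; have [h _] := hrL x Kx; lra.
move=> F FK Kcov.
pose s : seq V := finmap.enum_fset F.
have [d [L [d0 dL]]] : exists d L : R, 0 < d /\
    forall x, x \in s -> d <= (rL x).1 / 2 /\ (rL x).2 <= L.
  have : forall x, x \in s -> 0 < (rL x).1.
    by move=> x xs; have Kx : K x by [move: (FK x xs); rewrite inE]; have [] := hrL x Kx.
  elim: s => [|x s IH] h; first by exists 1, 0; split.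
  have [|d [L [d0 dL]]] := IH; first by move=> y ys; apply: h; rewrite inE ys orbT.
  have x0 : 0 < (rL x).1 by apply: h; rewrite mem_head.
  exists (Num.min d ((rL x).1 / 2)), (Num.max L (rL x).2); split.
    by rewrite lt_min d0 divr_gt0.
  move=> y; rewrite inE => /orP[/eqP->|/dL [h1 h2]].
    by rewrite ge_min lexx orbT le_max lexx orbT.
  by rewrite ge_min h1 le_max h2.
exists d, L; split => // y z Ky zy.
have [x xF] := Kcov y Ky; rewrite -ball_normE /= distrC => yx.
have xs : x \in s by [].
have [h1 h2] := dL x xs.
have Kx : K x by move: (FK x xs); rewrite inE.
have [r0 hP] := hrL x Kx.
apply: mono h2 _; apply: hP; first lra.
have := ler_distD y z x; lra.
Qed.

Lemma compact_bound (V W : normedModType R) (K : set V) (F : V -> W) :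
  compact K -> (forall x, K x -> {for x, continuous F}) ->
  exists2 M : R, 0 <= M & forall x, K x -> `|F x| <= M.
Proof.
move=> cK cF.
have [||d [L [d0 h]]] := @compact_uniform V K (fun L y z => `|F y| <= L) cK.
- by move=> L L' y z LL h; exact: le_trans h LL.
- move=> x Kx; have [d d0 hd] := cont_eps (cF x Kx) ltr01.
  exists d, (`|F x| + 1); split => // y z /hd h1 _.
  by have := ler_distD (F x) (F y) 0; rewrite !subr0; lra.
exists (Num.max L 0); first by rewrite le_max lexx orbT.
by move=> x Kx; rewrite le_max (h x x Kx) // subrr normr0.
Qed.

Lemma compact_ucont (V W : normedModType R) (K : set V) (F : V -> W) :
  compact K -> (forall x, K x -> {for x, continuous F}) ->
  forall e : R, 0 < e -> exists2 d, 0 < d & forall y z, K y -> K z -> `|z - y| < d -> `|F z - F y| <= e.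
Proof.
move=> cK cF e e0.
have [||d [L [d0 h]]] := @compact_uniform V K (fun L y z => `|F z - F y| <= e) cK.
- by [].
- move=> x Kx; have [d d0 hd] := cont_eps (cF x Kx) (divr_gt0 e0 (ltr0n _ 2)).
  exists d, 0; split => // y z /hd h1 /hd h2.
  by have := ler_distD (F x) (F z) (F y); rewrite (distrC (F x) (F y)); lra.
by exists d => // y z Ky _; exact: h.
Qed.

Lemma compact_thicken (V : normedModType R) (K D : set V) :
  compact K -> open D -> K `<=` D -> exists2 d : R, 0 < d & forall y z, K y -> `|z - y| < d -> D z.
Proof.
move=> cK oD KD.
have [||d [L [d0 h]]] := @compact_uniform V K (fun L y z => D z) cK.
- by [].
- move=> x /KD Dx; have /nbhs_ballP[d /= d0 hd] := open_nbhs_nbhs (conj oD Dx).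
  by exists d, 0; split => // y z _ zx; apply: hd; rewrite -ball_normE /= distrC.
by exists d.
Qed.

Lemma lipschitz_cont (V W : normedModType R) (F : V -> W) (K : R) :
  (forall y z, `|F y - F z| <= K * `|y - z|) -> continuous F.
Proof.
move=> FK y; apply/cvgrPdist_lt => e e0.
have K0 : 0 < `|K| + 1 by rewrite ltr_wpDl.
apply/nbhs_ballP; exists (e / (`|K| + 1)); first exact: divr_gt0.
move=> z; rewrite -ball_normE /= => yz; apply: (le_lt_trans (FK _ _)).
apply: (@le_lt_trans _ _ ((`|K| + 1) * `|y - z|)).
  by rewrite ler_wpM2r // (le_trans (ler_norm K)) // lerDl.
by rewrite mulrC -ltr_pdivlMr.
Qed.

Lemma norm_trmx (m n : nat) (A : 'M[R]_(m, n)) : `|A^T| <= `|A|.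
Proof.
rewrite [leLHS]/Num.norm /= mx_normrE; apply/bigmax_leP; split => // -[i j] _ /=.
rewrite mxE [leRHS]/Num.norm /= mx_normrE.
exact: (le_bigmax _ (fun ij => `|A ij.1 ij.2|) (j, i)).
Qed.

Lemma eball_compact n (r : R) : compact (@eball R n r).
Proof.
pose K := [set y : 'rV[R]_n | enorm y^T <= r].
have cK : compact K.
  apply: bounded_closed_compact.
    exists r; split; first exact: num_real.
    move=> M rM v /= vr; apply: le_trans (ltW rM); apply: le_trans vr.
    by apply: le_trans (norm_le_enorm _); rewrite -{1}[v]trmxK norm_trmx.
  have cf : continuous (fun y : 'rV[R]_n => enorm y^T : R^o).
    apply: (@lipschitz_cont _ _ _ n%:R) => y z.
    rewrite (le_trans (enorm_dist _ _)) // -linearB (le_trans (enorm_le_norm _)) //.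
    by rewrite ler_wpM2l // norm_trmx.
  apply: (@closed_comp _ _ (fun y : 'rV[R]_n => enorm y^T : R^o) [set x | x <= r]).
    by move=> y _; exact: cf.
  exact: closed_le.
have -> : @eball R n r = (fun v : 'rV[R]_n => v^T) @` K.
  apply/seteqP; split => [y hy|_ [v hv <-]//].
  by exists y^T; rewrite ?trmxK // /K /= trmxK.
apply: continuous_compact cK; apply: continuous_subspaceT.
apply: (@lipschitz_cont _ _ _ 1) => y z.
by rewrite mul1r -linearB norm_trmx.
Qed.

End compactness.

Section uniform_smooth.
Context {R : realType} {n : nat} {C : finType}.
Notation V := 'cV[R]_n.
Notation e_ i := (delta_mx i 0 : V).

Lemma cont_near (U W : normedModType R) (F G : U -> W) y : (\near y, F y = G y) ->
  {for y, continuous F} -> {for y, continuous G}.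
Proof.
move=> FG; rewrite /prop_for /continuous_at -(nbhs_singleton FG); apply: cvg_trans.
exact: near_eq_cvg.
Qed.

Lemma cont_sum (U W : normedModType R) (I : finType) (F : I -> U -> W) y :
  (forall i, {for y, continuous (F i)}) -> {for y, continuous (fun z => \sum_i F i z)}.
Proof.
move=> h; elim: (index_enum I) => [|i r IH].
  have -> : (fun z => \sum_(i <- [::]) F i z) = cst 0.
    by apply/funext => z; rewrite big_nil.
  exact: cvg_cst.
have -> : (fun z => \sum_(j <- i :: r) F j z) = F i + fun z => \sum_(j <- r) F j z.
  by apply/funext => z; rewrite big_cons.
by apply: cvgD; [exact: h|exact: IH].
Qed.

Lemma cont_add (U W : normedModType R) (F G : U -> W) y :
  {for y, continuous F} -> {for y, continuous G} -> {for y, continuous (fun z => F z + G z)}.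
Proof. exact: cvgD. Qed.

Lemma cont_scale (U W : normedModType R) (k : U -> R) (F : U -> W) y :
  {for y, continuous (k : U -> R^o)} -> {for y, continuous F} ->
  {for y, continuous (fun z => k z *: F z)}.
Proof. by move=> hk hF; apply: cvgZ. Qed.

Lemma cont_coord (U : normedModType R) (F : U -> V) i y :
  {for y, continuous F} -> {for y, continuous (fun z => F z i 0 : R^o)}.
Proof. by move=> h; apply: (@continuous_comp _ _ _ F (fun w : V => w i 0)) => //; exact: coord_continuous. Qed.

Lemma compact_bound_fin (U W : normedModType R) (I : finType) (K : set U) (F : I -> U -> W) :
  compact K -> (forall i x, K x -> {for x, continuous (F i)}) ->
  exists2 M : R, 0 <= M & forall i x, K x -> `|F i x| <= M.
Proof.
move=> cK cF.
have /choice [M hM] : forall i, exists M : R, 0 <= M /\ forall x, K x -> `|F i x| <= M.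
  by move=> i; have [M M0 h] := compact_bound cK (cF i); exists M.
exists (\sum_i M i); first by apply: sumr_ge0 => i _; have [] := hM i.
move=> i x Kx; rewrite (le_trans ((hM i).2 x Kx)) // (bigD1 i) //= lerDl.
by apply: sumr_ge0 => j _; have [] := hM j.
Qed.

Variables (D : set V) (X : C -> V -> V).
Hypotheses (oD : open D) (CX : forall c, Ck 2 D (X c)).

Lemma L2_cont c d y : D y -> {for y, continuous (L2 X c d)}.
Proof. by move=> Dy; apply: differentiable_continuous; exact: (L2_diff oD CX c d Dy).1. Qed.

Lemma L3_cont c d e y : D y -> {for y, continuous (L3 X c d e)}.
Proof.
move=> Dy.
pose T y := \sum_p (L2 X d e y) p 0 *: 'D_(e_ p) (X c) y +
    \sum_p (X d y) p 0 *: \sum_q (X e y) q 0 *: 'D_(e_ q) ('D_(e_ p) (X c)) y.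
have XC a : {for y, continuous (X a)} by exact: Ck_cont (CX a) Dy.
have X1 a p : {for y, continuous ('D_(e_ p) (X a))} by exact: Ck_cont (Ck_partial p (CX a)) Dy.
have X2 a p q : {for y, continuous ('D_(e_ q) ('D_(e_ p) (X a)))}.
  exact: Ck_cont (Ck_partial q (Ck_partial p (CX a))) Dy.
have cT : {for y, continuous T}.
  apply: cont_add.
    apply: cont_sum => p; apply: cont_scale; last exact: X1.
    by apply: cont_coord; exact: L2_cont.
  apply: cont_sum => p; apply: cont_scale; first by apply: cont_coord; exact: XC.
  apply: cont_sum => q; apply: cont_scale; last exact: X2.
  by apply: cont_coord; exact: XC.
apply: cont_near cT; apply: (near_open oD) Dy => z Dz.
apply/esym; apply: (etrans ((L2_diff oD CX c d Dz).2 _)).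
by congr (_ + _); apply: (etrans ((X_diff oD CX c Dz).2 _)).
Qed.

(** [M] is fixed before [eta]: constants built from [M] decide how small [eta] must be, and only the
    radius [rho] depends on it. *)
Lemma uniform_smooth (K : set V) : compact K -> K `<=` D ->
  exists M : R, [/\ 0 <= M,
    forall c y, K y -> `|X c y| <= M,
    forall c d e y, K y -> `|L3 X c d e y| <= M &
    forall eta : R, 0 < eta -> exists2 rho, 0 < rho & forall p r, r < rho ->
      (forall y, cball p r y -> K y) -> smooth_on X p r M eta].
Proof.
move=> cK KD.
have [M0 M00 h0] := compact_bound_fin cK (fun c x Kx => Ck_cont (CX c) (KD _ Kx)).
have [M1 M10 h1] := compact_bound_fin (F := fun cp : C * 'I_n => 'D_(e_ cp.2) (X cp.1)) cK
  (fun cp x Kx => Ck_cont (Ck_partial cp.2 (CX cp.1)) (KD _ Kx)).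
have [M2 M20 h2] := compact_bound_fin
  (F := fun cpq : C * ('I_n * 'I_n) => 'D_(e_ cpq.2.2) ('D_(e_ cpq.2.1) (X cpq.1))) cK
  (fun cpq x Kx => Ck_cont (Ck_partial cpq.2.2 (Ck_partial cpq.2.1 (CX cpq.1))) (KD _ Kx)).
have [M3 M30 h3] := compact_bound_fin (F := fun cde : C * (C * C) => L3 X cde.1 cde.2.1 cde.2.2) cK
  (fun cde x Kx => @L3_cont _ _ _ _ (KD _ Kx)).
pose N : R := n%:R.
have N0 : 0 <= N by exact: ler0n.
have NM0 : 0 <= N * M1 by rewrite mulr_ge0.
have NM1 : 0 <= N * M1 * (N * M1) by rewrite mulr_ge0.
have NM2 : 0 <= N * (M0 * (N * M2)) by rewrite !mulr_ge0.
exists (M0 + M3 + N * M1 + N * M1 * (N * M1) + N * (M0 * (N * M2))); split.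
- lra.
- move=> c y Ky; apply: (le_trans (h0 c y Ky)); lra.
- move=> c d e y Ky; apply: (le_trans (h3 (c, (d, e)) y Ky)); lra.
move=> eta eta0.
have bX c y h : K y -> `|'d (X c) y h| <= N * M1 * `|h|.
  move=> Ky; rewrite ((X_diff oD CX c (KD _ Ky)).2 h).
  by apply: lin_of_bound => p; exact: (h1 (c, p)).
have /choice [rho hrho] : forall cde : C * (C * C), exists rho, 0 < rho /\
    forall y z, K y -> K z -> `|z - y| < rho ->
      `|L3 X cde.1 cde.2.1 cde.2.2 z - L3 X cde.1 cde.2.1 cde.2.2 y| <= eta.
  move=> cde; have [rho r0 hr] := compact_ucont cK (fun x Kx => @L3_cont cde.1 cde.2.1 cde.2.2 _ (KD _ Kx)) eta0.
  by exists rho.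
exists (\big[Num.min/1]_i rho i).
  by apply/bigmin_gtP; split => // i _; have [] := hrho i.
move=> p r /bigmin_gtP[_ hr] hK y hy; have Ky := hK y hy; have Dy := KD _ Ky.
have r0 : 0 <= r by apply: le_trans hy.
have Kp : K p by apply: hK; rewrite /cball /= subrr normr0.
split.
- move=> c; split; first exact: (X_diff oD CX c Dy).1.
  move=> h; apply: (le_trans (bX c y h Ky)); apply: ler_wpM2r => //; lra.
- move=> c d; split; first exact: (L2_diff oD CX c d Dy).1.
  move=> h; rewrite ((L2_diff oD CX c d Dy).2 h).
  apply: (le_trans (ler_normD _ _)).
  have b1 : `|'d (X c) y ('d (X d) y h)| <= N * M1 * (N * M1) * `|h|.
    apply: (le_trans (bX _ _ _ Ky)); rewrite -[leRHS]mulrA; apply: ler_wpM2l => //; exact: bX.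
  have b2 : `|\sum_q (X d y) q 0 *: (\sum_q0 h q0 0 *: 'D_(e_ q0) ('D_(e_ q) (X c)) y)| <=
      N * (M0 * (N * M2)) * `|h|.
    have H q : `|\sum_q0 h q0 0 *: 'D_(e_ q0) ('D_(e_ q) (X c)) y| <= N * M2 * `|h|.
      by apply: lin_of_bound => q0; exact: (h2 (c, (q, q0))).
    have := lin_of_bound H (X d y); rewrite /lin_of => /le_trans; apply.
    rewrite -/N; have -> : N * (M0 * (N * M2)) * `|h| = N * (N * M2 * `|h|) * M0 by ring.
    by apply: ler_wpM2l; [rewrite !mulr_ge0|exact: h0].
  have h0' := normr_ge0 h.
  apply: (le_trans (lerD b1 b2)); rewrite -mulrDl; apply: ler_wpM2r => //; lra.
- move=> c d e; apply: (hrho (c, (d, e))).2 => //; apply: le_lt_trans hy _; exact: hr.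
Qed.

End uniform_smooth.

Section drift.
Context {R : realType} {n : nat}.
Notation V := 'cV[R]_n.

(** Compactness gives a constant only for pairs closer than [d]. The ball is convex, so distant
    pairs are joined by a segment cut into short pieces whose estimates add up; the induction on
    intervals does the cutting. *)
Lemma drift_lipschitz (D : set V) (g : R -> V -> V) (r1 T : R) :
  caratheodory_lipschitz D g -> @eball R n r1 `<=` D ->
  exists2 L : R, 0 <= L & forall t y z, 0 <= t <= T -> @eball R n r1 y -> @eball R n r1 z ->
    enorm (g t y - g t z) <= L * enorm (y - z).
Proof.
move=> [_ gL] KD.
have n1 : 0 < (n%:R + 1 : R) by rewrite ltr_wpDl.
have [||d [L [d0 hL]]] := @compact_uniform R V (@eball R n r1) (fun L y z => forall t, 0 <= t <= T ->
   D y -> D z -> enorm (g t y - g t z) <= L * enorm (y - z)) (@eball_compact R n r1).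
- move=> L L' y z LL h t ht Dy Dz; apply: (le_trans (h t ht Dy Dz)).
  by apply: ler_wpM2r => //; exact: enorm_ge0.
- move=> x /KD Dx; have [r [L [r0 h]]] := gL x T Dx.
  exists (r / (n%:R + 1)), L; split; first exact: divr_gt0.
  move=> y z hy hz t ht Dy Dz.
  have H u : `|u - x| < r / (n%:R + 1) -> enorm (u - x) < r.
    rewrite ltr_pdivlMr // => hu; apply: (le_lt_trans (enorm_le_norm _)).
    by apply: le_lt_trans hu; rewrite mulrC ler_wpM2l // lerDl.
  by apply: h => //; exact: H.
exists `|L| => // t y z ht hy hz.
pose w s := y + s *: (z - y).
have wK s : 0 <= s <= 1 -> @eball R n r1 (w s).
  move=> hs; rewrite /eball /= /w.
  have -> : y + s *: (z - y) = (1 - s) *: y + s *: z.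
    by rewrite scalerBl scale1r scalerBr addrAC addrA.
  apply: (le_trans (enormD _ _)); rewrite !enormZ !ger0_norm; try lra.
  have k1 : (1 - s) * enorm y <= (1 - s) * r1 by apply: ler_wpM2l; [lra|exact: hy].
  have k2 : s * enorm z <= s * r1 by apply: ler_wpM2l; [lra|exact: hz].
  lra.
have wB s s' : w s' - w s = (s' - s) *: (z - y).
  by rewrite /w opprD addrACA subrr add0r scalerBl.
have e0 := enorm_ge0 (z - y).
suff : enorm (g t (w 1) - g t (w 0)) <= `|L| * enorm (z - y) * (1 - 0).
  by rewrite /w scale1r scale0r addr0 (addrC y) subrK subr0 mulr1 enormB (enormB z).
apply: (@additive_interval R (fun s s' => enorm (g t (w s') - g t (w s)) <= `|L| * enorm (z - y) * (s' - s))) => //.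
  move=> a b c _ _ h1 h2.
  have -> : g t (w c) - g t (w a) = (g t (w c) - g t (w b)) + (g t (w b) - g t (w a)).
    by rewrite addrA subrK.
  apply: (le_trans (enormD _ _)); lra.
move=> s0 hs0.
have k0 : 0 < `|z - y| + 1 by rewrite ltr_wpDl.
exists (d / 2 / (`|z - y| + 1)); first by rewrite !divr_gt0.
move=> s s' hs hs' hd hd'.
have ws : @eball R n r1 (w s) by apply: wK; lra.
have ws' : @eball R n r1 (w s') by apply: wK; lra.
have close : `|w s - w s'| < d.
  rewrite wB normrZ distrC ger0_norm; last lra.
  have : (s' - s) * (`|z - y| + 1) < d.
    rewrite -ltr_pdivlMr // [ltRHS](_ : _ = d / 2 / (`|z - y| + 1) + d / 2 / (`|z - y| + 1)); first lra.
    by field; rewrite gt_eqF.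
  have k1 : 0 <= s' - s by lra.
  lra.
have := hL (w s') (w s) ws' close t ht (KD _ ws') (KD _ ws).
move=> /le_trans; apply; rewrite wB enormZ ger0_norm; last lra.
rewrite -mulrA [X in _ <= _ * X]mulrC; apply: ler_wpM2r; last exact: ler_norm.
by apply: mulr_ge0 => //; lra.
Qed.

End drift.

(** * Averages of the controls *)

Section increments.
Context {R : realType}.

(* c is the integral of phi over [t0, t1], given through an antiderivative. *)
Definition has_increment (t0 t1 : R) (phi : R -> R) (c : R) : Prop :=
  exists F : R -> R, [/\ forall t, is_derive t (1:R) F (phi t), F t0 = 0 & F t1 = c].

Lemma increment_add t0 t1 phi psi c d : has_increment t0 t1 phi c -> has_increment t0 t1 psi d ->
  has_increment t0 t1 (fun t => phi t + psi t) (c + d).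
Proof.
move=> [F [dF F0 F1]] [G [dG G0 G1]]; exists (fun t => F t + G t); split.
- by move=> t; apply: (@is_derive_add R R^o).
- by rewrite F0 G0 addr0.
- by rewrite F1 G1.
Qed.

Lemma increment_scale t0 t1 phi (a c : R) : has_increment t0 t1 phi c ->
  has_increment t0 t1 (fun t => a * phi t) (a * c).
Proof.
move=> [F [dF F0 F1]]; exists (fun t => a * F t); split.
- move=> t; have := @is_derive_scale R R^o (cst a) F t 0 (phi t) _ (dF t).
  by rewrite scale0r add0r; apply.
- by rewrite F0 mulr0.
- by rewrite F1.
Qed.

Lemma increment_ext t0 t1 phi psi (c d : R) : (forall t, phi t = psi t) -> c = d ->
  has_increment t0 t1 phi c -> has_increment t0 t1 psi d.
Proof. by move=> /funext -> ->. Qed.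

Lemma is_derive_affine (a b t : R) : is_derive t (1:R) (fun s => a * s + b) a.
Proof.
rewrite -[X in is_derive _ _ _ X]addr0; apply: (@is_derive_add R R^o (fun s => a * s) (cst b)).
have := @is_derive_scale R R^o (cst a) id t 0 1 _ _.
by rewrite scale0r add0r [_ *: _]mulr1; apply.
Qed.

Lemma is_derive_comp1 (F f : R -> R) (t dF df : R) :
  is_derive (f t) (1:R) F dF -> is_derive t (1:R) f df ->
  is_derive t (1:R) (fun s => F (f s)) (df * dF).
Proof.
move=> hF hf; have dFf : differentiable F (f t) by apply/derivable1_diffP.
have := @is_derive_comp_diff R R^o R^o F f t df dFf hf.
have E : 'd F (f t) df = df * dF.
  by rewrite -[df in 'd F _ df]mulr1 -[_ * 1]/(df *: 1) linearZ -(deriveE _ dFf) (derive_val (f := F)).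
by rewrite E.
Qed.

Lemma is_derive_sin_affine (a b t : R) :
  is_derive t (1:R) (fun s => sin (a * s + b)) (a * cos (a * t + b)).
Proof. by apply: is_derive_comp1; exact: is_derive_affine. Qed.

(* The mean of cos (2 pi z t / eps + psi) over a period of length eps. *)
Definition mean_cos (z : int) (psi : R) : R := if z == 0 then cos psi else 0.

Lemma sin_period (z : int) (x : R) : sin (x + 2 * pi * z%:~R) = sin x.
Proof.
suff H (k : nat) (y : R) : sin (y + 2 * pi * k%:R) = sin y.
  case: z => k; first by rewrite -pmulrn H.
  rewrite -(H k.+1 (x + 2 * pi * (Negz k)%:~R)); congr sin.
  by rewrite NegzE mulrNz -pmulrn; ring.
elim: k y => [|k IH] y; first by rewrite mulr0 addr0.
have -> : y + 2 * pi * k.+1%:R = (y + 2 * pi * k%:R) + pi *+ 2 by rewrite -natr1; ring.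
by rewrite sinD2pi IH.
Qed.

Variables (eps : R) (j : nat).
Hypothesis eps0 : 0 < eps.
Let w : R := 2 * pi / eps.
Let t0 : R := eps * j%:R.
Let t1 : R := eps * j.+1%:R.

Lemma angular_gt0 : 0 < w. Proof. by rewrite divr_gt0 // mulr_gt0 // pi_gt0. Qed.

Lemma period_length : t1 - t0 = eps. Proof. by rewrite /t1 /t0 -natr1; ring. Qed.

Lemma sin_t0 (z : int) psi : sin (w * z%:~R * t0 + psi) = sin psi.
Proof.
have -> : w * z%:~R * t0 + psi = psi + 2 * pi * (z * j%:Z)%:~R.
  by rewrite /w /t0 intrM -pmulrn; field; rewrite gt_eqF.
exact: sin_period.
Qed.

Lemma sin_t1 (z : int) psi : sin (w * z%:~R * t1 + psi) = sin psi.
Proof.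
have -> : w * z%:~R * t1 + psi = psi + 2 * pi * (z * j.+1%:Z)%:~R.
  by rewrite /w /t1 intrM -pmulrn; field; rewrite gt_eqF.
exact: sin_period.
Qed.

Lemma increment_cos (z : int) psi :
  has_increment t0 t1 (fun t => cos (w * z%:~R * t + psi)) (eps * mean_cos z psi).
Proof.
rewrite /mean_cos; case: eqVneq => [->|z0].
  exists (fun t => cos psi * t + - (cos psi * t0)); split.
  - move=> t; rewrite mulr0z mulr0 mul0r add0r; exact: is_derive_affine.
  - by rewrite subrr.
  - by rewrite -mulrBr period_length mulrC.
have wz : w * z%:~R != 0 by rewrite mulf_neq0 ?intr_eq0 // gt_eqF // angular_gt0.
exists (fun t => (w * z%:~R)^-1 * sin (w * z%:~R * t + psi) - (w * z%:~R)^-1 * sin psi); split.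
- move=> t; rewrite -[X in is_derive _ _ _ X]subr0.
  apply: (@is_derive_sub R R^o _ (cst ((w * z%:~R)^-1 * sin psi))).
  have := @is_derive_scale R R^o (cst (w * z%:~R)^-1) _ t 0 _ _ (is_derive_sin_affine (w * z%:~R) psi t).
  by rewrite scale0r add0r /GRing.scale /= mulrA mulVf // mul1r; apply.
- by rewrite sin_t0 subrr.
- by rewrite sin_t1 subrr mulr0.
Qed.

End increments.

Ltac nonzero := repeat (apply/andP; split);
  match goal with H : is_true (~~ _) |- _ => exact H end.

Section components.
Context {R : realType} {C : finType}.
Variables (k : C -> nat) (ph amp : C -> R) (eps : R) (j : nat).
Hypotheses (eps0 : 0 < eps) (k0 : forall c, (0 < k c)%N).
Let w : R := 2 * pi / eps.
Let t0 : R := eps * j%:R.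
Let t1 : R := eps * j.+1%:R.

(** Division by [eps] makes [amp] the scale of the primitive [Wave], so the averages [m_coef] and
    [u_coef] over a period do not involve [eps]. *)
Definition wave c t := amp c / eps * cos (w * (k c)%:R * t + ph c).
Definition Wave c t := amp c / (2 * pi * (k c)%:R) * (sin (w * (k c)%:R * t + ph c) - sin (ph c)).

Lemma Wave_derive c t : is_derive t (1:R) (Wave c) (wave c t).
Proof.
have kc : (k c)%:R != 0 :> R by rewrite pnatr_eq0 -lt0n.
have pi0 : pi != 0 :> R by rewrite gt_eqF // pi_gt0.
have d1 : is_derive t (1:R) (fun t => sin (w * (k c)%:R * t + ph c) - sin (ph c))
    (w * (k c)%:R * cos (w * (k c)%:R * t + ph c)).
  rewrite -[X in is_derive _ _ _ X]subr0.
  by apply: (@is_derive_sub R R^o _ (cst (sin (ph c)))); exact: is_derive_sin_affine.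
have := @is_derive_scale R R^o (cst (amp c / (2 * pi * (k c)%:R))) _ t 0 _ _ d1.
rewrite scale0r add0r /GRing.scale /=.
have -> : amp c / (2 * pi * (k c)%:R) * (w * (k c)%:R * cos (w * (k c)%:R * t + ph c)) = wave c t.
  have e0 : eps != 0 by exact: lt0r_neq0.
  by rewrite /wave /w; move: (@pi R) pi0 => P pi0; field; nonzero.
by apply.
Qed.

Lemma Wave_ends c : Wave c t0 = 0 /\ Wave c t1 = 0.
Proof.
have h0 := @sin_t0 R eps j eps0 (k c)%:Z (ph c); have h1 := @sin_t1 R eps j eps0 (k c)%:Z (ph c).
by rewrite /Wave /w /t0 /t1 -!pmulrn in h0 h1 *; rewrite h0 h1 subrr mulr0.
Qed.

Lemma wave_bound c t : `|wave c t| * (t1 - t0) <= `|amp c| /\ `|Wave c t| <= `|amp c|.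
Proof.
have kc : 1 <= (k c)%:R :> R by rewrite ler1n.
have kc0 : 0 < (k c)%:R :> R by rewrite ltr0n.
have p1 : 1 <= pi :> R by have := @pi_ge2 R; lra.
have pp : 0 < 2 * pi * (k c)%:R :> R by rewrite !mulr_gt0 // pi_gt0.
split.
  rewrite /t1 /t0 period_length /wave !normrM normfV (gtr0_norm eps0).
  have -> : `|amp c| / eps * `|cos (w * (k c)%:R * t + ph c)| * eps =
    `|amp c| * `|cos (w * (k c)%:R * t + ph c)| by field; exact: lt0r_neq0.
  by rewrite ler_piMr // ler_norml cos_geN1 cos_le1.
rewrite /Wave !normrM normfV (gtr0_norm pp) -mulrA ler_piMr //.
rewrite mulrC ler_pdivrMr // mul1r.
apply: (@le_trans _ _ 2).
  rewrite (le_trans (ler_normB _ _)) // -[2]/(1 + 1) lerD // ler_norml ?sin_geN1 ?sin_le1 //.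
have : 1 <= pi * (k c)%:R :> R by rewrite mulr_ege1.
lra.
Qed.

Let z c : int := (k c)%:Z.

Lemma waveE c t : wave c t = amp c / eps * cos (w * (z c)%:~R * t + ph c).
Proof. by rewrite /wave /z -pmulrn. Qed.

Lemma cosBpi2 (x : R) : cos (x - pi / 2) = sin x.
Proof. by rewrite cosB cos_pihalf sin_pihalf mulr0 mulr1 add0r. Qed.

(* Products of waves are turned into sums of cosines, each with mean mean_cos. *)
Definition m_coef c d : R := amp c * amp d / (4 * pi * (k c)%:R) * mean_cos (z c - z d) (ph c - ph d - pi / 2).

Lemma mean_cos_pos (a : int) psi : 0 < a -> mean_cos a psi = 0 :> R.
Proof. by move=> a0; rewrite /mean_cos; case: eqP => // h; move: a0; rewrite h ltxx. Qed.

Lemma m_increment c d : has_increment t0 t1 (fun t => Wave c t * wave d t) (m_coef c d).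
Proof.
have kc : (k c)%:R != 0 :> R by rewrite pnatr_eq0 -lt0n.
have pi0 : pi != 0 :> R by rewrite gt_eqF // pi_gt0.
have e0 : eps != 0 by exact: lt0r_neq0.
have I1 := @increment_cos R eps j eps0 (z c + z d) (ph c + ph d - pi / 2).
have I2 := @increment_cos R eps j eps0 (z c - z d) (ph c - ph d - pi / 2).
have I3 := @increment_cos R eps j eps0 (z d) (ph d).
have := increment_scale (amp c * amp d / (2 * pi * (k c)%:R * eps))
   (increment_add (increment_scale 2^-1 (increment_add I1 I2)) (increment_scale (- sin (ph c)) I3)).
apply: increment_ext => [t|].
  rewrite waveE /Wave.
  have -> : 2 * pi / eps * (z c + z d)%:~R * t + (ph c + ph d - pi / 2) =
     (w * (k c)%:R * t + ph c) + (w * (z d)%:~R * t + ph d) - pi / 2.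
    by rewrite /w intrD /z -!pmulrn; ring.
  have -> : 2 * pi / eps * (z c - z d)%:~R * t + (ph c - ph d - pi / 2) =
     (w * (k c)%:R * t + ph c) - (w * (z d)%:~R * t + ph d) - pi / 2.
    by rewrite /w intrB /z -!pmulrn; ring.
  rewrite !cosBpi2 -/w sinD sinB; move: (@pi R) pi0 => P pi0; field; nonzero.
have zp : 0 < z c + z d by rewrite /z; have := k0 c; lia.
have zd : 0 < z d by rewrite /z; have := k0 d; lia.
rewrite /m_coef (mean_cos_pos _ zp) (mean_cos_pos _ zd); move: (@pi R) pi0 => P pi0; field; nonzero.
Qed.

Definition u_core c d e : R := 4^-1 * (mean_cos (z c - z e + z d) (ph c - ph e + ph d)
   + mean_cos (z c - z e - z d) (ph c - ph e - ph d)
   - mean_cos (z c + z e + z d) (ph c + ph e + ph d) - mean_cos (z c + z e - z d) (ph c + ph e - ph d)).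

(** The primitives contain the constants [- sin (ph c)] and [- sin (ph e)] that make them vanish at
    [t0]. In the expanded product the pure triple product gives [u_core], each single constant
    leaves a mean of two waves, and both constants together leave a single wave, whose mean is
    zero. *)
Definition u_coef c d e : R := amp c * amp d * amp e / (4 * pi ^+ 2 * (k c)%:R * (k e)%:R) *
  (u_core c d e - sin (ph e) / 2 * mean_cos (z c - z d) (ph c - ph d - pi / 2)
     - sin (ph c) / 2 * mean_cos (z e - z d) (ph e - ph d - pi / 2)).

Lemma u_increment c d e :
  has_increment t0 t1 (fun t => Wave c t * wave d t * Wave e t) (u_coef c d e).
Proof.
have kc : (k c)%:R != 0 :> R by rewrite pnatr_eq0 -lt0n.
have ke : (k e)%:R != 0 :> R by rewrite pnatr_eq0 -lt0n.
have pi0 : pi != 0 :> R by rewrite gt_eqF // pi_gt0.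
have e0 : eps != 0 by exact: lt0r_neq0.
have H a b : has_increment t0 t1 (fun t => sin (w * (z a)%:~R * t + ph a) * cos (w * (z b)%:~R * t + ph b))
    (eps * (2^-1 * mean_cos (z a - z b) (ph a - ph b - pi / 2))).
  have I1 := @increment_cos R eps j eps0 (z a + z b) (ph a + ph b - pi / 2).
  have I2 := @increment_cos R eps j eps0 (z a - z b) (ph a - ph b - pi / 2).
  have := increment_scale 2^-1 (increment_add I1 I2).
  apply: increment_ext => [t|].
    have -> : 2 * pi / eps * (z a + z b)%:~R * t + (ph a + ph b - pi / 2) =
       (w * (z a)%:~R * t + ph a) + (w * (z b)%:~R * t + ph b) - pi / 2.
      by rewrite /w intrD; ring.
    have -> : 2 * pi / eps * (z a - z b)%:~R * t + (ph a - ph b - pi / 2) =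
       (w * (z a)%:~R * t + ph a) - (w * (z b)%:~R * t + ph b) - pi / 2.
      by rewrite /w intrB; ring.
    by rewrite !cosBpi2 sinD sinB; field.
  have zp : 0 < z a + z b by rewrite /z; have := k0 a; lia.
  by rewrite (mean_cos_pos _ zp); ring.
have I1 := @increment_cos R eps j eps0 (z c - z e + z d) (ph c - ph e + ph d).
have I2 := @increment_cos R eps j eps0 (z c - z e - z d) (ph c - ph e - ph d).
have I3 := @increment_cos R eps j eps0 (z c + z e + z d) (ph c + ph e + ph d).
have I4 := @increment_cos R eps j eps0 (z c + z e - z d) (ph c + ph e - ph d).
have I5 := @increment_cos R eps j eps0 (z d) (ph d).
have T := increment_scale 4^-1 (increment_add (increment_add I1 I2)
  (increment_scale (-1) (increment_add I3 I4))).
have := increment_scale (amp c * amp d * amp e / (4 * pi ^+ 2 * (k c)%:R * (k e)%:R * eps))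
  (increment_add (increment_add T (increment_scale (- sin (ph e)) (H c d)))
    (increment_add (increment_scale (- sin (ph c)) (H e d)) (increment_scale (sin (ph c) * sin (ph e)) I5))).
apply: increment_ext => [t|].
  rewrite waveE /Wave.
  have -> : 2 * pi / eps * (z c - z e + z d)%:~R * t + (ph c - ph e + ph d) =
     (w * (z c)%:~R * t + ph c) - (w * (z e)%:~R * t + ph e) + (w * (z d)%:~R * t + ph d).
    by rewrite /w intrD intrB; ring.
  have -> : 2 * pi / eps * (z c - z e - z d)%:~R * t + (ph c - ph e - ph d) =
     (w * (z c)%:~R * t + ph c) - (w * (z e)%:~R * t + ph e) - (w * (z d)%:~R * t + ph d).
    by rewrite /w !intrB; ring.
  have -> : 2 * pi / eps * (z c + z e + z d)%:~R * t + (ph c + ph e + ph d) =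
     (w * (z c)%:~R * t + ph c) + (w * (z e)%:~R * t + ph e) + (w * (z d)%:~R * t + ph d).
    by rewrite /w !intrD; ring.
  have -> : 2 * pi / eps * (z c + z e - z d)%:~R * t + (ph c + ph e - ph d) =
     (w * (z c)%:~R * t + ph c) + (w * (z e)%:~R * t + ph e) - (w * (z d)%:~R * t + ph d).
    by rewrite /w intrB intrD; ring.
  have -> : w * (k c)%:R * t + ph c = w * (z c)%:~R * t + ph c by rewrite /z -pmulrn.
  have -> : w * (k e)%:R * t + ph e = w * (z e)%:~R * t + ph e by rewrite /z -pmulrn.
  rewrite -/w.
  set A := _ + ph c; set B := _ + ph e; set G := _ + ph d.
  rewrite (cosD (A - B)) (cosB (A - B)) (cosD (A + B)) (cosB (A + B)) cosB cosD.
  move: (@pi R) pi0 => P pi0; field; nonzero.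
have zd : 0 < z d by rewrite /z; have := k0 d; lia.
rewrite /u_coef /u_core (mean_cos_pos (ph d) zd); move: (@pi R) pi0 => P pi0; field; nonzero.
Qed.

End components.

(** * Consequences of the absence of resonances *)

Section nonresonance.
Context {m : nat} (S2 : {set 'I_m * 'I_m}) (S3 : {set 'I_m * 'I_m * 'I_m}).
Variables (kap : 'I_m * 'I_m -> nat) (kap1 kap2 : 'I_m * 'I_m * 'I_m -> nat).
Hypothesis nonres : nonresonant S2 S3 kap kap1 kap2.

Definition freq3 (P : 'I_4 * 'I_#|S3|) : nat := kaps kap1 kap2 P.1 (enum_val P.2).
Definition freq2 (c : 'I_#|S2|) : nat := kap (enum_val c).

Lemma uniq_map_inj (T U : eqType) (h : T -> U) (s : seq T) : uniq (map h s) ->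
  {in s &, injective h}.
Proof.
elim: s => //= a s IH /andP[has /IH {}IH] x y; rewrite !inE.
move=> /orP[/eqP->|xs] /orP[/eqP->|ys] // hxy.
- by move: has; rewrite hxy map_f.
- by move: has; rewrite -hxy map_f.
- exact: IH.
Qed.

Let F3 := [seq kaps kap1 kap2 s l | s <- enum 'I_4, l <- enum S3].

Lemma freq3_mem P : freq3 P \in F3.
Proof. by apply: allpairs_f; rewrite mem_enum ?enum_valP. Qed.

Lemma freq2_mem c : freq2 c \in [seq kap j | j <- enum S2].
Proof. by apply: map_f; rewrite mem_enum enum_valP. Qed.

Lemma freq3_gt0 P : (0 < freq3 P)%N.
Proof.
have [/allP h _ _] := nonres; apply: h.
by rewrite mem_cat freq3_mem orbT.
Qed.

Lemma freq2_gt0 c : (0 < freq2 c)%N.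
Proof. by have [/allP h _ _] := nonres; apply: h; rewrite mem_cat freq2_mem. Qed.

Lemma freq3_inj : injective freq3.
Proof.
have [_ + _] := nonres; rewrite cat_uniq => /and3P[_ _ +].
have -> : [seq kaps kap1 kap2 s l | s <- enum 'I_4, l <- enum S3] =
   map (fun p => kaps kap1 kap2 p.1 p.2) [seq (s, l) | s <- enum 'I_4, l <- enum S3].
  by rewrite map_allpairs.
move=> /uniq_map_inj h [s l] [s' l'] E.
have := h (s, enum_val l) (s', enum_val l') _ _ E.
rewrite !allpairs_f ?mem_enum ?enum_valP // => /(_ isT isT) [-> /enum_val_inj ->] //.
Qed.

Lemma freq2_inj : injective freq2.
Proof.
have [_ + _] := nonres; rewrite cat_uniq => /and3P[/uniq_map_inj h _ _] c d E.
by apply/enum_val_inj; apply: h => //; rewrite mem_enum enum_valP.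
Qed.

Lemma freq23 c P : freq2 c <> freq3 P.
Proof.
have [_ + _] := nonres; rewrite cat_uniq => /and3P[_ /hasPn h _] E.
by have := h _ (freq3_mem P); rewrite /= -E freq2_mem.
Qed.

(* A vanishing signed sum of three frequencies is a third-order resonance, hence one
   of the imposed ones, which involve three frequencies of a single triple. *)
Lemma third_order (P Q T : 'I_4 * 'I_#|S3|) (e1 e2 e3 : int) :
  `|e1|%N = 1%N -> `|e2|%N = 1%N -> `|e3|%N = 1%N ->
  e1 * (freq3 P)%:Z + e2 * (freq3 Q)%:Z + e3 * (freq3 T)%:Z = 0 ->
  [/\ P != Q, Q != T, P != T, P.2 = Q.2 & Q.2 = T.2].
Proof.
move=> h1 h2 h3 E.
have kP := freq3_gt0 P; have kQ := freq3_gt0 Q; have kT := freq3_gt0 T.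
(* If two of the three indices coincide, the relation has coefficients of modulus 2 and 1; it still
   has order three, but an imposed relation has coefficients of modulus at most 1. *)
have two (A B : 'I_4 * 'I_#|S3|) (a b : int) : A != B -> `|a|%N = 2 -> `|b|%N = 1%N ->
    a * (freq3 A)%:Z + b * (freq3 B)%:Z = 0 -> False.
  move=> AB a2 b1 EE.
  have [_ _ /(_ (fun x => if x == A then a else if x == B then b else 0))] := nonres.
  case.
    split.
    - exact: freq3_inj.
    - rewrite (bigD1 B) //= eqxx eq_sym (negbTE AB) b1; exact: gcd1n.
    - rewrite (bigD1 A) //= (bigD1 B) 1?eq_sym //= big1; first by rewrite !eqxx eq_sym (negbTE AB) a2 b1.
      by move=> x /andP[/negbTE -> /negbTE ->].
    - rewrite (bigD1 A) //= (bigD1 B) 1?eq_sym //= big1; first by rewrite !eqxx eq_sym (negbTE AB) addr0.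
      by move=> x /andP[/negbTE -> /negbTE ->]; rewrite mul0r.
  move=> l0 [sg [rel3 H]].
  have := H A.1 A.2; rewrite -surjective_pairing eqxx => EA.
  move: a2; rewrite EA => {EA}.
  rewrite !abszM abszX abszN1 exp1n mul1n.
  by case: (A.2 == l0); case: rel3 {H}; case: A.1 => [[|[|[|[|?]]]] ?].
have [PQ|PQ] := eqVneq P Q.
  exfalso; rewrite -{}PQ in E kQ *.
  (* Opposite signs would leave a vanishing third frequency, against positivity. *)
  have e12 : e1 = e2 by lia.
  have [PT|PT] := eqVneq P T; first by rewrite -PT in E; lia.
  by apply: (two P T (e1 + e2) e3 PT) => //; lia.
have [QT|QT] := eqVneq Q T.
  exfalso; rewrite -{}QT in E kT *.
  have e12 : e2 = e3 by lia.
  by rewrite eq_sym in PQ; apply: (two Q P (e2 + e3) e1 PQ) => //; lia.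
have [PT|PT] := eqVneq P T.
  exfalso; rewrite -{}PT in E kT QT *.
  have e12 : e1 = e3 by lia.
  by rewrite eq_sym in PQ; apply: (two P Q (e1 + e3) e2) => //; [rewrite eq_sym|lia|lia].
have [_ _ /(_ (fun x => if x == P then e1 else if x == Q then e2 else if x == T then e3 else 0))] := nonres.
have [QP TP TQ] : [/\ Q != P, T != P & T != Q] by rewrite !(eq_sym T) (eq_sym Q).
case.
  split.
  - exact: freq3_inj.
  - by rewrite (bigD1 P) //= eqxx h1 gcd1n.
  - rewrite (bigD1 P) //= (bigD1 Q) //= (bigD1 T) ?TP ?TQ //= big1.
      by rewrite !eqxx (negbTE QP) (negbTE TP) (negbTE TQ) h1 h2 h3.
    by move=> x /andP[/andP[/negbTE -> /negbTE ->] /negbTE ->].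
  - rewrite (bigD1 P) //= (bigD1 Q) //= (bigD1 T) ?TP ?TQ //= big1.
      by rewrite !eqxx (negbTE QP) (negbTE TP) (negbTE TQ) addr0 addrA.
    by move=> x /andP[/andP[/negbTE -> /negbTE ->] /negbTE ->]; rewrite mul0r.
move=> l0 [sg [rel3 H]].
have key x : x \in [:: P; Q; T] -> x.2 = l0.
  move=> xPQT; apply/eqP/negPn/negP => xl.
  have := H x.1 x.2; rewrite -surjective_pairing (negbTE xl) mulr0 mul0r => EA.
  move: xPQT EA; rewrite !inE => /or3P[] /eqP ->.
  - by rewrite eqxx; lia.
  - by rewrite (negbTE QP) eqxx; lia.
  - by rewrite (negbTE TP) (negbTE TQ) eqxx; lia.
have lP := key P; have lQ := key Q; have lT := key T.
rewrite !inE !eqxx !orbT /= in lP lQ lT.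
by rewrite lP // lQ // lT.
Qed.

(** These are the accidental coincidences that could make a further signed sum of three of [K1],
    [K2], [K1 + K2], [K2 - K1] vanish. [K2 = 2 * K1] would identify the first and fourth
    frequencies; the last two would make twice the fourth frequency equal to the third or to the
    first. *)
Lemma freq3_generic (l : 'I_#|S3|) (K1 := kap1 (enum_val l)) (K2 := kap2 (enum_val l)) :
  [/\ (0 < K1)%N, (K1 < K2)%N, K2 <> (2 * K1)%N, K2 <> (3 * K1)%N & (2 * K2)%N <> (3 * K1)%N].
Proof.
pose o s (h : (s < 4)%N) : 'I_4 := Ordinal h.
have k1 := freq3_gt0 (o 0%N isT, l); have k4 := freq3_gt0 (o 3%N isT, l).
rewrite /freq3 /= /kaps /= /kap4 in k1 k4.
split => //.
- by rewrite -subn_gt0.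
- move=> E; suff : (o 0%N isT, l) = (o 3%N isT, l) by case.
  by apply: freq3_inj; rewrite /freq3 /kaps /= /kap4 -/K1 -/K2; lia.
- move=> E; have [] := @third_order (o 3%N isT, l) (o 3%N isT, l) (o 2%N isT, l) 1 1 (-1) erefl erefl erefl.
    by rewrite /freq3 /kaps /= /kap4 /kap3 -/K1 -/K2; lia.
  by rewrite eqxx.
- move=> E; have [] := @third_order (o 3%N isT, l) (o 3%N isT, l) (o 0%N isT, l) 1 1 (-1) erefl erefl erefl.
    by rewrite /freq3 /kaps /= /kap4 /kap3 -/K1 -/K2; lia.
  by rewrite eqxx.
Qed.

End nonresonance.

Lemma sum_pair (V : nmodType) (A B : finType) (G : A * B -> V) :
  \sum_p G p = \sum_a \sum_b G (a, b).
Proof. by rewrite pair_bigA; apply: eq_bigr => -[a b]. Qed.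

(* Four times the mean triple product (u_core, for indices s, t, u within one
   triple); the nonzero entries reflect kap1 + kap2 = kap3 and kap2 - kap1 = kap4. *)
Definition core_sign (s t u : nat) : int :=
  match s, t, u with
  | 0, 1, 2 | 2, 1, 0 | 1, 0, 2 | 2, 0, 1 => 1%R
  | 0, 2, 1 | 1, 2, 0 => (-1)%R
  | 0, 3, 1 | 1, 3, 0 | 3, 0, 1 | 1, 0, 3 => 1%R
  | 0, 1, 3 | 3, 1, 0 => (-1)%R
  | _, _, _ => 0%R
  end%N.

Lemma sum4 (V : nmodType) (G : nat -> V) : \sum_(s < 4) G s = G 0%N + (G 1%N + (G 2%N + G 3%N)).
Proof. by rewrite !big_ord_recl big_ord0 addr0. Qed.

(** [minn s 2] identifies the two waves along the third field, whose relative amplitude [h] is one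
    half. With that field at an outer place they enter with weights [1 / (K1 + K2)] and
    [1 / (K2 - K1)], and the factor [(K1 + K2) * (K2 - K1)] of the amplitude clears these
    denominators; with that field in the middle they cancel. The four remaining words form the
    expression of [lie_L3]. *)
Lemma word_sum (R : realType) (K1 K2 a : R) (h k : nat -> R) (L : nat -> nat -> nat -> R) :
  0 < K1 -> K1 < K2 ->
  h 0%N = 1 -> h 1%N = 1 -> h 2%N = 2^-1 -> h 3%N = 2^-1 ->
  k 0%N = K1 -> k 1%N = K2 -> k 2%N = K1 + K2 -> k 3%N = K2 - K1 ->
  \sum_(s < 4) \sum_(t < 4) \sum_(u < 4)
    (16 * pi ^+ 2 * (K1 + K2) * (K2 - K1) * a * (h s * h t * h u) / (4 * pi ^+ 2 * k s * k u)
      * ((core_sign s t u)%:~R / 4)) * L (minn s 2%N) (minn t 2%N) (minn u 2%N) =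
  - (a * (L 2%N 1%N 0%N - L 2%N 0%N 1%N - (L 1%N 0%N 2%N - L 0%N 1%N 2%N))).
Proof.
move=> K10 K12 h0 h1 h2 h3 k0 k1 k2 k3.
have p0 : pi != 0 :> R by rewrite gt_eqF // pi_gt0.
rewrite (sum4 (fun s => \sum_(t < 4) \sum_(u < 4)
   (16 * pi ^+ 2 * (K1 + K2) * (K2 - K1) * a * (h s * h t * h u) / (4 * pi ^+ 2 * k s * k u)
      * ((core_sign s t u)%:~R / 4)) * L (minn s 2%N) (minn t 2%N) (minn u 2%N))).
rewrite !(sum4 (fun t => \sum_(u < 4)
   (16 * pi ^+ 2 * (K1 + K2) * (K2 - K1) * a * (h _ * h t * h u) / (4 * pi ^+ 2 * k _ * k u)
      * ((core_sign _ t u)%:~R / 4)) * L (minn _ 2%N) (minn t 2%N) (minn u 2%N))).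
rewrite !(sum4 (fun u =>
   (16 * pi ^+ 2 * (K1 + K2) * (K2 - K1) * a * (h _ * h _ * h u) / (4 * pi ^+ 2 * k _ * k u)
      * ((core_sign _ _ u)%:~R / 4)) * L (minn _ 2%N) (minn _ 2%N) (minn u 2%N))).
rewrite /core_sign /minn /= !mulr0z !(mul0r, mulr0, addr0, add0r) h0 h1 h2 h3 k0 k1 k2 k3.
rewrite !mulrNz !mulr1z.
move: (@pi R) p0 => P P0; field.
by rewrite P0 /=; apply/and4P; split; apply: lt0r_neq0; lra.
Qed.

(** * Brackets selected by averaging *)

Section averaging.
Context {R : realType} {m n : nat} (S2 : {set 'I_m * 'I_m}) (S3 : {set 'I_m * 'I_m * 'I_m}).
Variables (kap : 'I_m * 'I_m -> nat) (kap1 kap2 : 'I_m * 'I_m * 'I_m -> nat).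
Hypothesis nonres : nonresonant S2 S3 kap kap1 kap2.
Notation V := 'cV[R]_n.
Variables (f : 'I_m -> V -> V).
Variables (A2 B2 : 'I_#|S2| -> R) (A3 : 'I_#|S3| -> R).

(* Two waves per pair, and four per triple: the two waves along l.1.1 and l.1.2, and the
   product cos (w1 t) sin (w2 t) along l.2 written as the half sum of sin (w3 t) and
   sin (w4 t). *)
Definition channel : finType := (('I_#|S2| * bool) + ('I_4 * 'I_#|S3|))%type.

Definition cfield (c : channel) : V -> V := match c with
  | inl (c, b) => f (if b then (enum_val c).1 else (enum_val c).2)
  | inr (s, l) => f (nth (enum_val l).2 [:: (enum_val l).1.1; (enum_val l).1.2] s)
  end.

Definition cfreq (c : channel) : nat := match c with
  | inl (c, _) => freq2 kap c
  | inr P => freq3 kap1 kap2 P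
  end.

Definition cphase (c : channel) : R := match c with
  | inl (_, b) => if b then 0 else - (pi / 2)
  | inr (s, _) => if s == 0 :> nat then 0 else - (pi / 2)
  end.

Definition camp (c : channel) : R := match c with
  | inl (c, b) => if b then A2 c else B2 c
  | inr (s, l) => if (s < 2)%N then A3 l else A3 l / 2
  end.

Lemma cfreq_gt0 c : (0 < cfreq c)%N.
Proof. by case: c => [[c b]|P] /=; [exact: freq2_gt0 nonres _|exact: freq3_gt0 nonres _]. Qed.

Lemma mean_cos_neq (z : int) (psi : R) : z != 0 -> mean_cos z psi = 0.
Proof. by rewrite /mean_cos => /negbTE ->. Qed.

Lemma mean_cos_bound (z : int) (psi : R) : `|mean_cos z psi| <= 1.
Proof. by rewrite /mean_cos; case: eqP => _; rewrite ?normr0 // ler_norml cos_geN1 cos_le1. Qed.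

Lemma cosNpi2 : cos (- (pi / 2) : R) = 0. Proof. by rewrite cosN cos_pihalf. Qed.

Notation mc := (m_coef cfreq cphase camp).
Notation uc := (u_coef cfreq cphase camp).

Lemma m_diag0 c d : (cfreq c)%:Z - (cfreq d)%:Z = 0 -> cphase c = cphase d -> mc c d = 0.
Proof.
by move=> E1 E2; rewrite /m_coef E2 subrr sub0r /mean_cos E1 eqxx cosNpi2 mulr0.
Qed.

(** Frequencies of triples differ from those of pairs and from one another, so a nonzero mean would
    need the same channel twice, and a wave is in quadrature with its own zero-mean primitive. Exact
    vanishing is essential: these products have order four or five in the amplitude scale and would
    dominate the main term, of order six. *)
Lemma m_inr1 P d : mc (inr P) d = 0.
Proof.
have [E|E] := eqVneq ((cfreq (inr P))%:Z - (cfreq d)%:Z) 0; last first.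
  by rewrite /m_coef mean_cos_neq // mulr0.
apply: m_diag0 => //; case: d E => [[d b]|Q] /= E.
  by exfalso; apply: (freq23 nonres (c := d) (P := P)); lia.
by have -> : P = Q by apply: (freq3_inj nonres); lia.
Qed.

Lemma m_inr2 P d : mc d (inr P) = 0.
Proof.
have [E|E] := eqVneq ((cfreq d)%:Z - (cfreq (inr P))%:Z) 0; last first.
  by rewrite /m_coef mean_cos_neq // mulr0.
apply: m_diag0 => //; case: d E => [[d b]|Q] /= E.
  by exfalso; apply: (freq23 nonres (c := d) (P := P)); lia.
by have -> : Q = P by apply: (freq3_inj nonres); lia.
Qed.

Lemma m_inl c b d b' : mc (inl (c, b)) (inl (d, b')) =
  if (c == d) && (b != b') then (-1) ^+ (~~ b) * (A2 c * B2 c / (4 * pi * (freq2 kap c)%:R)) else 0.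
Proof.
case: eqVneq => [<-|cd] /=; last first.
  rewrite /m_coef mean_cos_neq ?mulr0 //; apply: contra cd => /eqP /= E.
  by apply/eqP/(freq2_inj nonres); lia.
case: b; case: b' => /=.
- by apply: m_diag0; rewrite //= subrr.
- rewrite /m_coef /= subrr /mean_cos eqxx opprK add0r subrr cos0 expr0; ring.
- rewrite /m_coef /= subrr /mean_cos eqxx subr0 expr1.
  have -> : - (pi / 2) - pi / 2 = - pi :> R by field.
  by rewrite cosN cospi; ring.
- by apply: m_diag0; rewrite //= subrr.
Qed.

Lemma m_bound (K : R) : 0 <= K -> (forall c b, `|camp (inl (c, b))| <= K) ->
  forall c d, `|mc c d| <= K ^+ 2.
Proof.
move=> K0 hK c d.
have K2 : 0 <= K ^+ 2 by exact: sqr_ge0.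
case: c => [[c b]|P]; last by rewrite m_inr1 normr0.
case: d => [[d b']|P]; last by rewrite m_inr2 normr0.
rewrite m_inl; case: ifP => _; last by rewrite normr0.
have k1 : 1 <= (freq2 kap c)%:R :> R by rewrite ler1n; exact: freq2_gt0 nonres _.
have p1 : 1 <= pi :> R by have := @pi_ge2 R; lra.
have pk : 1 <= pi * (freq2 kap c)%:R :> R by rewrite mulr_ege1.
have pp : 0 < 4 * pi * (freq2 kap c)%:R :> R by rewrite -mulrA mulr_gt0 //; lra.
rewrite normrM normrX normrN1 expr1n mul1r !normrM normfV (gtr0_norm pp).
rewrite ler_pdivrMr // (@le_trans _ _ (K ^+ 2)) //.
  by rewrite expr2 ler_pM //; [exact: (hK c true)|exact: (hK c false)].
by rewrite ler_peMr //; lra.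
Qed.

Lemma u_bound c d e : `|uc c d e| <= `|camp c| * `|camp d| * `|camp e|.
Proof.
have kc : 1 <= (cfreq c)%:R :> R by rewrite ler1n cfreq_gt0.
have ke : 1 <= (cfreq e)%:R :> R by rewrite ler1n cfreq_gt0.
have p1 : 1 <= pi :> R by have := @pi_ge2 R; lra.
have pk : 1 <= pi ^+ 2 * (cfreq c)%:R * (cfreq e)%:R :> R.
  by rewrite !mulr_ege1 // expr2 mulr_ege1.
have pp : 0 < 4 * pi ^+ 2 * (cfreq c)%:R * (cfreq e)%:R :> R by rewrite -!mulrA mulr_gt0 // !mulrA; lra.
rewrite /u_coef normrM 2!normrM normfV (gtr0_norm pp) normrM.
set a := `|camp c| * _ * _; have a0 : 0 <= a by rewrite !mulr_ge0.
rewrite -mulrA ler_piMr // ler_pdivrMl // mulr1.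
apply: (@le_trans _ _ 2); last lra.
have s1 x y z : `|sin x / 2 * mean_cos y z| <= 2^-1 :> R.
  rewrite !normrM normfV (@ger0_norm _ 2) // mulrAC ler_piMl // mulr_ile1 // ?mean_cos_bound //.
  by rewrite ler_norml sin_geN1 sin_le1.
have u1 : `|u_core cfreq cphase c d e| <= 1.
  rewrite /u_core normrM normfV (@ger0_norm _ 4) // ler_pdivrMl // mulr1.
  set j1 := mean_cos _ _; set j2 := mean_cos _ _; set j3 := mean_cos _ _; set j4 := mean_cos _ _.
  have := ler_normB (j1 + j2 - j3) j4; have := ler_normB (j1 + j2) j3; have := ler_normD j1 j2.
  have : `|j1| <= 1 by exact: mean_cos_bound. have : `|j2| <= 1 by exact: mean_cos_bound.
  have : `|j3| <= 1 by exact: mean_cos_bound. have : `|j4| <= 1 by exact: mean_cos_bound.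
  lra.
set x := u_core _ _ _ _ _ in u1 *; set y := _ * mean_cos _ _; set z := _ * mean_cos _ _.
have := ler_normB (x - y) z; have := ler_normB x y.
have : `|y| <= 2^-1 by exact: s1. have : `|z| <= 2^-1 by exact: s1.
lra.
Qed.

(** The two waves of a pair are in quadrature, so [m_coef] changes sign when they are exchanged, and
    the two orders combine into the difference of [lie_L2]. *)
Lemma sum_m (p : V) (a : 'I_#|S2| -> R) (D : set V) :
  open D -> (forall i, Ck 2 D (f i)) -> D p ->
  (forall c, A2 c * B2 c = 4 * pi * (freq2 kap c)%:R * a c) ->
  \sum_c \sum_d mc c d *: L2 cfield c d p =
  - \sum_c a c *: field2 f (enum_val c) p.
Proof.
move=> oD Cf Dp hA.
have CX c : Ck 2 D (cfield c) by case: c => [[c b]|[s l]]; exact: Cf.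
rewrite big_sumType /= [X in _ + X]big1 ?addr0; last first.
  by move=> P _; rewrite big1 // => d _; rewrite m_inr1 scale0r.
rewrite sum_pair -sumrN; apply: eq_bigr => c _.
have inner b : \sum_d mc (inl (c, b)) d *: L2 cfield (inl (c, b)) d p =
    ((-1) ^+ (~~ b) * a c) *: L2 cfield (inl (c, b)) (inl (c, ~~ b)) p.
  rewrite big_sumType /= [X in _ + X]big1 ?addr0; last first.
    by move=> P _; rewrite m_inr2 scale0r.
  rewrite (bigD1 (c, ~~ b)) //= big1 ?addr0.
    rewrite m_inl eqxx; have -> : b != ~~ b by case: b. rewrite /=.
    congr (_ *: _); congr (_ * _); rewrite hA.
    rewrite mulrC mulKf //; apply: lt0r_neq0; rewrite mulr_gt0 ?mulr_gt0 ?pi_gt0 // ltr0n.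
    exact: freq2_gt0 nonres _.
  move=> [d b'] db; rewrite m_inl; case: ifP => [/andP[/eqP cd bb]|_]; last by rewrite scale0r.
  by exfalso; move/negP: db; apply; rewrite -cd; case: b bb; case: b'.
have E : field2 f (enum_val c) p = _ := lie_L2 oD CX (inl (c, true)) (inl (c, false)) Dp.
rewrite E scalerBr opprB big_bool; congr (_ + _).
  by apply: (etrans (inner true)); rewrite expr0 mul1r.
by apply: (etrans (inner false)); rewrite expr1 mulN1r scaleNr.
Qed.

Lemma freq3E (s : 'I_4) (l : 'I_#|S3|) : freq3 kap1 kap2 (s, l) =
  nth 0%N [:: kap1 (enum_val l); kap2 (enum_val l); (kap1 (enum_val l) + kap2 (enum_val l))%N;
      (kap2 (enum_val l) - kap1 (enum_val l))%N] s.
Proof. by []. Qed.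

(** In every surviving mean the phases cancel, since both imposed relations contain the cosine of
    [kap1], with phase zero, and two sines with opposite signs. The inequalities of [freq3_generic]
    exclude all other signed sums in the 64 cases. *)
Lemma u_core_same (s t u : 'I_4) (l : 'I_#|S3|) :
  u_core cfreq cphase (inr (s, l)) (inr (t, l)) (inr (u, l)) = (core_sign s t u)%:~R / 4.
Proof.
have [K0 K12 n1 n2 n3] := freq3_generic nonres l.
rewrite /u_core /mean_cos /= !freq3E.
set K1 := kap1 _ in K0 K12 n1 n2 n3 *; set K2 := kap2 _ in K12 n1 n2 n3 *.
case: s => [[|[|[|[|//]]]] ?]; case: t => [[|[|[|[|//]]]] ?]; case: u => [[|[|[|[|//]]]] ?];
rewrite /=; repeat (case: eqP => ?; try (exfalso; lia));
rewrite ?(subr0, addr0, sub0r, oppr0, mul0r, mulr0, mulr0z) //.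
all: match goal with |- context[cos ?x] => have -> : x = 0 by ring end.
all: by rewrite cos0 ?mulrNz ?mulr1z; field.
Qed.

Lemma u_core_diff (P Q T : 'I_4 * 'I_#|S3|) : ~ (P.2 = Q.2 /\ Q.2 = T.2) ->
  u_core cfreq cphase (inr P) (inr Q) (inr T) = 0.
Proof.
move=> h; rewrite /u_core !mean_cos_neq ?subr0 ?addr0 ?mulr0 //; apply/negP => /eqP /= E; apply: h.
- by have [] := @third_order _ _ _ _ _ _ nonres P Q T 1 (-1) 1 erefl erefl erefl ltac:(lia).
- by have [] := @third_order _ _ _ _ _ _ nonres P Q T 1 1 1 erefl erefl erefl ltac:(lia).
- by have [] := @third_order _ _ _ _ _ _ nonres P Q T 1 (-1) (-1) erefl erefl erefl ltac:(lia).
- by have [] := @third_order _ _ _ _ _ _ nonres P Q T 1 1 (-1) erefl erefl erefl ltac:(lia).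
Qed.

Lemma u_inr (P Q T : 'I_4 * 'I_#|S3|) : uc (inr P) (inr Q) (inr T) =
  camp (inr P) * camp (inr Q) * camp (inr T) / (4 * pi ^+ 2 * (freq3 kap1 kap2 P)%:R * (freq3 kap1 kap2 T)%:R)
    * u_core cfreq cphase (inr P) (inr Q) (inr T).
Proof.
have J0 (A B : 'I_4 * 'I_#|S3|) :
    mean_cos ((cfreq (inr A))%:Z - (cfreq (inr B))%:Z) (cphase (inr A) - cphase (inr B) - pi / 2) = 0.
  have [E|E] := eqVneq ((cfreq (inr A))%:Z - (cfreq (inr B))%:Z) 0; last exact: mean_cos_neq.
  have -> : A = B by apply: (freq3_inj nonres); rewrite /= in E; lia.
  by rewrite !subrr sub0r /mean_cos eqxx cosNpi2.
by rewrite /u_coef !J0 !mulr0 !subr0.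
Qed.

Lemma sum_triple (G : 'I_4 * 'I_#|S3| -> 'I_4 * 'I_#|S3| -> 'I_4 * 'I_#|S3| -> V) :
  (forall P Q T, ~ (P.2 = Q.2 /\ Q.2 = T.2) -> G P Q T = 0) ->
  \sum_P \sum_Q \sum_T G P Q T =
  \sum_l \sum_(s : 'I_4) \sum_(t : 'I_4) \sum_(u : 'I_4) G (s, l) (t, l) (u, l).
Proof.
move=> h; rewrite sum_pair exchange_big /=; apply: eq_bigr => l _; apply: eq_bigr => s _.
rewrite sum_pair; apply: eq_bigr => t _.
rewrite (bigD1 l) //= [X in _ + X]big1 ?addr0; last first.
  move=> l' ll'; rewrite big1 // => T _; apply: h => /= -[E _].
  by move: ll'; rewrite E eqxx.
rewrite sum_pair; apply: eq_bigr => u _.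
rewrite (bigD1 l) //= [X in _ + X]big1 ?addr0 // => l' ll'; apply: h => /= -[_ E].
by move: ll'; rewrite E eqxx.
Qed.

Lemma sum_u (p : V) (a : 'I_#|S3| -> R) (D : set V) :
  open D -> (forall i, Ck 2 D (f i)) -> D p ->
  (forall l, A3 l ^+ 3 = 16 * pi ^+ 2 * (kap3 kap1 kap2 (enum_val l))%:R
     * (kap4 kap1 kap2 (enum_val l))%:R * a l) ->
  \sum_P \sum_Q \sum_T uc (inr P) (inr Q) (inr T) *: L3 cfield (inr P) (inr Q) (inr T) p =
  - \sum_l a l *: field3 f (enum_val l) p.
Proof.
move=> oD Cf Dp hA.
have CX c : Ck 2 D (cfield c) by case: c => [[c b]|[s l]]; exact: Cf.
apply: (etrans (sum_triple _)).
  by move=> P Q T h; rewrite u_inr u_core_diff // mulr0 scale0r.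
rewrite -sumrN; apply: eq_bigr => l _.
pose o (s : nat) : 'I_4 := inord s.
pose Lam i j k := L3 cfield (inr (o i, l)) (inr (o j, l)) (inr (o k, l)) p.
have LamE (s t u : 'I_4) : L3 cfield (inr (s, l)) (inr (t, l)) (inr (u, l)) p =
    Lam (minn s 2%N) (minn t 2%N) (minn u 2%N).
  have E (s' : 'I_4) : cfield (inr (s', l)) = cfield (inr (o (minn s' 2%N), l)).
    by rewrite /= /o inordK; case: s' => [[|[|[|[|]]]] ?].
  exact: (f_equal3 (fun F1 F2 F3 : V -> V => 'd (fun y => 'd F1 y (F2 y)) p (F3 p)) (E s) (E t) (E u)).
have E : field3 f (enum_val l) p = Lam 2%N 1%N 0%N - Lam 2%N 0%N 1%N - (Lam 1%N 0%N 2%N - Lam 0%N 1%N 2%N).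
  apply: (etrans _ (lie_L3 oD CX (inr (o 0%N, l)) (inr (o 1%N, l)) (inr (o 2%N, l)) Dp)).
  have E0 : f (enum_val l).1.1 = cfield (inr (o 0%N, l)) by rewrite /= /o inordK.
  have E1 : f (enum_val l).1.2 = cfield (inr (o 1%N, l)) by rewrite /= /o inordK.
  have E2 : f (enum_val l).2 = cfield (inr (o 2%N, l)) by rewrite /= /o inordK.
  exact: (f_equal3 (fun F1 F2 F3 : V -> V => lie (lie F1 F2) F3 p) E0 E1 E2).
have [K0 K12 n1 n2 n3] := freq3_generic nonres l.
pose K1 : R := (kap1 (enum_val l))%:R; pose K2 : R := (kap2 (enum_val l))%:R.
pose h (s : nat) : R := if (s < 2)%N then 1 else 2^-1.
pose k (s : nat) : R := nth 0 [:: K1; K2; K1 + K2; K2 - K1] s.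
have kE (s : 'I_4) : (freq3 kap1 kap2 (s, l))%:R = k s.
  by rewrite freq3E /k; case: s => [[|[|[|[|//]]]] ?] //=; rewrite ?natrD ?natrB // ltnW.
have campE (s : 'I_4) : camp (inr (s, l)) = A3 l * h s.
  by rewrite /= /h; case: ifP; rewrite ?mulr1.
have hA' : A3 l ^+ 3 = 16 * pi ^+ 2 * (K1 + K2) * (K2 - K1) * a l.
  by rewrite hA /kap3 /kap4 natrD natrB // ltnW.
(* Coordinatewise the identity is scalar, which is what [word_sum] provides for an arbitrary array
   of values. *)
apply/colP => i; rewrite E !mxE.
have := @word_sum R K1 K2 (a l) h k (fun i0 j0 k0 => (Lam i0 j0 k0) i 0) _ _ erefl erefl erefl erefl erefl erefl erefl erefl.
rewrite ltr0n ltr_nat => /(_ K0 K12) W.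
apply: etrans W.
rewrite summxE; apply: eq_bigr => s _; rewrite summxE; apply: eq_bigr => t _.
rewrite summxE; apply: eq_bigr => u _.
rewrite u_inr u_core_same !campE !kE LamE mxE; congr (_ * _); congr (_ * _); congr (_ / _).
by rewrite -hA'; ring.
Qed.

End averaging.

(** * The frame and the control as a sum of waves *)

Section opnorm_theory.
Context {R : realType} {n : nat}.

Lemma opnorm_bound (A : 'M[R]_n) (y : 'cV[R]_n) : enorm (A *m y) <= opnorm A * enorm y.
Proof.
pose S := [set enorm (A *m y) | y in [set y | enorm y = 1]].
have ubS : has_ubound S.
  pose B := \sum_i \sum_j `|A i j|.
  exists (n%:R * B) => _ [z /= z1 <-]; apply: (le_trans (enorm_le_norm _)).
  have B0 : 0 <= B by apply: sumr_ge0 => i _; apply: sumr_ge0.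
  apply: ler_wpM2l => //; apply: cVnorm_le => // i; rewrite mxE.
  apply: (le_trans (ler_norm_sum _ _ _)).
  have zle j : `|z j 0| <= 1 by rewrite -z1 (le_trans (cVnorm_ge _ _)) // norm_le_enorm.
  apply: (@le_trans _ _ (\sum_j `|A i j|)).
    by apply: ler_sum => j _; rewrite normrM ler_piMr.
  by rewrite /B [leRHS](bigD1 i) //= lerDl; apply: sumr_ge0 => k _; apply: sumr_ge0.
have [y0|y0] := eqVneq (enorm y) 0; first by rewrite (enorm_eq0 y0) mulmx0 !enorm0 mulr0.
have yp : 0 < enorm y by rewrite lt_neqAle eq_sym y0 enorm_ge0.
pose u := (enorm y)^-1 *: y.
have u1 : enorm u = 1 by rewrite enormZ normfV ger0_norm ?mulVf // ltW.
have Su : S (enorm (A *m u)) by exists u.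
have : enorm (A *m u) <= opnorm A by apply: (ub_le_sup ubS).
rewrite /u -scalemxAr enormZ normfV (gtr0_norm yp) ler_pdivrMl // mulrC //.
Qed.

End opnorm_theory.

Section frame.
Context {R : realType} {m n : nat}.
Variables (f : 'I_m -> 'cV[R]_n -> 'cV[R]_n).
Variables (S1 : {set 'I_m}) (S2 : {set 'I_m * 'I_m}) (S3 : {set 'I_m * 'I_m * 'I_m}).
Hypothesis hn : (#|S1| + #|S2| + #|S3|)%N = n.
Notation V := 'cV[R]_n.

Lemma castmx_mul (p q k r : nat) (hk : k = q) (A : 'M[R]_(p, k)) (v : 'M[R]_(q, r)) :
  castmx (erefl p, hk) A *m v = A *m castmx (esym hk, erefl r) v.
Proof. by case: q / hk v => v; rewrite !castmx_id. Qed.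

Lemma columns_mul (k : nat) (F : 'I_k -> V) (w : 'cV[R]_k) :
  (\matrix_(r < n, c < k) F c r 0) *m w = \sum_c w c 0 *: F c.
Proof.
apply/colP => i; rewrite mxE summxE; apply: eq_bigr => c _.
by rewrite !mxE mulrC.
Qed.

Lemma Fmx_mul (x : V) (v : V) (w := castmx (esym hn, erefl 1%N) v) :
  Fmx f hn x *m v = \sum_c usubmx (usubmx w) c 0 *: f (enum_val c) x
   + \sum_c dsubmx (usubmx w) c 0 *: field2 f (enum_val c) x
   + \sum_c dsubmx w c 0 *: field3 f (enum_val c) x.
Proof.
rewrite /Fmx castmx_mul -/w -{1}[w]vsubmxK -{1}[usubmx w]vsubmxK.
by rewrite !mul_row_col !(columns_mul (fun c => _ (enum_val c) x)).
Qed.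

(** Each spanning vector is the image of a coordinate vector, so the matrix is onto; preimages of
    the canonical basis form a right inverse, which for a square matrix is enough. *)
Lemma Fmx_unit (x : V) : (<<fields_at f S1 S2 S3 x>> = fullv)%VS -> Fmx f hn x \in unitmx.
Proof.
move=> hspan.
pose L : {linear V -> V} := mulmx (Fmx f hn x).
pose phi := linfun L.
have H (w : 'cV[R]_(#|S1| + #|S2| + #|S3|)) :
   \sum_c usubmx (usubmx w) c 0 *: f (enum_val c) x
   + \sum_c dsubmx (usubmx w) c 0 *: field2 f (enum_val c) x
   + \sum_c dsubmx w c 0 *: field3 f (enum_val c) x \in limg phi.
  apply/memv_imgP; exists (castmx (hn, erefl 1%N) w); first exact: memvf.
  by rewrite lfunE /= Fmx_mul castmx_comp castmx_id.
have dsum (k : nat) (F : 'I_k -> V) (c : 'I_k) : \sum_d (delta_mx c 0 : 'cV[R]_k) d 0 *: F d = F c.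
  rewrite (bigD1 c) //= mxE !eqxx scale1r big1 ?addr0 // => d dc.
  by rewrite mxE (negbTE dc) scale0r.
have zsum (k : nat) (F : 'I_k -> V) : \sum_d (0 : 'cV[R]_k) d 0 *: F d = 0.
  by rewrite big1 // => d _; rewrite mxE scale0r.
have full : (fullv <= limg phi)%VS.
  rewrite -[X in (X <= _)%VS]hspan; apply/span_subvP => y; rewrite !mem_cat.
  case/or3P => /mapP [i]; rewrite mem_enum => iS ->.
  - have := H (col_mx (col_mx (delta_mx (enum_rank_in iS i) 0) 0) 0).
    by rewrite !(col_mxKu, col_mxKd) dsum !zsum !addr0 enum_rankK_in.
  - have := H (col_mx (col_mx 0 (delta_mx (enum_rank_in iS i) 0)) 0).
    by rewrite !(col_mxKu, col_mxKd) dsum !zsum addr0 add0r enum_rankK_in.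
  - have := H (col_mx (col_mx 0 0) (delta_mx (enum_rank_in iS i) 0)).
    by rewrite !(col_mxKu, col_mxKd) dsum !zsum !add0r enum_rankK_in.
have /choice [w hw] : forall i : 'I_n, exists w : V, Fmx f hn x *m w = delta_mx i 0.
  move=> i; have /memv_imgP [w _ hw] := subvP full (delta_mx i 0) (memvf _).
  by exists w; rewrite hw lfunE.
have E : Fmx f hn x *m (\matrix_(i, j) w j i 0) = 1%:M.
  apply/matrixP => i j; rewrite !mxE.
  have := congr1 (fun u : V => u i 0) (hw j); rewrite !mxE eqxx andbT => <-.
  by apply: eq_bigr => k _; rewrite !mxE.
by have [] := mulmx1_unit E.
Qed.

Lemma avec_combination (gamma : R) (x : V) : Fmx f hn x \in unitmx ->
  \sum_c a1 f hn gamma x c *: f (enum_val c) x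
   + \sum_c a2 f hn gamma x c *: field2 f (enum_val c) x
   + \sum_c a3 f hn gamma x c *: field3 f (enum_val c) x = - (gamma *: x).
Proof.
move=> U; rewrite /a1 /a2 /a3 /avec_split -Fmx_mul /avec mulmxN -scalemxAr mulmxA mulmxV //.
by rewrite mul1mx.
Qed.

Lemma castmx_entry (k : nat) (hk : k = n) (v : V) (i : 'I_k) :
  `|castmx (esym hk, erefl 1%N) v i 0| <= `|v|.
Proof. by rewrite castmxE cast_ord_id; exact: cVnorm_ge. Qed.

Lemma avec_bound (gamma alpha : R) (x : V) : 0 < gamma -> opnorm (invmx (Fmx f hn x)) <= alpha ->
  [/\ forall c, `|a1 f hn gamma x c| <= gamma * alpha * enorm x,
      forall c, `|a2 f hn gamma x c| <= gamma * alpha * enorm x &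
      forall c, `|a3 f hn gamma x c| <= gamma * alpha * enorm x].
Proof.
move=> g0 hal.
have H i : `|avec_split f hn gamma x i 0| <= gamma * alpha * enorm x.
  apply: (le_trans (castmx_entry _ _ _)); apply: (le_trans (norm_le_enorm _)).
  rewrite /avec enormN enormZ (gtr0_norm g0) -mulrA ler_pM2l //.
  apply: (le_trans (opnorm_bound _ _)); apply: ler_wpM2r => //; exact: enorm_ge0.
by split => c; rewrite /a1 /a2 /a3 !mxE.
Qed.

End frame.

Section roots.
Context {R : realType}.

Lemma powR_expn (x r : R) (k : nat) : (x `^ r) ^+ k = x `^ (r * k%:R).
Proof. by rewrite -powR_mulrn ?powR_ge0 // -powRrM. Qed.

Lemma cbrtK (y : R) : cbrt y ^+ 3 = y.
Proof.
rewrite /cbrt exprMn powR_expn mul1r mulVf // powRr1 //.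
have [->|y0] := eqVneq y 0; first by rewrite normr0 mulr0.
by rewrite exprS sqr_sg y0 mulr1 -numEsg.
Qed.

(** The exponents [- (1 / 2)] here and [- (2 / 3)] below are those for which the amplitude
    integrated over a period has a square, respectively a cube, proportional to [eps]: brackets of
    both orders then act at the same rate as a direct input. *)
Lemma scaled_sqrt (eps a : R) : 0 < eps ->
  (eps * (eps `^ (- (1 / 2)) * Num.sqrt `|a|)) ^+ 2 = eps * `|a|.
Proof.
move=> e0; rewrite !exprMn sqr_sqrtr // powR_expn.
have -> : - (1 / 2) * 2%:R = -1 :> R by field.
rewrite powRN powRr1 ?ltW //; field; exact: lt0r_neq0.
Qed.

Lemma scaled_cbrt (eps a : R) : 0 < eps ->
  (eps * (eps `^ (- (2 / 3)) * cbrt a)) ^+ 3 = eps * a.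
Proof.
move=> e0; rewrite 2!exprMn cbrtK powR_expn.
have -> : - (2 / 3) * 3%:R = - 2%:R :> R by field.
rewrite powRN powR_mulrn ?ltW //; field; exact: lt0r_neq0.
Qed.

End roots.

Section control_decomposition.
Context {R : realType} {m n : nat}.
Variables (f : 'I_m -> 'cV[R]_n -> 'cV[R]_n).
Variables (S1 : {set 'I_m}) (S2 : {set 'I_m * 'I_m}) (S3 : {set 'I_m * 'I_m * 'I_m}).
Hypothesis hn : (#|S1| + #|S2| + #|S3|)%N = n.
Variables (kap : 'I_m * 'I_m -> nat) (kap1 kap2 : 'I_m * 'I_m * 'I_m -> nat).
Hypothesis nonres : nonresonant S2 S3 kap kap1 kap2.
Notation V := 'cV[R]_n.
Variables (gamma eps : R) (x : V).
Hypothesis eps0 : 0 < eps.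

(** The amplitudes carry a factor [eps] because [wave] divides by it. The sign of the coefficient
    goes to the cosine wave alone, so that the product of the two amplitudes of a pair has the sign
    of [a2]. *)
Definition amp2 (c : 'I_#|S2|) : R := 2 * Num.sqrt (pi * (freq2 kap c)%:R) *
  (eps * (eps `^ (- (1 / 2)) * Num.sqrt `|a2 f hn gamma x c|)).
Definition samp2 (c : 'I_#|S2|) : R := Num.sg (a2 f hn gamma x c) * amp2 c.
Definition amp3 (l : 'I_#|S3|) : R :=
  2 * cbrt (2 * pi ^+ 2 * (kap3 kap1 kap2 (enum_val l))%:R * (kap4 kap1 kap2 (enum_val l))%:R) *
  (eps * (eps `^ (- (2 / 3)) * cbrt (a3 f hn gamma x l))).

Definition cwave := wave (cfreq kap kap1 kap2) (@cphase R m S2 S3) (camp samp2 amp2 amp3) eps.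

Lemma delta_sum (k : 'I_m) (r : R) y : \sum_i ((i == k)%:R * r) *: f i y = r *: f k y.
Proof.
rewrite (bigD1 k) //= eqxx mul1r big1 ?addr0 // => i /negbTE ->.
by rewrite mul0r scale0r.
Qed.

Lemma samp2_amp2 c : samp2 c * amp2 c = 4 * pi * (freq2 kap c)%:R * (eps * a2 f hn gamma x c).
Proof.
have -> : samp2 c * amp2 c = Num.sg (a2 f hn gamma x c) * (4 * Num.sqrt (pi * (freq2 kap c)%:R) ^+ 2 *
    (eps * (eps `^ (- (1 / 2)) * Num.sqrt `|a2 f hn gamma x c|)) ^+ 2).
  by rewrite /samp2 /amp2; ring.
rewrite scaled_sqrt // sqr_sqrtr ?mulr_ge0 ?pi_ge0 //.
rewrite [in RHS](numEsg (a2 f hn gamma x c)); ring.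
Qed.

Lemma amp3_cube l : amp3 l ^+ 3 = 16 * pi ^+ 2 * (kap3 kap1 kap2 (enum_val l))%:R
     * (kap4 kap1 kap2 (enum_val l))%:R * (eps * a3 f hn gamma x l).
Proof. rewrite /amp3 exprMn scaled_cbrt // (exprMn _ 2) cbrtK; ring. Qed.

Lemma control_sum t y :
  \sum_i control f hn kap kap1 kap2 gamma eps i t x *: f i y =
  \sum_c a1 f hn gamma x c *: f (enum_val c) y + \sum_c cwave c t *: cfield f c y.
Proof.
have e0 : eps != 0 by exact: lt0r_neq0.
rewrite /control; under eq_bigr do rewrite !scalerDl.
rewrite !big_split /= -addrA; congr (_ + _).
  under eq_bigr do rewrite scaler_suml.
  rewrite exchange_big /=; apply: eq_bigr => c _; rewrite -(delta_sum _ (a1 f hn gamma x c)).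
  by apply: eq_bigr => i _; rewrite mulrC.
rewrite big_sumType /= !sum_pair; congr (_ + _).
  under eq_bigr do rewrite -scalerA scaler_suml scaler_sumr.
  rewrite exchange_big /=; apply: eq_bigr => c _; rewrite big_bool /=.
  rewrite -(delta_sum (enum_val c).1) -(delta_sum (enum_val c).2) -big_split /=.
  apply: eq_bigr => i _; rewrite scalerA -scalerDl; congr (_ *: _).
  rewrite /phi2 /cwave /wave /= /samp2 /amp2 /freq2 addr0 cosBpi2.
  have -> : 2 * pi / eps * (kap (enum_val c))%:R * t = 2 * pi * (kap (enum_val c))%:R / eps * t by ring.
  by field.
rewrite exchange_big /=.
under eq_bigr do rewrite -scalerA scaler_suml scaler_sumr.
rewrite exchange_big /=; apply: eq_bigr => l _.
have [_ K12 _ _ _] := freq3_generic nonres l.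
rewrite !big_ord_recl big_ord0 /= addr0.
rewrite -(delta_sum (enum_val l).1.1) -(delta_sum (enum_val l).1.2) -2!(delta_sum (enum_val l).2) -!big_split /=.
apply: eq_bigr => i _; rewrite scalerA -!scalerDl; congr (_ *: _).
rewrite /phi3 /cwave /wave /= /amp3 !freq3E /= addr0 !cosBpi2.
rewrite natrD natrB ?(ltnW K12) //.
have -> : 2 * pi / eps * (kap1 (enum_val l))%:R * t = 2 * pi * (kap1 (enum_val l))%:R / eps * t by ring.
have -> : 2 * pi / eps * (kap2 (enum_val l))%:R * t = 2 * pi * (kap2 (enum_val l))%:R / eps * t by ring.
set A := 2 * pi * (kap1 _)%:R / eps * t; set B := 2 * pi * (kap2 _)%:R / eps * t.
have -> : 2 * pi / eps * ((kap1 (enum_val l))%:R + (kap2 (enum_val l))%:R) * t = B + A.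
  by rewrite /A /B; field.
have -> : 2 * pi / eps * ((kap2 (enum_val l))%:R - (kap1 (enum_val l))%:R) * t = B - A.
  by rewrite /A /B; field.
rewrite sinD sinB; move: (cos A) (sin A) (cos B) (sin B) => cA sA cB sB.
by field.
Qed.

End control_decomposition.

(** Several channels run along the same field; regularity is known for the fields and is pulled back
    along the map from channels to fields. *)
Lemma smooth_on_reindex (R : realType) (V : normedModType R) (C C' : finType) (X : C -> V -> V)
    (X' : C' -> V -> V) (idx : C' -> C) (p : V) (r M eta : R) :
  (forall c, X' c = X (idx c)) -> smooth_on X p r M eta -> smooth_on X' p r M eta.
Proof.
move=> /funext -> h y /h [h1 h2 h3]; split.
- by move=> c; exact: h1.
- by move=> c d; exact: h2.
- by move=> c d e; exact: h3.
Qed.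

(** Amplitudes are compared through their squares or cubes. As [1 <= c], the constant [c] dominates
    the [k]-th root of [G], so no root has to be taken. *)
Lemma pow_root (R : realType) (x c G s : R) (k : nat) : (0 < k)%N -> 0 <= x -> 0 <= s -> 1 <= c ->
  G <= c -> x ^+ k <= G * s ^+ k -> x <= c * s.
Proof.
move=> k0 x0 s0 c1 Gc h.
have c0 : 0 <= c by lra.
rewrite -(@ler_pXn2r _ k) ?nnegrE ?mulr_ge0 // (le_trans h) // exprMn ler_wpM2r ?exprn_ge0 //.
rewrite (le_trans Gc) //; case: k k0 {h} => // k _.
by rewrite exprS ler_peMr // exprn_ege1.
Qed.

Lemma sum_inr (V : nmodType) (A B : finType) (G : A + B -> V) :
  (forall a, G (inl a) = 0) -> \sum_c G c = \sum_b G (inr b).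
Proof. by move=> h; rewrite big_sumType /= big1 ?add0r. Qed.

(** [mn] is the leading third-order part and [mix] collects all other words. Stated in an abstract
    group, the identity keeps the large sums opaque. *)
Lemma step_identity (V : zmodType) (x p T T' SW SM SU mn mn' mix P : V) :
  T = T' -> SW = SM -> mix = SU - mn' -> mn' = mn -> T' - SM - mn = - P ->
  x - p + P = (x - p - T + SW + SU) - mix.
Proof.
move=> -> -> -> -> h; rewrite -[P]opprK -h !opprD !opprK.
by rewrite !addrA addrK.
Qed.

(** * One sampling period *)

Section step.
Context {R : realType} {m n : nat}.
Notation V := 'cV[R]_n.
Variables (D : set V) (f : 'I_m -> V -> V) (g : R -> V -> V).
Variables (S1 : {set 'I_m}) (S2 : {set 'I_m * 'I_m}) (S3 : {set 'I_m * 'I_m * 'I_m}).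
Hypothesis hn : (#|S1| + #|S2| + #|S3|)%N = n.
Variables (kap : 'I_m * 'I_m -> nat) (kap1 kap2 : 'I_m * 'I_m * 'I_m -> nat).
Hypotheses (nonres : nonresonant S2 S3 kap kap1 kap2) (oD : open D) (Cf : forall i, Ck 2 D (f i)).
(** [E] stands for the norm of the sampled state and [s] for the amplitude scale; [Ga] bounds the
    control coefficients relative to [E], and [KA] the amplitudes relative to powers of [s]. Below,
    [small1] makes the Picard operator preserve the ball of radius [r], and [small2] makes it a
    contraction. *)
Variables (gamma eps Ga E s KA M eta r Gb Lb : R) (j : nat) (p : V).
Hypotheses (eps0 : 0 < eps) (E0 : 0 <= E) (Ga0 : 0 <= Ga) (s0 : 0 <= s) (s1 : s <= 1)
  (sE : s ^+ 6 = eps * E) (KA1 : 1 <= KA) (M0 : 0 <= M) (eta0 : 0 <= eta) (r0 : 0 <= r)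
  (Gb0 : 0 <= Gb) (Lb0 : 0 <= Lb).
Hypotheses (hKA2 : forall c : 'I_#|S2|, 4 * pi * (freq2 kap c)%:R * Ga <= KA)
  (hKA3 : forall l : 'I_#|S3|, 16 * pi ^+ 2 * (kap3 kap1 kap2 (enum_val l))%:R *
     (kap4 kap1 kap2 (enum_val l))%:R * Ga <= KA).
Hypotheses (hU : Fmx f hn p \in unitmx)
  (ha1 : forall c, `|a1 f hn gamma p c| <= Ga * E)
  (ha2 : forall c, `|a2 f hn gamma p c| <= Ga * E)
  (ha3 : forall c, `|a3 f hn gamma p c| <= Ga * E).
Let t0 := eps * j%:R.
Let t1 := eps * j.+1%:R.
Let q := KA * s ^+ 2.
Let n1 : R := #|S1|%:R.
Let N : R := #|channel S2 S3|%:R.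
Hypotheses (hD : forall y, cball p r y -> D y)
  (hf : forall i y, cball p r y -> `|f i y| <= M)
  (hL3 : forall i k l, `|L3 f i k l p| <= M)
  (hsm : smooth_on f p r M eta)
  (hgb : forall t y, t0 <= t <= t1 -> cball p r y -> `|g t y| <= Gb)
  (hgl : forall t y z, t0 <= t <= t1 -> cball p r y -> cball p r z -> `|g t y - g t z| <= Lb * `|y - z|)
  (hgm : forall i y, cball p r y -> measurable_fun (`[t0, t1] : set R) (fun t => g t y i 0))
  (small1 : eps * Gb + n1 * Ga * M * s ^+ 6 + N * M * q <= r)
  (small2 : eps * (Lb + n1 * Ga * E * M) + N * M * q <= 2^-1).

Let amp := camp (samp2 f hn kap gamma eps p) (amp2 f hn kap gamma eps p) (amp3 f hn kap1 kap2 gamma eps p).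
Let X := @cfield R m n S2 S3 f.
Let v := cwave f hn kap kap1 kap2 gamma eps p.
Let Vv := Wave (cfreq kap kap1 kap2) (@cphase R m S2 S3) amp eps.

Lemma amp_inl c b : `|amp (inl (c, b))| <= KA * s ^+ 3.
Proof.
have A2 : `|amp2 f hn kap gamma eps p c| <= KA * s ^+ 3.
  apply: (@pow_root R _ _ (4 * pi * (freq2 kap c)%:R * Ga) _ 2) => //; first exact: exprn_ge0.
  rewrite -exprM sE /amp2 -normrX exprMn scaled_sqrt // exprMn sqr_sqrtr ?mulr_ge0 ?pi_ge0 //.
  rewrite ger0_norm; last by rewrite !mulr_ge0 ?pi_ge0 ?exprn_ge0 // ltW.
  have -> : 2 ^+ 2 * (pi * (freq2 kap c)%:R) * (eps * `|a2 f hn gamma p c|) =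
    4 * pi * (freq2 kap c)%:R * eps * `|a2 f hn gamma p c| by ring.
  have -> : 4 * pi * (freq2 kap c)%:R * Ga * (eps * E) = 4 * pi * (freq2 kap c)%:R * eps * (Ga * E) by ring.
  by rewrite ler_wpM2l // !mulr_ge0 ?pi_ge0 // ltW.
case: b => //=; rewrite /amp /= /samp2 normrM normr_sg.
apply: le_trans A2; rewrite ler_piMl // lern1; by case: eqP.
Qed.

Lemma amp_inr P : `|amp (inr P)| <= q.
Proof.
case: P => k l.
have A3 : `|amp3 f hn kap1 kap2 gamma eps p l| <= q.
  apply: (@pow_root R _ _ (16 * pi ^+ 2 * (kap3 kap1 kap2 (enum_val l))%:R *
     (kap4 kap1 kap2 (enum_val l))%:R * Ga) _ 3) => //; first exact: exprn_ge0.
  rewrite -exprM sE -normrX amp3_cube // normrM.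
  rewrite ger0_norm; last by rewrite !mulr_ge0 ?exprn_ge0 ?pi_ge0.
  rewrite -[leRHS]mulrA; apply: ler_wpM2l; first by rewrite !mulr_ge0 ?exprn_ge0 ?pi_ge0.
  by rewrite normrM (gtr0_norm eps0) mulrCA; apply: ler_wpM2l; [exact: ltW|exact: ha3].
rewrite /amp /=; case: ifP => // _; apply: le_trans A3.
rewrite normrM normfV (@ger0_norm _ 2) //.
have := normr_ge0 (amp3 f hn kap1 kap2 gamma eps p l); lra.
Qed.

Lemma KA_ge0 : 0 <= KA. Proof. exact: le_trans ler01 KA1. Qed.

Lemma q_ge0 : 0 <= q. Proof. by apply: mulr_ge0; [exact: KA_ge0|exact: exprn_ge0]. Qed.

Lemma amp_q c : `|amp c| <= q.
Proof.
case: c => [[c b]|P]; last exact: amp_inr.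
apply: le_trans (amp_inl c b) _; rewrite /q ler_wpM2l ?KA_ge0 //.
by rewrite exprSr ler_piMr // exprn_ge0.
Qed.

Lemma tau_eps : t1 - t0 = eps. Proof. exact: period_length. Qed.

Lemma v_bound c t : `|v c t| <= q / eps.
Proof.
have [h _] := wave_bound (@cphase R m S2 S3) amp j eps0 (cfreq_gt0 nonres) c t.
rewrite -/t0 -/t1 tau_eps in h.
by rewrite ler_pdivlMr // (le_trans h) // amp_q.
Qed.

Definition drive (t : R) (y : V) : V := g t y + \sum_i control f hn kap kap1 kap2 gamma eps i t p *: f i y.

Lemma driveE t y : drive t y =
  g t y + (\sum_c a1 f hn gamma p c *: f (enum_val c) y + \sum_c v c t *: X c y).
Proof. by rewrite /drive control_sum. Qed.

Lemma X_le c y : cball p r y -> `|X c y| <= M.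
Proof. by case: c => [[c b]|[k l]] hy; exact: hf. Qed.

Lemma smX : smooth_on X p r M eta.
Proof.
pose idx (c : channel S2 S3) : 'I_m := match c with
  | inl (c, b) => if b then (enum_val c).1 else (enum_val c).2
  | inr (s, l) => nth (enum_val l).2 [:: (enum_val l).1.1; (enum_val l).1.2] s
  end.
apply: (@smooth_on_reindex R V _ _ f X idx) => //.
by case=> [[c b]|[k l]].
Qed.

Lemma drive_bound t y : t0 <= t <= t1 -> cball p r y -> `|drive t y| <= r / eps.
Proof.
move=> ht hy; rewrite driveE ler_pdivlMr // mulrC; apply: le_trans small1.
have h1 : `|\sum_c a1 f hn gamma p c *: f (enum_val c) y| <= n1 * (Ga * E * M).
  rewrite /n1 -[X in X%:R](card_ord #|S1|); apply: ler_sum_const => c.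
  by rewrite normrZ ler_pM //; exact: hf.
have h2 : `|\sum_c v c t *: X c y| <= N * (q / eps * M).
  by apply: ler_sum_const => c; rewrite normrZ ler_pM // ?v_bound // X_le.
have h3 := hgb ht hy.
apply: (@le_trans _ _ (eps * (Gb + (n1 * (Ga * E * M) + N * (q / eps * M))))).
  rewrite ler_pM2l //; apply: (le_trans (ler_normD _ _)); apply: lerD => //.
  by apply: (le_trans (ler_normD _ _)); apply: lerD.
rewrite le_eqVlt; apply/orP; left; apply/eqP; rewrite sE; field; exact: lt0r_neq0.
Qed.

Lemma drive_lip t y z : t0 <= t <= t1 -> cball p r y -> cball p r z ->
  `|drive t y - drive t z| <= (Lb + n1 * Ga * E * M + N * (q / eps * M)) * `|y - z|.
Proof.
move=> ht hy hz; rewrite !driveE.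
have lf i : `|f i y - f i z| <= M * `|y - z|.
  by apply: mvi_diff hz hy => u /hsm [].
have lX c : `|X c y - X c z| <= M * `|y - z|.
  by apply: mvi_diff hz hy => u /smX [].
have -> : g t y + (\sum_c a1 f hn gamma p c *: f (enum_val c) y + \sum_c v c t *: X c y)
   - (g t z + (\sum_c a1 f hn gamma p c *: f (enum_val c) z + \sum_c v c t *: X c z)) =
   (g t y - g t z) + (\sum_c a1 f hn gamma p c *: (f (enum_val c) y - f (enum_val c) z) +
     \sum_c v c t *: (X c y - X c z)).
  rewrite opprD addrACA opprD; congr (_ + _); rewrite addrACA -!sumrB.
  by congr (_ + _); apply: eq_bigr => c _; rewrite scalerBr.
have h1 : `|\sum_c a1 f hn gamma p c *: (f (enum_val c) y - f (enum_val c) z)| <=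
    n1 * (Ga * E * (M * `|y - z|)).
  rewrite /n1 -[X in X%:R](card_ord #|S1|); apply: ler_sum_const => c.
  by rewrite normrZ ler_pM.
have h2 : `|\sum_c v c t *: (X c y - X c z)| <= N * (q / eps * (M * `|y - z|)).
  by apply: ler_sum_const => c; rewrite normrZ ler_pM // v_bound.
have h3 := hgl ht hy hz.
apply: (le_trans (ler_normD _ _)).
have := ler_normD (\sum_c a1 f hn gamma p c *: (f (enum_val c) y - f (enum_val c) z))
   (\sum_c v c t *: (X c y - X c z)).
lra.
Qed.

Lemma v_measurable c : measurable_fun setT (v c).
Proof.
have -> : v c = (fun t => amp c / eps *
   sin (2 * pi / eps * (cfreq kap kap1 kap2 c)%:R * t + (@cphase R m S2 S3 c + pi / 2))).
  apply/funext => t; rewrite /v /cwave /wave -/amp; congr (_ * _).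
  by rewrite -cosBpi2; congr cos; ring.
apply: measurable_funM; first exact: measurable_cst.
apply: continuous_measurable_fun => t.
apply/differentiable_continuous/derivable1_diffP.
by have [] := is_derive_sin_affine (2 * pi / eps * (cfreq kap kap1 kap2 c)%:R)
  (@cphase R m S2 S3 c + pi / 2) t.
Qed.

Lemma drive_measurable i y : cball p r y ->
  measurable_fun (`[t0, t1] : set R) (fun t => drive t y i 0).
Proof.
move=> hy.
have -> : (fun t => drive t y i 0) = (fun t => g t y i 0 +
   ((\sum_c a1 f hn gamma p c *: f (enum_val c) y) i 0 + \sum_c v c t * X c y i 0)).
  apply/funext => t; rewrite driveE !mxE; congr (_ + (_ + _)).
  by rewrite summxE; apply: eq_bigr => c _; rewrite mxE.
apply: measurable_funD; first exact: hgm.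
apply: measurable_funD; first exact: measurable_cst.
apply: measurable_sum => c; apply: measurable_funM; last exact: measurable_cst.
by apply: measurable_funTS; exact: v_measurable.
Qed.

Lemma step_main_term : eps *: (\sum_c a1 f hn gamma p c *: f (enum_val c) p) -
  \sum_c \sum_d m_coef (cfreq kap kap1 kap2) (@cphase R m S2 S3) amp c d *: L2 X c d p -
  \sum_P \sum_Q \sum_T u_coef (cfreq kap kap1 kap2) (@cphase R m S2 S3) amp (inr P) (inr Q) (inr T)
     *: L3 X (inr P) (inr Q) (inr T) p = - ((eps * gamma) *: p).
Proof.
have Dp : D p by apply: hD; rewrite /cball /= subrr normr0.
have E1 := sum_m nonres (amp3 f hn kap1 kap2 gamma eps p) oD Cf Dp (samp2_amp2 f hn kap gamma p eps0).
have E2 := sum_u nonres (samp2 f hn kap gamma eps p) (amp2 f hn kap gamma eps p) oD Cf Dp (amp3_cube f hn kap1 kap2 gamma p eps0).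
apply: (etrans (congr2 (fun a b => _ - a - b) E1 E2)).
rewrite !opprK -scalerA -scalerN -(avec_combination gamma hU) !scalerDr !scaler_sumr.
by congr (_ + _ + _); apply: eq_bigr => c _; rewrite scalerA.
Qed.

Let B0 := Gb + n1 * (Ga * E * (M * r)).

Lemma period_step : exists x : R -> V, [/\ x t0 = p,
    forall s t, `|x t - x s| <= r / eps * `|t - s|,
    forall t, t0 <= t <= t1 -> cball p r (x t),
    {ae @lebesgue_measure R, forall t, t0 <= t <= t1 -> is_derive t (1:R) x (drive t (x t))} &
    `|x t1 - p + (eps * gamma) *: p| <=
      eps * B0 + (N * M * q + N ^+ 2 * M * q ^+ 2) * (eps * B0 + n1 * Ga * M * s ^+ 6)
      + N ^+ 3 * q ^+ 3 * eta + N ^+ 2 * (KA * s ^+ 3) ^+ 2 * M * r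
      + N ^+ 3 * (KA * s ^+ 3 * q ^+ 2 * M)].
Proof.
have t01 : t0 < t1 by rewrite -subr_gt0 tau_eps.
have q0 := q_ge0.
have N0 : 0 <= N by exact: ler0n.
have n10 : 0 <= n1 by exact: ler0n.
have [] := @picard R n drive p t0 t1 (r / eps) (Lb + n1 * Ga * E * M + N * (q / eps * M)) r t01.
- by rewrite divr_ge0 // ltW.
- apply: addr_ge0; first by rewrite addr_ge0 // !mulr_ge0.
  by rewrite mulr_ge0 // mulr_ge0 // divr_ge0 // ltW.
- exact: r0.
- by move=> i y; exact: drive_measurable.
- exact: drive_bound.
- exact: drive_lip.
- by rewrite tau_eps divfK // lt0r_neq0.
- rewrite tau_eps; apply: le_trans small2; rewrite le_eqVlt; apply/orP; left; apply/eqP.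
  by field; exact: lt0r_neq0.
move=> x [x0 lx xK dx]; exists x; split => //.
(* The terms of S1 are split: frozen at [p] they form [A0], which the expansion treats exactly;
   their variation joins the drift in the slow remainder bounded by [B0]. *)
pose A0 := \sum_c a1 f hn gamma p c *: f (enum_val c) p.
have A0b : `|A0| <= n1 * (Ga * E * M).
  rewrite /n1 -[X in X%:R](card_ord #|S1|); apply: ler_sum_const => c.
  rewrite normrZ ler_pM //; apply: hf; by rewrite /cball /= subrr normr0.
have /choice [W hW] : forall cd : channel S2 S3 * channel S2 S3, exists F : R -> R,
    [/\ forall t, is_derive t (1:R) F (Vv cd.1 t * v cd.2 t), F t0 = 0 &
       F t1 = m_coef (cfreq kap kap1 kap2) (@cphase R m S2 S3) amp cd.1 cd.2].
  move=> cd; exact: (m_increment (@cphase R m S2 S3) amp j eps0 (cfreq_gt0 nonres) cd.1 cd.2).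
have /choice [U hU'] : forall cde : channel S2 S3 * (channel S2 S3 * channel S2 S3), exists F : R -> R,
    [/\ forall t, is_derive t (1:R) F (Vv cde.1 t * v cde.2.1 t * Vv cde.2.2 t), F t0 = 0 &
       F t1 = u_coef (cfreq kap kap1 kap2) (@cphase R m S2 S3) amp cde.1 cde.2.1 cde.2.2].
  move=> cde; exact: (u_increment (@cphase R m S2 S3) amp j eps0 (cfreq_gt0 nonres) cde.1 cde.2.1 cde.2.2).
pose uc := u_coef (cfreq kap kap1 kap2) (@cphase R m S2 S3) amp.
have Ws c d : W (c, d) t0 = 0 /\ `|W (c, d) t1| <= (KA * s ^+ 3) ^+ 2.
  have [_ W0 ->] := hW (c, d); split => //.
  apply: (m_bound nonres); first by rewrite mulr_ge0 ?exprn_ge0 // KA_ge0.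
  exact: amp_inl.
have Ex := @expansion R V (channel S2 S3) X p A0 r M eta q B0 ((KA * s ^+ 3) ^+ 2) t0 t1 v Vv
  (fun c d => W (c, d)) (fun c d e => U (c, (d, e))) x smX t01 M0 q0.
have {}Ex := Ex _ eta0 (Wave_derive (@cphase R m S2 S3) amp eps0 (cfreq_gt0 nonres))
  (Wave_ends (cfreq kap kap1 kap2) (@cphase R m S2 S3) amp j eps0).
have B00 : 0 <= B0 by rewrite /B0 addr_ge0 // !mulr_ge0.
have {}Ex := Ex B00.
have {}Ex : `| x t1 - p - (t1 - t0) *: A0 + \sum_c \sum_d W (c, d) t1 *: L2 X c d p
     + \sum_c \sum_d \sum_e U (c, (d, e)) t1 *: L3 X c d e p | <=
  (t1 - t0) * B0 + (t1 - t0) * (N * M * q + N ^+ 2 * M * q ^+ 2) * (B0 + `|A0|)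
  + N ^+ 3 * q ^+ 3 * eta + N ^+ 2 * (KA * s ^+ 3) ^+ 2 * M * r.
  apply: Ex => //.
  - move=> c t _.
    have [h1 h2] := wave_bound (@cphase R m S2 S3) amp j eps0 (cfreq_gt0 nonres) c t.
    by split; [apply: le_trans h1 _|apply: le_trans h2 _]; exact: amp_q.
  - by move=> c d t; have [h _ _] := hW (c, d); exact: h.
  - by move=> c d e t; have [h _ _] := hU' (c, (d, e)); exact: h.
  - by move=> c d e; have [_ h _] := hU' (c, (d, e)).
  - by exists (r / eps) => a b _ _; exact: lx.
  - apply: filterS dx; first exact: (ae_filter_ringOfSetsType lebesgue_measure).
    move=> t h ht; exists (g t (x t) + \sum_c a1 f hn gamma p c *: (f (enum_val c) (x t) - f (enum_val c) p)).
      apply: (le_trans (ler_normD _ _)); apply: lerD; first by apply: hgb => //; exact: xK.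
      rewrite /n1 -[X in X%:R](card_ord #|S1|); apply: ler_sum_const => c.
      rewrite normrZ ler_pM //.
      have pp : cball p r p by rewrite /cball /= subrr normr0.
      apply: (le_trans (mvi_diff _ pp (xK t ht))) => [u /hsm []//|].
      by apply: ler_wpM2l => //; exact: xK.
    have -> : g t (x t) + \sum_c a1 f hn gamma p c *: (f (enum_val c) (x t) - f (enum_val c) p) + A0 +
        \sum_c v c t *: X c (x t) = drive t (x t).
      rewrite driveE -!addrA; congr (_ + _); rewrite addrA; congr (_ + _).
      by rewrite /A0 -big_split /=; apply: eq_bigr => c _; rewrite scalerBr subrK.
    exact: h.
(* Only words made of three waves of triples reach order six in [s]. Every other word contains a
   wave of a pair, of size [KA * s ^+ 3], and is bounded at order seven without being averaged. *)
pose main (c d e : channel S2 S3) : V := match c, d, e with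
  | inr P, inr Q, inr T => uc (inr P) (inr Q) (inr T) *: L3 X (inr P) (inr Q) (inr T) p
  | _, _, _ => 0
  end.
have mainE : \sum_c \sum_d \sum_e main c d e =
   \sum_P \sum_Q \sum_T uc (inr P) (inr Q) (inr T) *: L3 X (inr P) (inr Q) (inr T) p.
  apply: (etrans (sum_inr _)) => [c|]; first by rewrite big1 // => d _; exact: big1.
  apply: eq_bigr => P _; apply: (etrans (sum_inr _)) => [d|]; first exact: big1.
  by apply: eq_bigr => Q _; exact: sum_inr.
have mix : `|\sum_c \sum_d \sum_e (uc c d e *: L3 X c d e p - main c d e)| <=
    N ^+ 3 * (KA * s ^+ 3 * q ^+ 2 * M).
  have -> : N ^+ 3 * (KA * s ^+ 3 * q ^+ 2 * M) = N * (N * (N * (KA * s ^+ 3 * q ^+ 2 * M))) by ring.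
  apply: ler_sum_const => c; apply: ler_sum_const => d; apply: ler_sum_const => e.
  have K0 := KA_ge0.
  have s3 : 0 <= KA * s ^+ 3 by rewrite mulr_ge0 // exprn_ge0.
  have bnd0 : 0 <= KA * s ^+ 3 * q ^+ 2 * M by rewrite !mulr_ge0 // ?exprn_ge0.
  have hL3X : `|L3 X c d e p| <= M.
    by case: c => [[? ?]|[? ?]]; case: d => [[? ?]|[? ?]]; case: e => [[? ?]|[? ?]]; exact: hL3.
  have small a b c' : 0 <= a -> 0 <= b -> 0 <= c' -> a <= KA * s ^+ 3 -> b <= q -> c' <= q ->
      a * b * c' <= KA * s ^+ 3 * q ^+ 2.
    by move=> a0 b0 c0 ha hb hc; rewrite expr2 mulrA !ler_pM // mulr_ge0.
  have gen : (`|amp c| * `|amp d| * `|amp e| <= KA * s ^+ 3 * q ^+ 2) ->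
     `|uc c d e *: L3 X c d e p| <= KA * s ^+ 3 * q ^+ 2 * M.
    move=> h; rewrite normrZ ler_pM //; apply: le_trans h; exact: (u_bound nonres).
  case: c gen hL3X => [[c b]|P] gen hL3X; first last.
    case: d gen hL3X => [[d b]|Q] gen hL3X; first last.
      case: e gen hL3X => [[e b]|T] gen hL3X; first last.
        by rewrite /main subrr normr0.
      rewrite subr0; apply: gen; rewrite mulrC mulrA; apply: small => //; [exact: amp_inl|exact: amp_q|exact: amp_q].
    rewrite subr0; apply: gen; rewrite [X in X * _]mulrC; apply: small => //; [exact: amp_inl|exact: amp_q|exact: amp_q].
  rewrite subr0; apply: gen; apply: small => //; [exact: amp_inl|exact: amp_q|exact: amp_q].
have ident : x t1 - p + (eps * gamma) *: p =
   (x t1 - p - (t1 - t0) *: A0 + \sum_c \sum_d W (c, d) t1 *: L2 X c d p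
     + \sum_c \sum_d \sum_e U (c, (d, e)) t1 *: L3 X c d e p)
   - \sum_c \sum_d \sum_e (uc c d e *: L3 X c d e p - main c d e).
  have EU : \sum_c \sum_d \sum_e (uc c d e *: L3 X c d e p - main c d e) =
      \sum_c \sum_d \sum_e U (c, (d, e)) t1 *: L3 X c d e p - \sum_c \sum_d \sum_e main c d e.
    rewrite -sumrB; apply: eq_bigr => c _; rewrite -sumrB; apply: eq_bigr => d _.
    rewrite -sumrB; apply: eq_bigr => e _; congr (_ *: _ - _).
    by have [_ _ ->] := hU' (c, (d, e)).
  have EW : \sum_c \sum_d W (c, d) t1 *: L2 X c d p =
     \sum_c \sum_d m_coef (cfreq kap kap1 kap2) (@cphase R m S2 S3) amp c d *: L2 X c d p.
    by apply: eq_bigr => c _; apply: eq_bigr => d _; have [_ _ ->] := hW (c, d).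
  have ET : (t1 - t0) *: A0 = eps *: A0 by rewrite tau_eps.
  exact: step_identity ET EW EU mainE step_main_term.
rewrite ident; apply: (le_trans (ler_normB _ _)); apply: lerD => //.
apply: (le_trans Ex); rewrite tau_eps; apply: lerD => //; apply: lerD => //; apply: lerD => //.
set Q := N * M * q + _.
have Q0 : 0 <= Q.
  rewrite /Q addr_ge0 //; first by rewrite mulr_ge0 // mulr_ge0.
  by rewrite mulr_ge0 ?exprn_ge0 // mulr_ge0 ?exprn_ge0.
rewrite (_ : eps * Q * (B0 + `|A0|) = Q * (eps * B0 + eps * `|A0|)); last by ring.
apply: ler_wpM2l => //.
rewrite lerD2l (_ : n1 * Ga * M * s ^+ 6 = eps * (n1 * (Ga * E * M))); last by rewrite sE; ring.
by apply: ler_wpM2l => //; exact: ltW.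
Qed.

End step.

(** * Orders of magnitude and uniform constants *)

Ltac nonneg := repeat (first [assumption | by [] | apply: exprn_ge0 | apply: addr_ge0 | apply: mulr_ge0]).

Lemma cube_sum (R : realType) (a b : R) : 0 <= a -> 0 <= b -> (a + b) ^+ 3 <= 4 * (a ^+ 3 + b ^+ 3).
Proof.
move=> a0 b0; rewrite -subr_ge0.
have -> : 4 * (a ^+ 3 + b ^+ 3) - (a + b) ^+ 3 = 3 * ((a + b) * (a - b) ^+ 2) by ring.
apply: mulr_ge0 => //; apply: mulr_ge0; [exact: addr_ge0|exact: sqr_ge0].
Qed.

Section step_arith.
Context {R : realType}.
Variables (n N n1 M KA Kr Ga Mc del E eps s eta : R).
Hypotheses (n0 : 0 <= n) (N0 : 0 <= N) (n10 : 0 <= n1) (M0 : 0 <= M) (KA0 : 0 <= KA)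
  (Kr0 : 0 <= Kr) (Ga0 : 0 <= Ga) (Mc0 : 0 <= Mc) (E0 : 0 <= E) (Ed : E <= del)
  (eps0 : 0 <= eps) (eps1 : eps <= 1) (s0 : 0 <= s) (s1 : s <= 1) (eta0 : 0 <= eta)
  (sE : s ^+ 6 = eps * E).
Let r := Kr * s ^+ 2.
Let q := KA * s ^+ 2.
Let Gb := Mc * (E + n * r) ^+ 3.
Let B0 := Gb + n1 * (Ga * E * (M * r)).
Let c1 := 4 * Mc * (n * Kr) ^+ 3.
Let c2 := n1 * Ga * M * Kr.
Let b := 4 * Mc * del ^+ 2 + c1 + c2.
Let c3 := (N * M * KA + N ^+ 2 * M * KA ^+ 2) * (b + n1 * Ga * M).

Lemma spow k l : (k <= l)%N -> s ^+ l <= s ^+ k.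
Proof. by move=> kl; rewrite -(subnKC kl) exprD ler_piMr ?exprn_ge0 // exprn_ile1. Qed.

(** The excursion [r] may exceed [E], but its cube is a multiple of [s ^+ 6 = eps * E]; after
    multiplication by [eps] it gains a further [eps]. Only the cube of [E] itself leaves a term that
    does not become small. *)
Lemma drift_arith : eps * Gb <= s ^+ 6 * (4 * Mc * del ^+ 2 + c1 * eps).
Proof.
have s6 : 0 <= s ^+ 6 by exact: exprn_ge0.
have r0 : 0 <= n * r by rewrite /r; nonneg.
have h := cube_sum E0 r0.
have h1 : eps * Gb <= eps * (Mc * (4 * (E ^+ 3 + (n * r) ^+ 3))).
  by rewrite ler_wpM2l // ler_wpM2l.
apply: (le_trans h1).
have -> : eps * (Mc * (4 * (E ^+ 3 + (n * r) ^+ 3))) = s ^+ 6 * (4 * Mc * E ^+ 2 + c1 * eps).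
  transitivity (eps * E * (4 * Mc * E ^+ 2) + s ^+ 6 * (c1 * eps)); first by rewrite /c1 /r; ring.
  by rewrite -sE; ring.
rewrite ler_wpM2l // lerD2r; apply: ler_wpM2l; first by nonneg.
by rewrite ler_sqr ?nnegrE //; exact: le_trans Ed.
Qed.

Definition step_const := c1 + c2 + c3 + N ^+ 3 * KA ^+ 3 + N ^+ 2 * KA ^+ 2 * M * Kr + N ^+ 3 * KA ^+ 3 * M.

Lemma c1_ge0 : 0 <= c1. Proof. by rewrite /c1; nonneg. Qed.
Lemma c2_ge0 : 0 <= c2. Proof. by rewrite /c2; nonneg. Qed.
Lemma b_ge0 : 0 <= b.
Proof. by have k1 := c1_ge0; have k2 := c2_ge0; rewrite /b; nonneg; exact: le_trans Ed. Qed.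
Lemma c3a_ge0 : 0 <= N * M * KA + N ^+ 2 * M * KA ^+ 2.
Proof. by nonneg. Qed.
Lemma c3_ge0 : 0 <= c3.
Proof. by have kb := b_ge0; have k3 := c3a_ge0; rewrite /c3; nonneg. Qed.

(** Besides [s ^+ 6], every contribution carries a factor [eps], [s] or [eta], except
    [4 * Mc * del ^+ 2], which is free of the gain. *)
Lemma step_arith :
  eps * B0 + (N * M * q + N ^+ 2 * M * q ^+ 2) * (eps * B0 + n1 * Ga * M * s ^+ 6)
      + N ^+ 3 * q ^+ 3 * eta + N ^+ 2 * (KA * s ^+ 3) ^+ 2 * M * r
      + N ^+ 3 * (KA * s ^+ 3 * q ^+ 2 * M)
  <= s ^+ 6 * (4 * Mc * del ^+ 2 + step_const * (eps + s + eta)).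
Proof.
have s6 : 0 <= s ^+ 6 by exact: exprn_ge0.
have k1 := c1_ge0; have k2 := c2_ge0; have kb := b_ge0; have k3a := c3a_ge0; have k3 := c3_ge0.
have eB : eps * B0 <= s ^+ 6 * (4 * Mc * del ^+ 2 + c1 * eps + c2 * s).
  have -> : eps * B0 = eps * Gb + s ^+ 6 * (c2 * s ^+ 2).
    by rewrite sE /B0 /c2 /r; ring.
  rewrite [in leRHS]mulrDr; apply: lerD; first exact: drift_arith.
  by rewrite ler_wpM2l // ler_wpM2l // -[leRHS]expr1 spow.
have eBb : eps * B0 <= s ^+ 6 * b.
  apply: (le_trans eB); rewrite ler_wpM2l // /b.
  have : c1 * eps <= c1 by rewrite ler_piMr.
  have : c2 * s <= c2 by rewrite ler_piMr.
  lra.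
have t2 : (N * M * q + N ^+ 2 * M * q ^+ 2) * (eps * B0 + n1 * Ga * M * s ^+ 6) <= s ^+ 6 * (c3 * s).
  have -> : s ^+ 6 * (c3 * s) = ((N * M * KA + N ^+ 2 * M * KA ^+ 2) * s) * (s ^+ 6 * b + n1 * Ga * M * s ^+ 6).
    by rewrite /c3; ring.
  apply: ler_pM.
  - by rewrite /q; nonneg.
  - by rewrite /B0 /Gb /r; nonneg.
  - have -> : N * M * q + N ^+ 2 * M * q ^+ 2 = N * M * KA * s ^+ 2 + N ^+ 2 * M * KA ^+ 2 * s ^+ 4.
      by rewrite /q; ring.
    rewrite mulrDl; apply: lerD; (apply: ler_wpM2l; [by nonneg|rewrite -[leRHS]expr1; exact: spow]).
  - by rewrite lerD2r.
have t3 : N ^+ 3 * q ^+ 3 * eta = s ^+ 6 * (N ^+ 3 * KA ^+ 3 * eta) by rewrite /q; ring.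
have t4 : N ^+ 2 * (KA * s ^+ 3) ^+ 2 * M * r <= s ^+ 6 * (N ^+ 2 * KA ^+ 2 * M * Kr * s).
  have -> : N ^+ 2 * (KA * s ^+ 3) ^+ 2 * M * r = s ^+ 6 * (N ^+ 2 * KA ^+ 2 * M * Kr * s ^+ 2).
    by rewrite /r; ring.
  rewrite ler_wpM2l //; apply: ler_wpM2l; first by nonneg.
  by rewrite -[leRHS]expr1 spow.
have t5 : N ^+ 3 * (KA * s ^+ 3 * q ^+ 2 * M) = s ^+ 6 * (N ^+ 3 * KA ^+ 3 * M * s) by rewrite /q; ring.
rewrite t3 t5.
have step_le : s ^+ 6 * (4 * Mc * del ^+ 2 + c1 * eps + c2 * s) + s ^+ 6 * (c3 * s) +
    s ^+ 6 * (N ^+ 3 * KA ^+ 3 * eta) + s ^+ 6 * (N ^+ 2 * KA ^+ 2 * M * Kr * s) +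
    s ^+ 6 * (N ^+ 3 * KA ^+ 3 * M * s) <= s ^+ 6 * (4 * Mc * del ^+ 2 + step_const * (eps + s + eta)).
  rewrite -!mulrDr ler_wpM2l //.
  have k4 : 0 <= N ^+ 3 * KA ^+ 3 by nonneg.
  have k5 : 0 <= N ^+ 2 * KA ^+ 2 * M * Kr by nonneg.
  have k6 : 0 <= N ^+ 3 * KA ^+ 3 * M by nonneg.
  have P (x y : R) : 0 <= x -> 0 <= y -> 0 <= x * y by exact: mulr_ge0.
  rewrite /step_const.
  move: (N ^+ 3 * KA ^+ 3) (N ^+ 2 * KA ^+ 2 * M * Kr) (N ^+ 3 * KA ^+ 3 * M) k4 k5 k6 => d4 d5 d6 k4 k5 k6.
  move: c1 c2 c3 k1 k2 k3 => d1 d2 d3 k1 k2 k3.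
  have := P d1 s k1 s0; have := P d1 eta k1 eta0; have := P d2 eps k2 eps0; have := P d2 eta k2 eta0.
  have := P d3 eps k3 eps0; have := P d3 eta k3 eta0; have := P d4 eps k4 eps0; have := P d4 s k4 s0.
  have := P d5 eps k5 eps0; have := P d5 eta k5 eta0; have := P d6 eps k6 eps0; have := P d6 eta k6 eta0.
  lra.
apply: le_trans step_le; lra.
Qed.

End step_arith.

(* The amplitude scale: waves of pairs have size root6^3, those of triples root6^2. *)
Definition root6 (R : realType) (eps E : R) := (eps * E) `^ (1 / 6).

Lemma root6_ge0 (R : realType) (eps E : R) : 0 <= root6 eps E. Proof. exact: powR_ge0. Qed.

Lemma root6K (R : realType) (eps E : R) : 0 < eps -> 0 <= E -> root6 eps E ^+ 6 = eps * E.
Proof.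
move=> e0 E0; rewrite /root6 powR_expn mul1r mulVf // powRr1 //; apply: mulr_ge0 => //; exact: ltW.
Qed.

(** The dimension comes from comparing the sup norm with the Euclidean norm, the 4 from [cube_sum],
    and [del ^+ 2] from bounding two of the three factors of the norm. The gain does not enter, so
    it can be chosen above this rate. *)
Definition drift_rate (R : realType) (n : nat) (del Mc : R) : R := n%:R * (4 * Mc * del ^+ 2).

(** [Kr] is fixed before [sigma] and [eps], and [eps1] is uniform in the period and in the state,
    since infinitely many periods are to be concatenated. The radius [rho] is left open because the
    ball on which the drift is controlled changes with time. *)
Lemma uniform_step (R : realType) (m n : nat) (D : set 'cV[R]_n) (f : 'I_m -> 'cV[R]_n -> 'cV[R]_n)
  (g : R -> 'cV[R]_n -> 'cV[R]_n) (S1 : {set 'I_m}) (S2 : {set 'I_m * 'I_m})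
  (S3 : {set 'I_m * 'I_m * 'I_m}) (hn : (#|S1| + #|S2| + #|S3|)%N = n)
  (kap : 'I_m * 'I_m -> nat) (kap1 kap2 : 'I_m * 'I_m * 'I_m -> nat)
  (alpha del r1 Mc L gamma : R) :
  nonresonant S2 S3 kap kap1 kap2 -> open D -> (forall i, Ck 2 D (f i)) ->
  0 < alpha -> 0 < del -> eball r1 `<=` D -> 0 <= Mc -> 0 <= L ->
  (forall x, D x -> (<<fields_at f S1 S2 S3 x>> = fullv)%VS) ->
  (forall x, D x -> opnorm (invmx (Fmx f hn x)) <= alpha) ->
  0 < gamma -> exists2 Kr, 0 <= Kr & forall sigma, 0 < sigma ->
  exists2 eps1, 0 < eps1 & forall eps, 0 < eps <= eps1 -> forall (j : nat) (p : 'cV[R]_n) (rho : R),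
  enorm p <= del ->
  let s := root6 eps (enorm p) in let r := Kr * s ^+ 2 in
  let t0 := eps * j%:R in let t1 := eps * j.+1%:R in
  r <= sigma /\
  ((forall y, cball p r y -> eball rho y) -> rho <= r1 ->
   (forall t y, t0 <= t <= t1 -> eball rho y -> enorm (g t y) <= Mc * enorm y ^+ 3) ->
   (forall t y z, t0 <= t <= t1 -> eball rho y -> eball rho z ->
      enorm (g t y - g t z) <= L * enorm (y - z)) ->
   (forall i y, eball rho y -> measurable_fun (`[t0, t1] : set R) (fun t => g t y i 0)) ->
   exists x : R -> 'cV[R]_n, [/\ x t0 = p,
    forall u t, `|x t - x u| <= r / eps * `|t - u|,
    forall t, t0 <= t <= t1 -> cball p r (x t),
    {ae @lebesgue_measure R, forall t, t0 <= t <= t1 -> is_derive t (1:R) x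
       (g t (x t) + \sum_i control f hn kap kap1 kap2 gamma eps i t p *: f i (x t))} &
    enorm (x t1) <= (1 - eps * (gamma - drift_rate n del Mc - 1)) * enorm p]).
Proof.
move=> nonres oD Cf alpha0 del0 r1D Mc0 L0 hspan hop gamma0.
pose Ga := gamma * alpha.
have Ga0 : 0 <= Ga by apply/ltW/mulr_gt0.
pose n1 : R := #|S1|%:R; pose N : R := #|channel S2 S3|%:R; pose nn : R := n%:R.
have n10 : 0 <= n1 by exact: ler0n.
have N0 : 0 <= N by exact: ler0n.
have nn0 : 0 <= nn by exact: ler0n.
have [M [M0 hM hL3M hsmooth]] := uniform_smooth oD Cf (@eball_compact R n r1) r1D.
pose KA : R := 1 + \sum_(c < #|S2|) 4 * pi * (freq2 kap c)%:R * Ga +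
   \sum_(l < #|S3|) 16 * pi ^+ 2 * (kap3 kap1 kap2 (enum_val l))%:R *
     (kap4 kap1 kap2 (enum_val l))%:R * Ga.
have pi0 : 0 <= pi :> R by exact: pi_ge0.
have p2 (c : 'I_#|S2|) : 0 <= 4 * pi * (freq2 kap c)%:R * Ga by nonneg.
have p3 (l : 'I_#|S3|) : 0 <= 16 * pi ^+ 2 * (kap3 kap1 kap2 (enum_val l))%:R *
     (kap4 kap1 kap2 (enum_val l))%:R * Ga by nonneg.
have sp2 : 0 <= \sum_(c < #|S2|) 4 * pi * (freq2 kap c)%:R * Ga by exact: sumr_ge0.
have sp3 : 0 <= \sum_(l < #|S3|) 16 * pi ^+ 2 * (kap3 kap1 kap2 (enum_val l))%:R *
     (kap4 kap1 kap2 (enum_val l))%:R * Ga by exact: sumr_ge0.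
have KA1 : 1 <= KA by rewrite /KA -addrA lerDl addr_ge0.
have KA0 : 0 <= KA by exact: le_trans KA1.
have hKA2 (c : 'I_#|S2|) : 4 * pi * (freq2 kap c)%:R * Ga <= KA.
  apply: (@le_trans _ _ (\sum_(c < #|S2|) 4 * pi * (freq2 kap c)%:R * Ga)).
    by rewrite (bigD1 c) //= lerDl; exact: sumr_ge0.
  by rewrite /KA; lra.
have hKA3 (l : 'I_#|S3|) : 16 * pi ^+ 2 * (kap3 kap1 kap2 (enum_val l))%:R *
     (kap4 kap1 kap2 (enum_val l))%:R * Ga <= KA.
  apply: (@le_trans _ _ (\sum_(l < #|S3|) 16 * pi ^+ 2 * (kap3 kap1 kap2 (enum_val l))%:R *
     (kap4 kap1 kap2 (enum_val l))%:R * Ga)).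
    by rewrite (bigD1 l) //= lerDl; exact: sumr_ge0.
  by rewrite /KA; lra.
(* The sum of the coefficients of [s ^+ 2] in [small1]; the summand 1 covers [c1 * eps]. *)
pose Kr := 4 * Mc * del ^+ 2 + 1 + n1 * Ga * M + N * M * KA.
have k1 : 0 <= 4 * Mc * del ^+ 2 by nonneg; exact: ltW.
have k2 : 0 <= n1 * Ga * M by nonneg.
have k3 : 0 <= N * M * KA by nonneg.
have Kr0 : 0 <= Kr by rewrite /Kr !addr_ge0.
exists Kr => // sigma sigma0.
pose Cb := step_const nn N n1 M KA Kr Ga Mc del.
have Cb0 : 0 <= Cb.
  have := @c1_ge0 R nn Kr Mc nn0 Kr0 Mc0; have := @c2_ge0 R n1 M Kr Ga n10 M0 Kr0 Ga0.
  move=> h2 h1; rewrite /Cb /step_const; nonneg; exact: ltW.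
(* With [eps] and [s] also at most [eta], the vanishing errors add up to at most [eps * E]; this is
   the unit subtracted from the rate in the conclusion. *)
pose eta := (3 * (nn * Cb + 1))^-1.
have nC0 : 0 < nn * Cb + 1 by rewrite ltr_wpDl // mulr_ge0.
have eta0 : 0 < eta by rewrite invr_gt0 mulr_gt0.
have [rh rh0 hrh] := hsmooth eta eta0.
(* Upper bound for [s]. The entries serve, in order: monotonicity of powers, the error budget,
   [r <= sigma], [r < rh], and half of [small2]. *)
pose sb := Num.min 1 (Num.min eta (Num.min (sigma / (Kr + 1)) (Num.min (rh / (2 * (Kr + 1)))
   (4 * (N * M * KA + 1))^-1))).
have Kr1 : 0 < Kr + 1 by exact: ltr_wpDl.
have sb0 : 0 < sb.
  rewrite !lt_min ltr01 eta0 /= !divr_gt0 ?mulr_gt0 //= invr_gt0 mulr_gt0 //; exact: ltr_wpDl.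
pose c1 := 4 * Mc * (nn * Kr) ^+ 3.
have c10 : 0 <= c1 by rewrite /c1; nonneg.
pose c4 := L * nn + n1 * Ga * del * M.
have c40 : 0 <= c4 by rewrite /c4; nonneg; exact: ltW.
(* The entries serve, in order: powers of [eps], the error budget, [c1 * eps <= 1] in [small1], the
   other half of [small2], nonnegativity of [1 - eps * gamma], and [s <= sb]. *)
exists (Num.min 1 (Num.min eta (Num.min (c1 + 1)^-1 (Num.min (4 * (c4 + 1))^-1
   (Num.min gamma^-1 (sb ^+ 6 / (del + 1))))))).
  have q1 : 0 < (c1 + 1)^-1 by rewrite invr_gt0; exact: ltr_wpDl.
  have q4 : 0 < (4 * (c4 + 1))^-1 by rewrite invr_gt0 mulr_gt0 //; exact: ltr_wpDl.
  have qs : 0 < sb ^+ 6 / (del + 1) by apply: divr_gt0; [exact: exprn_gt0|exact: addr_gt0].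
  by rewrite !lt_min ltr01 eta0 q1 q4 qs invr_gt0 gamma0.
move=> eps /andP[eps0]; rewrite !le_min => /and5P[eps1 epseta epsc1 epsc4 /andP[epsg epsb]].
move=> j p rho pdel s r t0 t1.
set E := enorm p in pdel s r *.
have E0 : 0 <= E by exact: enorm_ge0.
have s0 : 0 <= s by exact: root6_ge0.
have sE : s ^+ 6 = eps * E by exact: root6K.
have ssb : s <= sb.
  have d1 : 0 < del + 1 by exact: addr_gt0.
  suff : s ^+ 6 <= sb ^+ 6 by rewrite ler_pXn2r // nnegrE // ltW.
  rewrite sE; rewrite ler_pdivlMr // in epsb; apply: le_trans epsb.
  rewrite ler_pM2l //; apply: (le_trans pdel); by rewrite lerDl.
have [s1 seta ssig srh s4] : [/\ s <= 1, s <= eta, s <= sigma / (Kr + 1), s <= rh / (2 * (Kr + 1)) &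
    s <= (4 * (N * M * KA + 1))^-1].
  by move: ssb; rewrite !le_min => /and5P[].
have s2s : s ^+ 2 <= s by rewrite expr2 ler_piMl.
have r0 : 0 <= r by rewrite /r mulr_ge0 // exprn_ge0.
have rs : r <= Kr * s by rewrite /r ler_wpM2l.
split.
  apply: (le_trans rs); rewrite ler_pdivlMr // in ssig; apply: le_trans ssig.
  by rewrite mulrC ler_wpM2l // lerDl.
move=> hball rhor1 hg3 hgL hgm.
have hD y : cball p r y -> D y.
  move=> /hball hy; apply: r1D; exact: le_trans rhor1.
have hK y : cball p r y -> @eball R n r1 y by move=> /hball hy; exact: le_trans rhor1.
have pin : cball p r p by rewrite /cball /= subrr normr0.
have Dp : D p by exact: hD.
have rrh : r < rh.
  apply: (le_lt_trans rs); rewrite ler_pdivlMr ?mulr_gt0 // mulrCA mulrDr mulr1 in srh.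
  have := mulr_ge0 s0 Kr0; rewrite [Kr * s]mulrC; move: srh rh0 s0; clear; lra.
pose Gb := Mc * (E + nn * r) ^+ 3.
have Gb0 : 0 <= Gb by rewrite /Gb; nonneg.
have [ha1 ha2 ha3] := avec_bound gamma0 (hop p Dp).
have ynorm y : cball p r y -> enorm y <= E + nn * r.
  move=> hy; rewrite -(subrK p y) addrC (le_trans (enormD _ _)) // lerD2l.
  by rewrite (le_trans (enorm_le_norm _)) // ler_wpM2l.
have hgb t y : t0 <= t <= t1 -> cball p r y -> `|g t y| <= Gb.
  move=> ht hy; rewrite (le_trans (norm_le_enorm _)) // (le_trans (hg3 t y ht (hball y hy))) //.
  rewrite ler_wpM2l // ler_pXn2r ?nnegrE ?enorm_ge0 ?ynorm // addr_ge0 // mulr_ge0 //.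
have hgl t y z : t0 <= t <= t1 -> cball p r y -> cball p r z -> `|g t y - g t z| <= (L * nn) * `|y - z|.
  move=> ht hy hz; rewrite (le_trans (norm_le_enorm _)) //.
  rewrite (le_trans (hgL t y z ht (hball y hy) (hball z hz))) // -mulrA ler_wpM2l //.
  exact: enorm_le_norm.
have arith := @drift_arith R nn Kr Mc del E eps s nn0 Kr0 Mc0 E0 pdel (ltW eps0) s0 sE.
rewrite -/r -/c1 -/Gb in arith.
have s62 : s ^+ 6 <= s ^+ 2 by exact: (spow s0 s1).
have s20 : 0 <= s ^+ 2 by exact: exprn_ge0.
have small1 : eps * Gb + n1 * Ga * M * s ^+ 6 + N * M * (KA * s ^+ 2) <= r.
  have c1e : c1 * eps <= 1.
    have c1p : 0 < c1 + 1 by exact: ltr_wpDl.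
    apply: (@le_trans _ _ ((c1 + 1) * eps)); first by rewrite ler_pM2r // lerDl.
    by rewrite mulrC -ler_pdivlMr // mul1r.
  have h1 : s ^+ 6 * (4 * Mc * del ^+ 2 + c1 * eps) <= s ^+ 2 * (4 * Mc * del ^+ 2 + 1).
    apply: ler_pM => //; rewrite ?exprn_ge0 //; last by rewrite lerD2l.
    by rewrite addr_ge0 // mulr_ge0 // ltW.
  have h2 : n1 * Ga * M * s ^+ 6 <= n1 * Ga * M * s ^+ 2 by exact: ler_wpM2l.
  have h3 : N * M * (KA * s ^+ 2) = N * M * KA * s ^+ 2 by ring.
  rewrite h3 /r /Kr; move: arith h1 h2; clear; lra.
have small2 : eps * (L * nn + n1 * Ga * E * M) + N * M * (KA * s ^+ 2) <= 2^-1.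
  have h1 : eps * (L * nn + n1 * Ga * E * M) <= 4^-1.
    apply: (@le_trans _ _ (eps * (c4 + 1))).
      rewrite ler_pM2l // /c4; have : n1 * Ga * E * M <= n1 * Ga * del * M.
        by rewrite ler_wpM2r // ler_wpM2l // mulr_ge0.
      by move=> hh; rewrite -addrA lerD2l (le_trans hh) // lerDl.
    have c5 : 0 < c4 + 1 by exact: ltr_wpDl.
    rewrite -ler_pdivlMr //; apply: le_trans epsc4 _; rewrite invfM //.
  have h2 : N * M * (KA * s ^+ 2) <= 4^-1.
    have -> : N * M * (KA * s ^+ 2) = N * M * KA * s ^+ 2 by ring.
    have c5 : 0 < N * M * KA + 1 by exact: ltr_wpDl.
    apply: (@le_trans _ _ ((N * M * KA + 1) * s)).
      by apply: ler_pM => //; rewrite lerDl.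
    rewrite mulrC -ler_pdivlMr //; apply: le_trans s4 _; rewrite invfM //.
  have -> : 2^-1 = 4^-1 + 4^-1 :> R by field.
  exact: lerD.
have hfM i y : cball p r y -> `|f i y| <= M by move=> /hK; exact: hM.
have hL3' i k l : `|L3 f i k l p| <= M by apply: hL3M; exact: hK.
have hgm' i y : cball p r y -> measurable_fun (`[t0, t1] : set R) (fun t => g t y i 0).
  by move=> /hball; exact: hgm.
have hsm : smooth_on f p r M eta by apply: hrh => // y; exact: hK.
have [x [x0 lx xK dx err]] := @period_step R m n D f g S1 S2 S3 hn kap kap1 kap2 nonres oD Cf
  gamma eps Ga E s KA M eta r Gb (L * nn) j p eps0 E0 Ga0 s0 s1 sE KA1 M0 (ltW eta0) r0 Gb0
  (mulr_ge0 L0 nn0) hKA2 hKA3 (Fmx_unit hn (hspan p Dp)) ha1 ha2 ha3 hD hfM hL3' hsm hgb hgl hgm'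
  small1 small2.
exists x; split => //.
have A := @step_arith R nn N n1 M KA Kr Ga Mc del E eps s eta nn0 N0 n10 M0 KA0 Kr0 Ga0 Mc0 E0 pdel
  (ltW eps0) eps1 s0 s1 (ltW eta0) sE.
have {}err := le_trans err A.
have eg : 0 <= 1 - eps * gamma by rewrite subr_ge0 -ler_pdivlMr // mul1r.
have -> : x t1 = (1 - eps * gamma) *: p + (x t1 - p + (eps * gamma) *: p).
  by rewrite scalerBl scale1r [_ - p + _]addrC addrA subrK subrKC.
apply: (le_trans (enormD _ _)); rewrite enormZ (ger0_norm eg) -/E.
have h1 : enorm (x t1 - p + (eps * gamma) *: p) <= nn * (s ^+ 6 * (4 * Mc * del ^+ 2 + Cb * (eps + s + eta))).
  by rewrite (le_trans (enorm_le_norm _)) // ler_wpM2l.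
apply: (le_trans (lerD (lexx _) h1)).
have h2 : nn * (Cb * (eps + s + eta)) <= 1.
  apply: (@le_trans _ _ ((nn * Cb + 1) * (3 * eta))).
    rewrite mulrA; apply: ler_pM; [by nonneg|by rewrite !addr_ge0 // ltW|by rewrite lerDl|by move: epseta seta; clear; lra].
  by rewrite /eta mulrA [_ * 3]mulrC mulfV // lt0r_neq0 // mulr_gt0.
have eE : 0 <= eps * E by rewrite mulr_ge0 // ltW.
have h3 := ler_wpM2l eE h2.
rewrite sE /drift_rate -/nn; move: h3; clear; lra.
Qed.

(** * Concatenation of the periods *)

Section glue.
Context {R : realType} {n : nat}.
Notation V := 'cV[R]_n.
Notation mu := (@lebesgue_measure R).
Variables (eps : R) (eps0 : 0 < eps).

Lemma node_step j : eps * j%:R < eps * j.+1%:R.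
Proof. by rewrite ltr_pM2l // ltr_nat. Qed.

Lemma node_itv t : 0 <= t -> exists j, eps * j%:R <= t < eps * j.+1%:R.
Proof.
move=> t0; exists (Num.truncn (t / eps)).
have /truncn_itv : 0 <= t / eps by rewrite divr_ge0 // ltW.
by rewrite ler_pdivlMr // ltr_pdivrMr // ![_ * eps]mulrC.
Qed.

Variables (X : nat -> R -> V) (B : R).
Hypotheses (B0 : 0 <= B) (lipX : forall j u t, `|X j t - X j u| <= B * `|t - u|)
  (chainX : forall j, X j.+1 (eps * j.+1%:R) = X j (eps * j.+1%:R)).

Definition glued t := X (Num.truncn (t / eps)) t.

Lemma gluedE_lt j t : eps * j%:R <= t < eps * j.+1%:R -> glued t = X j t.
Proof.
move=> h; rewrite /glued (@truncn_def _ _ j) //.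
by rewrite ler_pdivlMr // ltr_pdivrMr // ![_ * eps]mulrC.
Qed.

Lemma gluedE j t : eps * j%:R <= t <= eps * j.+1%:R -> glued t = X j t.
Proof.
move=> /andP[h1]; rewrite le_eqVlt => /orP[/eqP ->|h2]; last by apply: gluedE_lt; rewrite h1.
by rewrite (@gluedE_lt j.+1) ?chainX // lexx node_step.
Qed.

Lemma glued_lip u t : 0 <= u -> u <= t -> `|glued t - glued u| <= B * (t - u).
Proof.
move=> u0 ut; have t0 : 0 <= t by exact: le_trans ut.
have [j /andP[jt tj]] := node_itv t0; have {jt tj} := ltW tj.
elim: j t u u0 ut {t0} => [|j IH] t u u0 ut tj.
  have h v : 0 <= v -> v <= t -> glued v = X 0%N v.
    by move=> v0 vt; apply: gluedE; rewrite mulr0 v0 (le_trans vt).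
  by rewrite !h // ?(le_trans u0) // (le_trans (lipX _ _ _)) // ger0_norm ?subr_ge0.
have [tj1|/ltW jt] := leP t (eps * j.+1%:R); first exact: IH.
have same w v : eps * j.+1%:R <= w -> w <= v -> v <= t -> `|glued v - glued w| <= B * (v - w).
  move=> jw wv vt; rewrite (@gluedE j.+1 v) ?(@gluedE j.+1 w).
  - by rewrite (le_trans (lipX _ _ _)) // ger0_norm ?subr_ge0.
  - by rewrite jw (le_trans wv) // (le_trans vt).
  - by rewrite (le_trans jw wv) (le_trans vt).
have [ju|/ltW uj] := leP (eps * j.+1%:R) u; first exact: same.
have h1 := IH _ _ u0 uj (lexx _); have h2 := same _ _ (lexx _) jt (lexx _).
rewrite (le_trans (ler_distD (glued (eps * j.+1%:R)) _ _)) //.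
by rewrite (le_trans (lerD h2 h1)) // -mulrDr addrA subrK.
Qed.

(** The left node is a null set and is discarded, as the one-sided derivatives of the glued curve
    may differ there. Strictly inside a period the curve agrees with [X j] on a neighbourhood. *)
Lemma glued_ae (F : nat -> R -> V -> V) j :
  {ae mu, forall t, eps * j%:R <= t <= eps * j.+1%:R -> is_derive t (1:R) (X j) (F j t (X j t))} ->
  {ae mu, forall t, eps * j%:R <= t < eps * j.+1%:R -> is_derive t (1:R) glued (F j t (glued t))}.
Proof.
move=> h.
have hb : {ae mu, forall t, t <> eps * j%:R}.
  exists [set eps * j%:R]; split => //; first by rewrite lebesgue_measure_set1.
  by move=> t /= /contrapT ->.
apply: (@filterS2 _ _ (ae_filter_ringOfSetsType mu) _ _ _ _ h hb).
move=> t ht tb /andP[jt tj].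
have jt' : eps * j%:R < t by rewrite lt_neqAle jt andbT eq_sym; exact/eqP.
have E := @gluedE_lt j.
rewrite E ?jt //; apply: near_eq_is_derive (ht _); last by rewrite jt ltW.
have : \forall s \near t, s \in `]eps * j%:R, eps * j.+1%:R[ by apply: near_in_itvoo; rewrite in_itv /= jt'.
by apply: filterS => s; rewrite in_itv /= => /andP[/ltW js sj]; rewrite E // js.
Qed.

End glue.

(** * Uniqueness of the sampled solution *)

Section regularity.
Context {R : realType} {n : nat}.
Notation V := 'cV[R]_n.

Lemma lip_abs_continuous (x : R -> V) (B : R) : 0 <= B ->
  (forall u t, 0 <= u -> u <= t -> `|x t - x u| <= B * (t - u)) -> forall T, abs_continuous x T.
Proof.
move=> B0 hx T e e0.
have n0 : 0 <= n%:R * B by rewrite mulr_ge0.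
have n1 : 0 < n%:R * B + 1 by rewrite ltr_wpDl.
exists (e / (n%:R * B + 1)) => [|N a b hab _]; first exact: divr_gt0.
rewrite ltr_pdivlMr // => hs.
have S0 : 0 <= \sum_i (b i - a i) by apply: sumr_ge0 => i _; have := hab i; lra.
apply: le_lt_trans hs; apply: (@le_trans _ _ (\sum_i (n%:R * B * (b i - a i)))).
  apply: ler_sum => i _; have [a0 [ab _]] := hab i.
  by rewrite (le_trans (enorm_le_norm _)) // -mulrA ler_wpM2l // hx.
by rewrite -mulr_sumr mulrC ler_wpM2l // lerDl.
Qed.

Lemma abs_continuous_ac (x : R -> V) (a b : R) : 0 <= a -> abs_continuous x b -> ac_on x a b.
Proof.
move=> a0 h e /h [d d0 hd]; exists d => // N s t hst tr ds.
apply: le_lt_trans (hd N s t _ tr ds); first by apply: ler_sum => i _; exact: norm_le_enorm.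
by move=> i; have := hst i; lra.
Qed.

Lemma C1_locally_lipschitz (I : finType) (D : set V) (f : I -> V -> V) (p : V) :
  open D -> (forall i, Ck 1 D (f i)) -> D p -> exists r M : R, 0 < r /\
  forall i u w, `|u - p| < r -> `|w - p| < r -> `|f i u - f i w| <= M * `|u - w|.
Proof.
move=> oD Cf Dp.
pose dd (ci : I * 'I_n) := 'D_(delta_mx ci.2 0 : V) (f ci.1).
have [r r0 hr] := open_cball oD Dp.
have : nbhs p [set y | forall ci, `|dd ci y - dd ci p| < 1].
  apply: (@filter_forall _ _ (fun ci y => `|dd ci y - dd ci p| < 1) (nbhs p) (nbhs_filter p)) => ci.
  have /cont_eps /(_ 1 ltr01) [d d0 hd] : {for p, continuous (dd ci)}.
    by apply: Ck_cont Dp; exact: Ck_partial.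
  by apply/nbhs_ballP; exists d => // y; rewrite -ball_normE /= distrC; exact: hd.
move=> /nbhs_ballP[d /= d0 hd].
pose M1 := 1 + \sum_ci `|dd ci p|.
exists (Num.min d r / 2), (n%:R * M1); split; first by rewrite divr_gt0 // lt_min d0.
have mr0 : 0 < Num.min d r by rewrite lt_min d0.
move=> i u w up wp.
apply: (@mvi_diff R V V (f i) p (Num.min d r / 2)); last 2 first.
- exact: ltW.
- exact: ltW.
move=> y; rewrite /cball /= => yp.
have {yp} : `|y - p| < Num.min d r by apply: (le_lt_trans yp); lra.
rewrite lt_min => /andP[yd yr].
have [df hdf] := C1_diff oD (Cf i) (hr y yr); split => // h.
have -> : n%:R * M1 * `|h| = #|'I_n|%:R * (M1 * `|h|) by rewrite card_ord mulrA.
rewrite hdf; apply: ler_sum_const => k.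
rewrite normrZ mulrC; apply: ler_pM => //; last exact: cVnorm_ge.
have hy : `|dd (i, k) y - dd (i, k) p| < 1 by apply: hd; rewrite -ball_normE /= distrC.
have h2 : `|dd (i, k) y| <= `|dd (i, k) y - dd (i, k) p| + `|dd (i, k) p|.
  by rewrite -[X in `|X| <= _](subrK (dd (i, k) p)) ler_normD.
have h3 : `|dd (i, k) p| <= \sum_ci `|dd ci p| by rewrite (bigD1 (i, k)) //= lerDl sumr_ge0.
by rewrite /M1 (le_trans h2) // lerD // ltW.
Qed.

End regularity.

Section bounded.
Context {R : realType}.

(** Boundedness in time of the control at a frozen state makes the right-hand side Lipschitz in
    space uniformly over a period, as the uniqueness argument requires. *)
Definition bounded_line (F : R -> R) := exists C : R, forall t, `|F t| <= C.

Lemma bounded_line_cst c : bounded_line (fun=> c). Proof. by exists `|c|. Qed.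

Lemma bounded_lineD F G : bounded_line F -> bounded_line G -> bounded_line (fun t => F t + G t).
Proof.
by move=> [C hC] [C' hC']; exists (C + C') => t; apply: le_trans (ler_normD _ _) (lerD _ _).
Qed.

Lemma bounded_lineM F G : bounded_line F -> bounded_line G -> bounded_line (fun t => F t * G t).
Proof. by move=> [C hC] [C' hC']; exists (C * C') => t; rewrite normrM; exact: ler_pM. Qed.

Lemma bounded_line_sum (I : finType) (F : I -> R -> R) : (forall i, bounded_line (F i)) ->
  bounded_line (fun t => \sum_i F i t).
Proof.
move=> /choice[C hC]; exists (\sum_i C i) => t.
by rewrite (le_trans (ler_norm_sum _ _ _)) // ler_sum.
Qed.

Lemma bounded_line_cos w : bounded_line (fun t => cos (w * t)).
Proof. by exists 1 => t; exact: cos_max. Qed.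

Lemma bounded_line_sin w : bounded_line (fun t => sin (w * t)).
Proof. by exists 1 => t; exact: sin_max. Qed.

End bounded.

Section uniqueness.
Context {R : realType} {m n : nat}.
Notation V := 'cV[R]_n.

Lemma control_bounded (f : 'I_m -> V -> V) (S1 : {set 'I_m}) (S2 : {set 'I_m * 'I_m})
  (S3 : {set 'I_m * 'I_m * 'I_m}) (hn : (#|S1| + #|S2| + #|S3|)%N = n) kap kap1 kap2 gamma eps k p :
  bounded_line (fun t => control f hn kap kap1 kap2 gamma eps k t p).
Proof.
have cs (a : R) F : bounded_line F -> bounded_line (fun t => a * F t).
  by apply: bounded_lineM; exact: bounded_line_cst.
have C := @bounded_line_cos R; have S := @bounded_line_sin R.
apply: bounded_lineD; first apply: bounded_lineD.
- exact: bounded_line_cst.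
- apply: (cs); apply: bounded_line_sum => c; apply: (cs); apply: (cs).
  by apply: bounded_lineD; apply: (cs).
- apply: (cs); apply: bounded_line_sum => c; apply: (cs); apply: (cs).
  apply: bounded_lineD; first by apply: bounded_lineD; apply: (cs).
  by apply: (cs); exact: bounded_lineM.
Qed.

(** The input on a period depends on the sampled state, so agreement at a node is what makes both
    curves solve the same equation on the period that follows; hence the induction over nodes. *)
Lemma pi_unique (D : set V) (g : R -> V -> V) (f : 'I_m -> V -> V) (h : 'I_m -> R -> V -> R)
    (eps : R) (x0 : V) (x y : R -> V) :
  0 < eps -> open D -> (forall i, Ck 1 D (f i)) -> caratheodory_lipschitz D g ->
  (forall i p, bounded_line (fun t => h i t p)) ->
  pi_solution D g f h eps x0 x -> pi_solution D g f h eps x0 y -> forall t, 0 <= t -> y t = x t.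
Proof.
move=> eps0 oD Cf [_ gL] hb [Dx acx x00 dx] [Dy acy y00 dy].
have node0 j : 0 <= eps * j%:R by rewrite mulr_ge0 // ltW.
have step j : y (eps * j%:R) = x (eps * j%:R) ->
    forall t, eps * j%:R <= t <= eps * j.+1%:R -> y t = x t.
  move=> yx; set p := x (eps * j%:R) in yx.
  pose G t u := g t u + \sum_i h i t p *: f i u.
  apply: (@ode_unique _ _ G D) => //.
  - by rewrite ltW // node_step.
  - exact: abs_continuous_ac.
  - exact: abs_continuous_ac.
  - by move=> t /andP[jt _]; have t0 := le_trans (node0 j) jt; split; [exact: Dy|exact: Dx].
  - by apply: ae_closed_itv; have := dy j; rewrite yx.
  - by apply: ae_closed_itv; exact: dx j.
  move=> s /andP[js _]; have Ds := Dx _ (le_trans (node0 j) js).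
  have [rg [Lg [rg0 hg]]] := gL _ (eps * j.+1%:R) Ds.
  have [rf [M [rf0 hf]]] := C1_locally_lipschitz oD Cf Ds.
  have [C hC] : exists C : R, forall i t, `|h i t p| <= C.
    have /choice[C hC] : forall i, bounded_line (fun t => h i t p) by move=> i; exact: hb.
    exists (\sum_i `|C i|) => i t; rewrite (le_trans (hC i t)) // (le_trans (ler_norm _)) //.
    by rewrite (bigD1 i) //= lerDl sumr_ge0.
  have n1 : 0 < n%:R + 1 :> R by rewrite ltr_wpDl.
  exists (Num.min rf (rg / (n%:R + 1))), (`|Lg| * n%:R + m%:R * (C * `|M|)).
  split=> [|t u w ht Du Dw]; first by rewrite lt_min rf0 divr_gt0.
  rewrite !lt_min => /andP[u1 u2] /andP[w1 w2].
  have hr (v : V) : `|v| < rg / (n%:R + 1) -> enorm v < rg.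
    rewrite ltr_pdivlMr // => hv; apply: le_lt_trans (enorm_le_norm v) _; apply: le_lt_trans hv.
    by rewrite [leLHS]mulrC; apply: ler_wpM2l => //; rewrite lerDl.
  have t0 : 0 <= t <= eps * j.+1%:R by case/andP: ht => jt ->; rewrite (le_trans (node0 j)).
  have h1 : `|g t u - g t w| <= `|Lg| * n%:R * `|u - w|.
    rewrite (le_trans (norm_le_enorm _)) // (le_trans (hg t u w t0 Du Dw (hr _ u2) (hr _ w2))) //.
    rewrite -mulrA (le_trans (ler_wpM2r (enorm_ge0 _) (ler_norm Lg))) //.
    by apply: ler_wpM2l => //; exact: enorm_le_norm.
  have h2 : `|\sum_i h i t p *: f i u - \sum_i h i t p *: f i w| <= m%:R * (C * `|M|) * `|u - w|.
    rewrite -sumrB -mulrA -[X in X%:R * _](card_ord m); apply: ler_sum_const => i.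
    rewrite -scalerBr normrZ -mulrA; apply: ler_pM => //.
    by rewrite (le_trans (hf i _ _ u1 w1)) // ler_wpM2r // ler_norm.
  rewrite /G opprD addrACA mulrDl (le_trans (ler_normD _ _)) //; exact: lerD.
have node j : y (eps * j%:R) = x (eps * j%:R).
  elim: j => [|j IH]; first by rewrite mulr0 x00 y00.
  by apply: (step j IH); rewrite lexx ltW // node_step.
move=> t t0; have [j /andP[jt tj]] := node_itv eps0 t0.
by apply: (step j (node j)); rewrite jt ltW.
Qed.

End uniqueness.

(** * Uniform estimates of the drift *)

Section constants.
Context {R : realType} {n : nat}.
Notation V := 'cV[R]_n.

(** A state of norm [delta] may leave the ball within a period, so room inside [D] is needed. Points
    of the shell are compared with their radial projection onto the sphere of radius [delta]. *)
Lemma eball_thicken (D : set V) (delta : R) : open D -> 0 < delta -> @eball R n delta `<=` D ->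
  exists2 r : R, delta < r & @eball R n r `<=` D.
Proof.
move=> oD delta0 dD.
have [d d0 hd] := compact_thicken (@eball_compact R n delta) oD dD.
exists (delta + d / 2) => [|y yr]; first by lra.
have [/dD //|dy] := leP (enorm y) delta.
have y0 : 0 < enorm y by exact: lt_trans dy.
have c0 : 0 <= delta / enorm y by rewrite divr_ge0 // ltW.
apply: (hd ((delta / enorm y) *: y)).
  by rewrite /eball /= enormZ ger0_norm // divfK // gt_eqF.
apply: le_lt_trans (norm_le_enorm _) _.
rewrite -{1}[y]scale1r -scalerBl enormZ ger0_norm; last by rewrite subr_ge0 ler_pdivrMr // mul1r ltW.
rewrite mulrBl mul1r divfK ?gt_eqF //; move: yr; rewrite /eball /=; lra.
Qed.

(** The given drift bounds reach only to [delta0]. Farther out, [g t 0 = 0] and a Lipschitz constant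
    [Lr] give the bound [Lr * enorm y], which is at most [Lr / r0 ^+ 2 * enorm y ^+ 3] once
    [r0 <= enorm y]. That constant is obtained on bounded times only, whence the alternative for
    [rho]. *)
Lemma drift_constants (D : set V) (g : R -> V -> V) (Mg Lg delta0 delta : R) :
  open D -> caratheodory_lipschitz D g -> 0 <= Mg -> 0 <= Lg -> 0 < delta0 ->
  (forall t x, 0 <= t -> (eball delta0 `&` D) x -> enorm (g t x) <= Mg * enorm x ^+ 3) ->
  (forall t x y, 0 <= t -> (eball delta0 `&` D) x -> (eball delta0 `&` D) y ->
     enorm (g t x - g t y) <= Lg * enorm (x - y)) ->
  0 < delta -> @eball R n delta `<=` D ->
  exists r0 r1 Mc L : R, [/\ 0 < r0 <= r1, delta < r1, @eball R n r1 `<=` D, 0 <= Mc /\ 0 <= L &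
    forall t rho, 0 <= t -> (rho = r0) \/ (rho = r1 /\ t <= 2) ->
      (forall y, eball rho y -> enorm (g t y) <= Mc * enorm y ^+ 3) /\
      (forall y z, eball rho y -> eball rho z -> enorm (g t y - g t z) <= L * enorm (y - z))].
Proof.
move=> oD cg Mg0 Lg0 d00 g3 gl d0 dD.
have [r1 dr1 r1D] := eball_thicken oD d0 dD.
have [Lr Lr0 hLr] := drift_lipschitz 2 cg r1D.
pose r0 := Num.min delta0 r1.
have r00 : 0 < r0 by rewrite lt_min d00 (lt_trans d0).
have in0 y : eball r0 y -> (eball delta0 `&` D) y.
  by rewrite /eball /= le_min => /andP[h1 /r1D h2].
have z0 : @eball R n r0 0 by rewrite /eball /= enorm0 ltW.
have z1 : @eball R n r1 0 by rewrite /eball /= enorm0 (le_trans (ltW d0)) // ltW.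
have g0 t : 0 <= t -> g t 0 = 0.
  move=> t0; apply: enorm_eq0; apply/eqP; rewrite eq_le enorm_ge0 andbT.
  by have := g3 t 0 t0 (in0 _ z0); rewrite enorm0 expr0n mulr0.
have Mc0 : 0 <= Num.max Mg (Lr / r0 ^+ 2) by rewrite le_max Mg0.
exists r0, r1, (Num.max Mg (Lr / r0 ^+ 2)), (Num.max Lr Lg).
split => //; first by rewrite r00 ge_min lexx orbT.
  by split => //; rewrite le_max Lr0.
have small t y : 0 <= t -> eball r0 y -> enorm (g t y) <= Num.max Mg (Lr / r0 ^+ 2) * enorm y ^+ 3.
  move=> t0 /in0 hy; rewrite (le_trans (g3 t y t0 hy)) // ler_wpM2r ?exprn_ge0 ?enorm_ge0 //.
  by rewrite le_max lexx.
move=> t rho t0 [->|[-> t2]]; split.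
- by move=> y; exact: small.
- move=> y z /in0 hy /in0 hz; rewrite (le_trans (gl t y z t0 hy hz)) // ler_wpM2r ?enorm_ge0 //.
  by rewrite le_max lexx orbT.
- move=> y hy; have [yr|/ltW ry] := leP (enorm y) r0; first exact: small.
  have := hLr t y 0; rewrite g0 // !subr0 t0 t2 => /(_ isT hy z1) h; apply: (le_trans h).
  apply: (@le_trans _ _ (Lr / r0 ^+ 2 * enorm y ^+ 3)); last first.
    by rewrite ler_wpM2r ?exprn_ge0 ?enorm_ge0 // le_max lexx orbT.
  rewrite [enorm y ^+ 3]exprS mulrCA [leLHS]mulrC ler_wpM2l ?enorm_ge0 // mulrAC -mulrA.
  rewrite ler_peMr // ler_pdivlMr ?exprn_gt0 // mul1r ler_pXn2r // nnegrE ?enorm_ge0 //; exact: ltW.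
- move=> y z hy hz; have ht : 0 <= t <= 2 by rewrite t0.
  rewrite (le_trans (hLr t y z ht hy hz)) // ler_wpM2r ?enorm_ge0 //.
  by rewrite le_max lexx.
Qed.

(** The excursion is of the order of the cube root of the sampled norm: if that norm decays like
    [c ^+ 3], the excursion decays like [c]. The factor [1 + del] stands in for the cube root of
    [del]. *)
Lemma root6_decay (eps E del c : R) : 0 < eps <= 1 -> 0 <= E -> 0 <= c -> 0 < del ->
  E <= c ^+ 3 * del -> root6 eps E ^+ 2 <= (1 + del) * c.
Proof.
move=> /andP[e0 e1] E0 c0 d0 hE.
have d1 : 0 <= (1 + del) * c by rewrite mulr_ge0 // addr_ge0 // ltW.
suff : (root6 eps E ^+ 2) ^+ 3 <= ((1 + del) * c) ^+ 3.
  by rewrite ler_pXn2r // nnegrE // exprn_ge0 // root6_ge0.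
rewrite -exprM root6K // exprMn mulrC.
apply: (@le_trans _ _ E); first by rewrite ler_piMr.
apply: (le_trans hE); rewrite mulrC ler_wpM2r ?exprn_ge0 //.
apply: (@le_trans _ _ (1 + del)); first by rewrite lerDr.
by rewrite -[leLHS]expr1 ler_weXn2l // lerDl ltW.
Qed.

End constants.

(** * Choice of the gain and exponential decay *)

Section corollary.
Context {R : realType} {n : nat}.
Notation V := 'cV[R]_n.

(** Dependent choice with an invariant: a curve is chosen for all pairs of a period and a state at
    once, with the zero curve as default where the invariant fails. *)
Lemma dependent_steps (I : nat -> V -> Prop) (Q : nat -> V -> (R -> V) -> Prop) (node : nat -> R) (x0 : V) :
  (forall j p, I j p -> exists x, Q j p x) ->
  (forall j p x, I j p -> Q j p x -> I j.+1 (x (node j.+1))) -> I 0%N x0 ->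
  exists (P : nat -> V) (X : nat -> R -> V), [/\ P 0%N = x0,
    forall j, P j.+1 = X j (node j.+1), forall j, I j (P j) & forall j, Q j (P j) (X j)].
Proof.
move=> step next I0.
have /choice[F hF] : forall jp : nat * V, exists x, I jp.1 jp.2 -> Q jp.1 jp.2 x.
  move=> [j p] /=; have [/step[x hx]|nI] := pselect (I j p); first by exists x.
  by exists (fun=> 0).
pose P := fix P j := if j is j'.+1 then F (j', P j') (node j'.+1) else x0.
have IP j : I j (P j).
  by elim: j => [//|j IH]; exact: next IH (hF (j, P j) IH).
by exists P, (fun j => F (j, P j)); split => // j; exact: hF (j, P j) (IP j).
Qed.

Lemma expR_decay_node (eps la t : R) j : 0 < eps -> 0 <= la -> t <= eps * j.+1%:R ->
  expR (- (la * (eps * j%:R))) <= expR (la * eps) * expR (- (la * t)).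
Proof.
move=> e0 l0 tj; rewrite -expRD ler_expR.
have : la * t <= la * (eps * j.+1%:R) by rewrite ler_wpM2l.
rewrite -natr1 mulrDr mulr1 mulrDr; lra.
Qed.

End corollary.

Theorem corollary1 (R : realType) (m n : nat) (D : set 'cV[R]_n)
    (f : 'I_m -> 'cV[R]_n -> 'cV[R]_n) (g : R -> 'cV[R]_n -> 'cV[R]_n)
    (S1 : {set 'I_m}) (S2 : {set 'I_m * 'I_m}) (S3 : {set 'I_m * 'I_m * 'I_m})
    (hn : (#|S1| + #|S2| + #|S3|)%N = n)
    (kap : 'I_m * 'I_m -> nat) (kap1 kap2 : 'I_m * 'I_m * 'I_m -> nat)
    (alpha Mg Lg delta0 : R) :
  open D ->
  (forall i, Ck 3 D (f i)) ->
  caratheodory_lipschitz D g ->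
  (forall x, D x -> (<<fields_at f S1 S2 S3 x>> = fullv)%VS) ->
  0 < alpha ->
  (forall x, D x -> opnorm (invmx (Fmx f hn x)) <= alpha) ->
  0 <= Mg -> 0 <= Lg -> 0 < delta0 ->
  (forall (t : R) x, 0 <= t -> (eball delta0 `&` D) x ->
     enorm (g t x) <= Mg * enorm x ^+ 3) ->
  (forall (t : R) x y, 0 <= t -> (eball delta0 `&` D) x -> (eball delta0 `&` D) y ->
     enorm (g t x - g t y) <= Lg * enorm (x - y)) ->
  nonresonant S2 S3 kap kap1 kap2 ->
  forall delta : R, 0 < delta -> eball delta `<=` D ->
  exists gamma epsbar : R, 0 < gamma /\ 0 < epsbar /\
    forall eps : R, 0 < eps <= epsbar ->
    forall x0 : 'cV[R]_n, eball delta x0 ->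
    let h := control f hn kap kap1 kap2 gamma eps in
    exists x : R -> 'cV[R]_n,
      [/\ pi_solution D g f h eps x0 x,
          forall y, pi_solution D g f h eps x0 y ->
            forall t : R, 0 <= t -> y t = x t &
          exists2 lambda : R, 0 < lambda &
            (fun t : R => enorm (x t)) =O_ (pinfty_nbhs R) (fun t : R => expR (- (lambda * t)))].
Proof.
move=> oD Cf3 cg hspan alpha_gt0 hop Mg0 Lg0 d00 g3 gl nonres delta delta_gt0 dD.
have Cf2 i : Ck 2 D (f i) by exact/CkW/Cf3.
have Cf1 i : Ck 1 D (f i) by exact/CkW.
have [r0 [r1 [Mc [L [/andP[r00 r01] dr1 r1D [Mc0 L0] hg]]]]] :=
  drift_constants oD cg Mg0 Lg0 d00 g3 gl delta_gt0 dD.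
have n0 : 0 <= n%:R :> R by exact: ler0n.
have n1 : 0 < n%:R + 1 :> R by rewrite ltr_wpDl.
(* With this rate the state enters the ball of radius r0 / 2 by time 1; before that the
   bounds on the drift are only needed on the compact time interval [0, 2]. *)
pose lam := 2 * delta / r0.
have lam0 : 0 < lam by rewrite divr_gt0 // mulr_gt0.
pose b := drift_rate n delta Mc.
have b0 : 0 <= b.
  by rewrite /b /drift_rate; apply: mulr_ge0 => //; rewrite !mulr_ge0 ?exprn_ge0 // ltW.
(* One period contracts the norm by [1 - eps * (gamma - b - 1)]: [b] compensates the drift, the unit
   absorbs the errors, and the rate [lam] remains. *)
pose gamma := b + 1 + lam.
have gamma0 : 0 < gamma by rewrite /gamma; lra.
have [Kr Kr0 hKr] :=
  uniform_step g nonres oD Cf2 alpha_gt0 delta_gt0 r1D Mc0 L0 hspan hop gamma0.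
(* An excursion of size [sigma] in the sup norm changes the Euclidean norm by at most
   [n%:R * sigma], so it leads from the ball of radius [delta] at most to [r1], and from that of
   radius [r0 / 2] at most to [r0]. *)
pose sigma := Num.min ((r1 - delta) / (n%:R + 1)) (r0 / 2 / (n%:R + 1)).
have sigma0 : 0 < sigma by rewrite lt_min !divr_gt0 // subr_gt0.
have nsig : n%:R * sigma <= r1 - delta /\ n%:R * sigma <= r0 / 2.
  have h u : 0 < u -> sigma <= u / (n%:R + 1) -> n%:R * sigma <= u.
    move=> u0; rewrite ler_pdivlMr // => h; apply: le_trans h.
    by rewrite [leLHS]mulrC ler_wpM2l ?(ltW sigma0) // lerDl.
  by split; apply: h; rewrite ?subr_gt0 ?divr_gt0 // /sigma ge_min lexx ?orbT.
have [eps1 eps10 heps] := hKr sigma sigma0.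
exists gamma, (Num.min eps1 1); split => //; split; first by rewrite lt_min eps10 ltr01.
move=> eps /andP[eps0]; rewrite le_min => /andP[epse1 epsl1] x0 hx0 h.
have step1 := heps eps; rewrite eps0 epse1 in step1; have {}step1 := step1 isT.
pose node j : R := eps * j%:R.
have node0 j : 0 <= node j by rewrite mulr_ge0 // ltW.
have elam (t : R) : 0 <= t -> expR (- (lam * t)) <= 1.
  by move=> t0; rewrite -expR0 ler_expR oppr_le0 mulr_ge0 // ltW.
pose I j (p : 'cV[R]_n) := enorm p <= expR (- (lam * node j)) * delta.
pose Q j (p : 'cV[R]_n) (x : R -> 'cV[R]_n) := [/\ x (node j) = p,
  forall u t, `|x t - x u| <= sigma / eps * `|t - u|,
  forall t, node j <= t <= node j.+1 -> D (x t) /\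
     enorm (x t) <= enorm p + n%:R * (Kr * root6 eps (enorm p) ^+ 2),
  {ae @lebesgue_measure R, forall t, node j <= t <= node j.+1 -> is_derive t (1:R) x
       (g t (x t) + \sum_i h i t p *: f i (x t))} &
  enorm (x (node j.+1)) <= expR (- (lam * eps)) * enorm p].
have step j p : I j p -> exists x, Q j p x.
  move=> Ip.
  have pdel : enorm p <= delta.
    by apply: (le_trans Ip); rewrite ler_piMl ?elam // ltW.
  (* Periods that start by time 1 are run in the large ball; as [eps <= 1] they end by time 2, where
     the drift estimates on that ball are still available. Later periods start in the ball of radius
     [r0 / 2]. *)
  pose rho := if node j <= 1 then r1 else r0.
  have rhoP : rho = r0 \/ (rho = r1 /\ node j.+1 <= 2).
    rewrite /rho; case: ifP => hj; [right|by left]; split => //.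
    by move: hj epsl1; rewrite /node -natr1 mulrDr mulr1; clear; lra.
  have rhor1 : rho <= r1 by rewrite /rho; case: ifP.
  have [rsig step2] := step1 j p rho pdel.
  have rs0 : 0 <= Kr * root6 eps (enorm p) ^+ 2 by rewrite mulr_ge0 // exprn_ge0 // root6_ge0.
  have near y : cball p (Kr * root6 eps (enorm p) ^+ 2) y ->
      enorm y <= enorm p + n%:R * (Kr * root6 eps (enorm p) ^+ 2).
    move=> hy; rewrite -[y in enorm y](subrK p) addrC (le_trans (enormD _ _)) // lerD2l.
    by rewrite (le_trans (enorm_le_norm _)) // ler_wpM2l.
  have inr y : cball p (Kr * root6 eps (enorm p) ^+ 2) y -> eball rho y.
    move=> /near hy; apply: (le_trans hy).
    apply: (@le_trans _ _ (enorm p + n%:R * sigma)); first by rewrite lerD2l ler_wpM2l.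
    rewrite /rho; case: ifP => hj; first by case: nsig pdel => + _; clear; lra.
    have hj' : 1 <= node j by rewrite leNgt; apply/negP => /ltW; rewrite hj.
    have pr : enorm p <= r0 / 2.
      apply: (le_trans Ip); apply: (@le_trans _ _ (expR (- lam) * delta)).
        apply: ler_wpM2r; first exact: ltW.
        by rewrite ler_expR lerN2; apply: ler_peMr => //; exact: ltW.
      (* By the choice of [lam], [delta] equals [r0 / 2 * lam], and [lam <= expR lam]. *)
      rewrite expRN mulrC ler_pdivrMr ?expR_gt0 //.
      apply: (@le_trans _ _ (r0 / 2 * lam)).
        have -> : r0 / 2 * lam = delta by rewrite /lam; field; rewrite lt0r_neq0.
        exact: lexx.
      rewrite ler_wpM2l ?divr_ge0 ?(ltW r00) //; apply: le_trans (expR_ge1Dx lam).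
      by rewrite lerDr.
    by case: nsig pr => _; clear; lra.
  have tin (t : R) : node j <= t <= node j.+1 -> 0 <= t /\ (rho = r0 \/ (rho = r1 /\ t <= 2)).
    move=> /andP[jt tj]; split; first exact: le_trans jt.
    by case: rhoP => [->|[-> t2]]; [left|right; split => //; exact: le_trans t2].
  have meas i y : eball rho y -> measurable_fun (`[node j, node j.+1] : set R) (fun t => g t y i 0).
    move=> hy; have Dy : D y by apply: r1D; exact: le_trans rhor1.
    apply: measurable_funS (cg.1 y i Dy) => //.
    by move=> t /=; rewrite !in_itv /= andbT => /andP[jt _]; exact: le_trans jt.
  have [x [xp xl xc xd xe]] := step2 inr rhor1
    (fun t y ht => (hg t rho (tin t ht).1 (tin t ht).2).1 y)
    (fun t y z ht => (hg t rho (tin t ht).1 (tin t ht).2).2 y z)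
    meas.
  exists x; split => //.
  - move=> u t; apply: (le_trans (xl u t)); rewrite ler_wpM2r // ler_pM2r // invr_gt0 //.
  - move=> t ht; have hc := xc t ht; split; last exact: near.
    by apply: r1D; apply: (le_trans (inr _ hc)).
  - apply: (le_trans xe); rewrite ler_wpM2r ?enorm_ge0 //.
    apply: le_trans (expR_ge1Dx _); rewrite -/b /gamma; clear; lra.
have next j p x : I j p -> Q j p x -> I j.+1 (x (node j.+1)).
  move=> Ip [_ _ _ _ hx]; apply: (le_trans hx).
  apply: (@le_trans _ _ (expR (- (lam * eps)) * (expR (- (lam * node j)) * delta))).
    by rewrite ler_wpM2l // expR_ge0.
  rewrite mulrA -expRD ler_wpM2r ?(ltW delta_gt0) // ler_expR /node -natr1; clear; lra.
have I0 : I 0%N x0 by rewrite /I /node mulr0 mulr0 oppr0 expR0 mul1r.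
have [P [X [P0 PS IP QP]]] := dependent_steps step next I0.
have sB : 0 <= sigma / eps by rewrite divr_ge0 // ltW.
have lipX j u t : `|X j t - X j u| <= sigma / eps * `|t - u| by case: (QP j).
have chainX j : X j.+1 (eps * j.+1%:R) = X j (eps * j.+1%:R).
  by case: (QP j.+1) => ->; rewrite PS.
pose x := glued eps X.
have xE j t : eps * j%:R <= t <= eps * j.+1%:R -> x t = X j t by exact: gluedE.
have xP j : x (eps * j%:R) = P j.
  by rewrite (xE j) ?lexx ?ltW ?node_step //; case: (QP j).
have solx : pi_solution D g f h eps x0 x.
  split.
  - move=> t t0; have [j /andP[jt /ltW tj]] := node_itv eps0 t0.
    have ht : eps * j%:R <= t <= eps * j.+1%:R by rewrite jt.
    by rewrite (xE j t ht); case: (QP j) => _ _ /(_ t ht)[].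
  - apply: (lip_abs_continuous sB) => u t u0 ut; exact: glued_lip.
  - by have := xP 0%N; rewrite mulr0 P0.
  move=> j; rewrite xP.
  apply: (@glued_ae R n eps eps0 X (fun j t u => g t u + \sum_i h i t (P j) *: f i u)).
  by case: (QP j).
exists x; split => //.
  move=> y soly; apply: (pi_unique eps0 oD Cf1 cg _ solx soly) => i p.
  exact: control_bounded.
have la0 : 0 < lam / 3 by rewrite divr_gt0.
(* Within a period the distance to the sampled state is of the order of the cube root of its norm,
   so a third of the rate along the nodes survives. *)
exists (lam / 3) => //.
(* The exponential factor pays for comparing [t] with the node on its left. *)
pose C := (delta + n%:R * (Kr * (1 + delta))) * expR (lam / 3 * eps).
have C0 : 0 < C.
  apply: mulr_gt0; last exact: expR_gt0.
  by apply: ltr_wpDr => //; rewrite !mulr_ge0 // addr_ge0 // ltW.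
apply/eqO_exP; exists C => //.
have : \forall t \near +oo, 0 <= t :> R by exact: nbhs_pinfty_ge.
apply: filterS => t t0; rewrite !ger0_norm ?enorm_ge0 ?expR_ge0 //.
have [j /andP[jt /ltW tj]] := node_itv eps0 t0.
have ht : eps * j%:R <= t <= eps * j.+1%:R by rewrite jt.
rewrite (xE j t ht).
have [_ /(_ t ht)[_ hx] _ _] : [/\ True, forall t, node j <= t <= node j.+1 -> D (X j t) /\
     enorm (X j t) <= enorm (P j) + n%:R * (Kr * root6 eps (enorm (P j)) ^+ 2), True & True].
  by case: (QP j).
apply: (le_trans hx).
pose c := expR (- (lam / 3 * (eps * j%:R))).
have c0 : 0 <= c by exact: expR_ge0.
have c1 : c <= 1 by rewrite /c -[leRHS]expR0 ler_expR oppr_le0 mulr_ge0 ?node0 // ltW.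
have Pc : enorm (P j) <= c ^+ 3 * delta.
  rewrite /c -expRM_natl; apply: (le_trans (IP j)).
  by rewrite ler_wpM2r ?(ltW delta_gt0) // ler_expR /node; clear; lra.
have epsI : 0 < eps <= 1 by rewrite eps0.
have hs := root6_decay epsI (enorm_ge0 (P j)) c0 delta_gt0 Pc.
have Pc1 : enorm (P j) <= delta * c.
  apply: (le_trans Pc); rewrite mulrC ler_wpM2l ?(ltW delta_gt0) //.
  by rewrite exprS ler_piMr // exprn_ile1.
apply: (@le_trans _ _ ((delta + n%:R * (Kr * (1 + delta))) * c)).
  rewrite mulrDl; apply: lerD => //; rewrite -!mulrA; apply: ler_wpM2l => //.
  exact: ler_wpM2l.
rewrite /C -[leRHS]mulrA; apply: ler_wpM2l; last exact: expR_decay_node (ltW la0) tj.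
by rewrite addr_ge0 ?(ltW delta_gt0) // !mulr_ge0 // addr_ge0 // ltW.
Qed.
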